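(* Let $n\ge 2$, $G=\mathrm{Spin}(2n,1)$, let $a_1>a_2>\cdots>a_{n-1}>0$ and $a_n>0$ be real numbers, $\vec a=(a_1,\dots,a_n)$, $f=\iota(t'_{\vec a})\in\mathfrak g^*$, and $\mathcal O_f=G\cdot f$. The image $q(\mathcal O_f)$ of the moment map $q:\mathcal O_f\to\mathfrak p^*$ consists of two depth zero orbits $P\cdot q(f)$, $P\cdot q(g'_\infty\cdot f)$, and all depth one coadjoint $P$-orbits with singular values $(x_1,\dots,x_{n-1})$ such that $$a_1\ge x_1\ge a_2\ge x_2\ge\cdots\ge a_{n-1}\ge x_{n-1}\ge0.$$ Moreover, $q$ maps different $P$-orbits in $\mathcal O_f$ to different $P$-orbits in $\mathfrak p^*$.
   Context: Put $m=2n-1$. $G=\mathrm{Spin}(m+1,1)$ is the two-fold covering of $G_1=\mathrm{SO}_e(m+1,1)$, the identity component of $\{X\in M_{m+2}(\mathbb{R}):XI_{m+1,1}X^t=I_{m+1,1}\}$, $I_{m+1,1}=\mathrm{diag}(1,\dots,1,-1)$; $\mathfrak g=\mathfrak{so}(m+1,1)$. $H_0$ has only nonzero entries $1$ at positions $(m+1,m+2),(m+2,m+1)$; $\mathfrak a=\mathbb{R}H_0$; $\mathfrak m=\mathfrak{so}(m)$ (upper-left block); for a row vector $\alpha\in\mathbb{R}^m$, $X_\alpha=\begin{pmatrix}0_{m\times m}&-\alpha^t&\alpha^t\\ \alpha&0&0\\ \alpha&0&0\end{pmatrix}$ and $\mathfrak n=\{X_\alpha\}$. $P=MAN$ is the minimal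 parabolic subgroup with Lie algebra $\mathfrak p=\mathfrak l+\mathfrak n$, $\mathfrak l=\mathfrak m+\mathfrak a$, $M\cong\mathrm{Spin}(m)$. Put $H'=\begin{pmatrix}0&1\\-1&0\end{pmatrix}$, $H=\begin{pmatrix}0&1\\1&0\end{pmatrix}$ and $t'_{\vec a}=\mathrm{diag}\{a_1H',\dots,a_{n-1}H',0,a_nH\}\in\mathfrak g$. $g'_\infty\in G$ is a preimage of $\mathrm{diag}\{I_{2n-2},-1,-1,1\}\in G_1$. $\iota:\mathfrak g\to\mathfrak g^*$, $\iota(X)(Y)=\frac12\mathrm{tr}(XY)$; $\mathrm{pr}:\mathfrak g\to\mathfrak p^*$, $\mathrm{pr}(X)=\iota(X)|_{\mathfrak p}$. The moment map $q:\mathcal O_f\to\mathfrak p^*$ is restriction of linear forms to $\mathfrak p$. A coadjoint $P$-orbit in $\mathfrak p^*$ has depth zero if it is contained in $\mathfrak l^*=\{h:h|_{\mathfrak n}=0\}$, and depth one otherwise. For $Y\in\mathfrak{so}(m)$ and $\beta\in\mathbb{R}^m$, put $X_{Y,\beta,0}=\begin{pmatrix}Y&\beta^t&\beta^t\\-\beta&0&0\\ \beta&0&0\end{pmatrix}$. Each depth one $P$-orbit contains some $\mathrm{pr}(X_{Y,\beta,0})$ with $\beta\ne0$, $Y\beta^t=0$; $Y$ then has singular values $x_1,x_1,\dots,x_{n-1},x_{n-1},0$ with $x_1\ge\cdots\ge x_{n-1}\ge0$ depending only on the orbit, and the orbit is said to have singular values $(x_1,\dots,x_{n-1})$. *)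

(* Defs.v *)
From HB Require Import structures.
From mathcomp Require Import all_boot all_order all_algebra.
From mathcomp Require Import all_classical all_reals all_analysis.
Set Implicit Arguments.
Unset Strict Implicit.
Unset Printing Implicit Defensive.
Import Order.TTheory GRing.Theory Num.Theory numFieldNormedType.Exports.
Local Open Scope classical_set_scope.
Local Open Scope ring_scope.

HB.mixin Record isTopologicalGroup G of Topological G & Group G := {
  mulg_continuous : continuous (fun xy : G * G => (xy.1 * xy.2)%g);
  invg_continuous : continuous (fun x : G => x^-1%g) }.

#[short(type="topologicalGroupType")]
HB.structure Definition TopologicalGroup :=
  {G of isTopologicalGroup G & Topological G & Group G}.

(* [V] is a sheet of [p : T -> B] over the relatively open set [O `&` B]. *)
Definition covering_sheet (T U : topologicalType) (B : set U) (p : T -> U)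
    (O : set U) (V : set T) : Prop :=
  [/\ open V, set_bij V (O `&` B) p &
      forall W, open W -> W `<=` V ->
        exists2 O', open O' & p @` W = O' `&` B].

Definition two_fold_covering (T U : topologicalType) (B : set U) (p : T -> U)
    : Prop :=
  [/\ continuous p, range p = B &
      forall b, B b -> exists O : set U, [/\ open O, O b &
        exists V1 V2 : set T, [/\ covering_sheet B p O V1,
          covering_sheet B p O V2, V1 `&` V2 = set0 &
          p @^-1` O = V1 `|` V2]]].

Definition expmx (R : realType) (k : nat) (X : 'M[R]_k) : 'M[R]_k :=
  limn (series (fun i => i`!%:R^-1 *: X ^+ i)).

Section LieAlgebras.
Context (R : realType) (m : nat).

Definition mx22 (a b c d : R) : 'M[R]_2 :=
  @block_mx R 1 1 1 1 a%:M b%:M c%:M d%:M.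

Definition Hboost : 'M[R]_2 := mx22 0 1 1 0.

Definition lorentz_form : 'M[R]_(m + 2) := block_mx 1%:M 0 0 (mx22 1 0 0 (-1)).

Definition lorentz_group : set 'M[R]_(m + 2) :=
  [set X | X *m lorentz_form *m X^T = lorentz_form].

Definition SOe : set 'M[R]_(m + 2) := connected_component lorentz_group 1%:M.

Definition lorentz_defect (X : 'M[R]_(m + 2)) : 'M[R]_(m + 2) :=
  X *m lorentz_form + lorentz_form *m X^T.

Lemma lorentz_defect_linear : linear lorentz_defect.
Proof.
move=> c X Y; rewrite /lorentz_defect mulmxDl linearP /= mulmxDr.
by rewrite -scalemxAl -scalemxAr scalerDr addrACA.
Qed.

HB.instance Definition _ := GRing.isLinear.Build R _ _ _ lorentz_defect
  lorentz_defect_linear.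

(* so(m+1,1) *)
Definition g_alg : {vspace 'M[R]_(m + 2)} := lker (linfun lorentz_defect).

Lemma mem_g_alg X :
  (X \in g_alg) = (X *m lorentz_form + lorentz_form *m X^T == 0).
Proof. by rewrite memv_ker lfunE. Qed.

Definition skew_defect (Y : 'M[R]_m) : 'M[R]_m := Y + Y^T.

Lemma skew_defect_linear : linear skew_defect.
Proof.
by move=> c X Y; rewrite /skew_defect linearP /= scalerDr addrACA.
Qed.

HB.instance Definition _ := GRing.isLinear.Build R _ _ _ skew_defect
  skew_defect_linear.

Definition so_m : {vspace 'M[R]_m} := lker (linfun skew_defect).

Lemma mem_so_m Y : (Y \in so_m) = (Y + Y^T == 0).
Proof. by rewrite memv_ker lfunE. Qed.

Definition upper_left (Y : 'M[R]_m) : 'M[R]_(m + 2) := block_mx Y 0 0 0.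

Lemma upper_left_linear : linear upper_left.
Proof.
move=> c X Y; rewrite /upper_left scale_block_mx add_block_mx.
by rewrite !scaler0 !addr0.
Qed.

HB.instance Definition _ := GRing.isLinear.Build R _ _ _ upper_left
  upper_left_linear.

Definition m_alg : {vspace 'M[R]_(m + 2)} := (linfun upper_left @: so_m)%VS.

Definition H0 : 'M[R]_(m + 2) := block_mx 0 0 0 Hboost.

Definition a_alg : {vspace 'M[R]_(m + 2)} := <[H0]>%VS.

Definition X_ (alpha : 'rV[R]_m) : 'M[R]_(m + 2) :=
  block_mx 0 (row_mx (- alpha^T) alpha^T) (col_mx alpha alpha) 0.

Lemma X_linear : linear X_.
Proof.
move=> c u v; rewrite /X_ scale_block_mx add_block_mx !scaler0 !addr0.
rewrite (@scale_row_mx _ _ 1 1) (@add_row_mx _ _ 1 1).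
rewrite (@scale_col_mx _ 1 1) (@add_col_mx _ 1 1).
by rewrite linearP /= opprD scalerN.
Qed.

HB.instance Definition _ := GRing.isLinear.Build R _ _ _ X_ X_linear.

Definition n_alg : {vspace 'M[R]_(m + 2)} := limg (linfun X_).

Definition l_alg : {vspace 'M[R]_(m + 2)} := (m_alg + a_alg)%VS.
Definition p_alg : {vspace 'M[R]_(m + 2)} := (l_alg + n_alg)%VS.

Lemma mem_n_alg X : reflect (exists u, X = X_ u) (X \in n_alg).
Proof.
apply: (iffP memv_imgP) => [[u _ ->]|[u ->]]; exists u; rewrite ?lfunE //.
exact: memvf.
Qed.

Lemma p_sub_g : (p_alg <= g_alg)%VS.
Proof.
rewrite !subv_add; apply/andP; split; first (apply/andP; split).
- apply/subvP => _ /memv_imgP[Y + ->]; rewrite mem_so_m mem_g_alg lfunE /=.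
  move=> /eqP hY; rewrite /upper_left /lorentz_form tr_block_mx !mulmx_block.
  rewrite !trmx0 !mul0mx !mulmx0 !addr0 mulmx1 mul1mx add_block_mx hY !addr0.
  by rewrite block_mx0.
- rewrite -memvE mem_g_alg /H0 /lorentz_form tr_block_mx !mulmx_block.
  rewrite !trmx0 !mul0mx !mulmx0 !addr0 add_block_mx !addr0 !add0r.
  rewrite /Hboost /mx22 (@tr_block_mx _ 1 1 1 1).
  rewrite !(@mulmx_block _ 1 1 1 1 1 1) !tr_scalar_mx !mul_scalar_mx.
  rewrite !scale0r !scale1r !scaleN1r (@add_block_mx _ 1 1 1 1).
  rewrite ?(scaler0, add0r, addr0, subrr, addNr).
  rewrite raddfN /= addNr ?raddf0 ?oppr0 ?addr0 ?subrr (@block_mx0 _ 1 1 1 1).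
  by rewrite block_mx0.
- apply/subvP => _ /mem_n_alg[u ->]; rewrite mem_g_alg.
  rewrite /X_ /lorentz_form tr_block_mx !mulmx_block.
  rewrite !trmx0 !mul0mx !mulmx0 ?addr0 ?add0r add_block_mx !addr0.
  rewrite (@tr_row_mx _ _ 1 1) (@tr_col_mx _ 1 1) !mul1mx !mulmx1.
  rewrite !linearN /= trmxK.
  rewrite /mx22 (@mul_row_block _ _ 1 1 1 1) (@mul_block_col _ 1 1 1 1).
  rewrite !mul_scalar_mx !mul_mx_scalar !scale0r !scale1r !scaleN1r !addr0.
  rewrite !add0r (@add_row_mx _ _ 1 1) (@add_col_mx _ 1 1).
  rewrite ?(addNr, addrN, subrr) (@row_mx0 _ _ 1 1) (@col_mx0 _ 1 1).
  by rewrite block_mx0.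
Qed.

Definition lin_dual (V : {vspace 'M[R]_(m + 2)}) : Type := 'Hom(subvs_of V, R^o).

Definition iotag_fun (X : 'M[R]_(m + 2)) (Y : subvs_of g_alg) : R^o :=
  2^-1 * \tr (X *m vsval Y).

Lemma iotag_fun_linear X : linear (iotag_fun X).
Proof.
move=> c Y Z; rewrite /iotag_fun mulmxDr -scalemxAr mxtraceD mxtraceZ.
by rewrite mulrDr mulrCA.
Qed.

HB.instance Definition _ X := GRing.isLinear.Build R _ _ _ (iotag_fun X)
  (iotag_fun_linear X).

Definition iotag (X : 'M[R]_(m + 2)) : lin_dual g_alg := linfun (iotag_fun X).

Definition restrict_fun (h : lin_dual g_alg) (Y : subvs_of p_alg) : R^o :=
  h (vsproj g_alg (vsval Y)).

Lemma restrict_fun_linear h : linear (restrict_fun h).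
Proof. by move=> c Y Z; rewrite /restrict_fun !linearP. Qed.

HB.instance Definition _ h := GRing.isLinear.Build R _ _ _ (restrict_fun h)
  (restrict_fun_linear h).

Definition moment (h : lin_dual g_alg) : lin_dual p_alg := linfun (restrict_fun h).

Definition pr (X : 'M[R]_(m + 2)) : lin_dual p_alg := moment (iotag X).

Definition X_Ybeta0 (Y : 'M[R]_m) (beta : 'rV[R]_m) : 'M[R]_(m + 2) :=
  block_mx Y (row_mx beta^T beta^T) (col_mx (- beta) beta) 0.

(* diag{a_1 H', ..., a_k H', 0} with H' = (0, 1; -1, 0) and m = 2k+1.  As a is *)
(* 0-indexed, the entries a and -a of block i are at (2i, 2i+1) and (2i+1, 2i).*)
Definition rot_blocks (a : seq R) : 'M[R]_m :=
  \matrix_(i < m, j < m)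
    if ~~ odd i && (j == i.+1 :> nat) then a`_(i./2)
    else if ~~ odd j && (i == j.+1 :> nat) then - a`_(j./2)
    else 0.

(* The last entry of [a] is the coefficient of H. *)
Definition t' (a : seq R) : 'M[R]_(m + 2) :=
  block_mx (rot_blocks a) 0 0 (last 0 a *: Hboost).

(* diag{I_{m-1}, -1, -1, 1} *)
Definition ginf_mx : 'M[R]_(m + 2) :=
  diag_mx (\row_(i < m + 2)
    if (i == m.-1 :> nat) || (i == m :> nat) then -1 else 1).

(* The nonnegative square roots of the eigenvalues of Y^t Y, listed with       *)
(* multiplicity (in any order).                                                *)
Definition singular_values (Y : 'M[R]_m) (s : seq R) : Prop :=
  all (fun t => 0 <= t) s /\
  char_poly (Y^T *m Y) = \prod_(t <- s) ('X - (t ^+ 2)%:P).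

End LieAlgebras.

Arguments mx22 {R} a b c d.
Arguments Hboost {R}.
Arguments H0 {R m}.
Arguments iotag {R m} X.
Arguments restrict_fun {R m} h Y.
Arguments moment {R m} h.
Arguments pr {R m} X.
Arguments X_ {R m} alpha.
Arguments X_Ybeta0 {R m} Y beta.
Arguments singular_values {R m} Y s.
Arguments lorentz_form {R m}.

Section Groups.
Context (R : realType) (m : nat).

(* A connected two-fold covering group of SO_e(m+1,1); for m >= 2 the          *)
(* fundamental group of SO_e(m+1,1) has order two, so that (G, cov) is         *)
(* Spin(m+1,1) up to isomorphism over SO_e(m+1,1).                             *)
Definition is_Spin (G : topologicalGroupType) (cov : G -> 'M[R]_(m + 2))
    : Prop :=
  [/\ connected [set: G],
      {morph cov : x y / (x * y)%g >-> x *m y} &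
      two_fold_covering (@SOe R m) cov].

Context (G : topologicalGroupType) (cov : G -> 'M[R]_(m + 2)).

Definition Ad (g : G) (X : 'M[R]_(m + 2)) : 'M[R]_(m + 2) :=
  cov g *m X *m cov g^-1%g.

(* P = MAN with M = cov^{-1}(SO(m)); as M contains the kernel of cov, P is the *)
(* full preimage of SO(m) exp(a) exp(n).                                       *)
Definition P_grp : set G :=
  [set g | exists (k : 'M[R]_m) (t : R) (alpha : 'rV[R]_m),
    [/\ k *m k^T = 1%:M, \det k = 1 &
        cov g = block_mx k 0 0 1%:M *m expmx (t *: H0) *m expmx (X_ alpha)]].

(* The coadjoint action (g . h)(Y) = h(Ad(g^-1) Y) on V^*, meaningful when     *)
(* Ad(g) preserves V: used for V = g_alg, and for V = p_alg with g in P.       *)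
Definition coad_fun (V : {vspace 'M[R]_(m + 2)}) (g : G) (h : lin_dual V)
    (Y : subvs_of V) : R^o :=
  h (vsproj V (Ad g^-1%g (vsval Y))).

Lemma coad_fun_linear V g (h : lin_dual V) : linear (coad_fun g h).
Proof.
move=> c Y Z; rewrite /coad_fun /Ad mulmxDr mulmxDl.
by rewrite -scalemxAr -scalemxAl !linearP.
Qed.

HB.instance Definition _ V g (h : lin_dual V) :=
  GRing.isLinear.Build R _ _ _ (coad_fun g h) (coad_fun_linear g h).

Definition coad (V : {vspace 'M[R]_(m + 2)}) (g : G) (h : lin_dual V) : lin_dual V :=
  linfun (coad_fun g h).

Definition G_orbit (h : lin_dual (g_alg R m)) : set (lin_dual (g_alg R m)) :=
  [set coad g h | g in [set: G]].

(* Used for V = g_alg and V = p_alg. *)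
Definition P_orbit (V : {vspace 'M[R]_(m + 2)}) (h : lin_dual V) : set (lin_dual V) :=
  [set coad g h | g in P_grp].

Definition is_P_orbit (V : {vspace 'M[R]_(m + 2)}) (O : set (lin_dual V)) : Prop :=
  exists h : lin_dual V, O = P_orbit h.

Definition depth_zero (O : set (lin_dual (p_alg R m))) : Prop :=
  is_P_orbit O /\
  O `<=` [set h | forall X, X \in n_alg R m -> h (vsproj (p_alg R m) X) = 0].

Definition depth_one (O : set (lin_dual (p_alg R m))) : Prop :=
  is_P_orbit O /\ ~ depth_zero O.

Definition orbit_singular_values (O : set (lin_dual (p_alg R m))) (x : seq R)
    : Prop :=
  sorted >=%R x /\
  exists (Y : 'M[R]_m) (beta : 'rV[R]_m),
    [/\ Y \in so_m R m, beta != 0, Y *m beta^T = 0, O (pr (X_Ybeta0 Y beta)) &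
        singular_values Y (rcons (flatten [seq [:: t; t] | t <- x]) 0)].

End Groups.

(* a_1 >= x_1 >= a_2 >= ... >= a_k >= x_k >= 0, with 0-indexed sequences. *)
Definition interlaced (R : realType) (k : nat) (a x : seq R) : Prop :=
  [/\ forall i, (i < k)%N -> x`_i <= a`_i,
      forall i, (i.+1 < k)%N -> a`_i.+1 <= x`_i &
      forall i, (i < k)%N -> 0 <= x`_i].

(* Main.v *)
(* Since n is the annihilator of p for the trace form, p^* is g / n, and the q-image
   of O_f is the set of classes modulo n of the matrices X = g T g^-1, T = t'_a.
   The group P is the stabilizer of the null ray of e_+ = (0, 1, 1).  If e_+ is an
   eigenvector of X, then g^-1 e_+ is a null eigenvector of T, hence lies on one of
   the two null lines +-a_n that g'_infinity exchanges: this gives the two orbits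
   of depth zero.  Otherwise X is P-conjugate to Z = X_{Y,b,0} + X_alpha with
   Y b = 0 and b <> 0.  Computing <(t - Z)^-1 e_+, e_+> once with a Schur complement
   and once in eigencoordinates of T^2 for the null vector v = g^-1 e_+ gives
     4 |b|^2 det(t - Y) = t \sum_y w_y \prod_(y' <> y) (t^2 - y'),
   where y runs over the nodes - a_1^2 < ... < - a_{n-1}^2 < 0 and w_y >= 0 is a
   positive multiple of the squared length of the y-component of v.  Therefore the
   roots - x_j^2 of the sum interlace the nodes.  Conversely, if they interlace,
   the partial fraction expansion of det(t - T) / det(t - Y) has nonnegative
   residues, which provide an alpha for which Z has the characteristic polynomial
   of T; such a Z is conjugate to T through an adapted Lorentz frame.
   For the injectivity, the w_y are determined by (Y, b), hence v is determined up
   to the centralizer of T.  This yields a conjugation in O(m+1,1) that fixes e_+;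
   if T has no kernel component along v, its determinant can be corrected inside
   the centralizer of T, and otherwise Y is injective on the orthogonal of b, which
   forces the determinant to be 1. *)

Require Import Defs.
From HB Require Import structures.
From mathcomp Require Import all_boot all_order all_algebra.
From mathcomp Require Import all_classical all_reals all_analysis.
From mathcomp Require Import ring lra zify.
Import Order.TTheory GRing.Theory Num.Theory numFieldNormedType.Exports.
Local Open Scope classical_set_scope.
Local Open Scope ring_scope.
Set Implicit Arguments.
Unset Strict Implicit.
Unset Printing Implicit Defensive.

(** [G] is given only as a connected two-fold cover of SO_e, so orbit statements are moved to
    matrices through [cov]. This requires recognizing the identity component by determinant and time
    orientation, which is done with explicit paths of products of reflections.

    The main obstacle is that the interlacing is weak: roots may coincide with nodes, and weights
    may vanish. The sum over the nodes is therefore handled through its numerator over the common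
    denominator, whose values at the nodes alternate in sign only weakly; conversely, the partial
    fraction expansion must cancel repeated factors before residues make sense.

    The only datum of a normal form that [q] forgets is [al]. The characteristic polynomial does not
    determine it (the coefficients of [al] enter through their squares), so injectivity cannot be
    proved by recovering [al]; it must come from an element of P that conjugates one choice into
    another.

    Spectral data are obtained algebraically: characteristic polynomials are compared through their
    squares, because the square of t' is diagonal, and eigenvectors come from roots. *)

Lemma delta_form (R : nzRingType) n (M : 'M[R]_n) i j :
  ((delta_mx i 0 : 'cV_n)^T *m M *m (delta_mx j 0 : 'cV_n)) 0 0 = M i j.
Proof. by rewrite trmx_delta -rowE -colE !mxE. Qed.

(** * Lorentz geometry *)

Section EuclideanDot.
Context (R : realFieldType) (m : nat).
Implicit Types u v w : 'cV[R]_m.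

Definition edot u v : R := (u^T *m v) 0 0.

Lemma edot_mx u v : u^T *m v = (edot u v)%:M.
Proof. exact: mx11_scalar. Qed.

Lemma edotE u v : edot u v = \sum_i u i 0 * v i 0.
Proof. by rewrite /edot mxE; apply: eq_bigr => i _; rewrite mxE. Qed.

Lemma edotC u v : edot u v = edot v u.
Proof. by rewrite !edotE; apply: eq_bigr => i _; rewrite mulrC. Qed.

Lemma edotDl u v w : edot (u + v) w = edot u w + edot v w.
Proof. by rewrite /edot linearD /= mulmxDl mxE. Qed.

Lemma edotDr u v w : edot w (u + v) = edot w u + edot w v.
Proof. by rewrite /edot mulmxDr mxE. Qed.

Lemma edotZl c u w : edot (c *: u) w = c * edot u w.
Proof. by rewrite /edot linearZ /= -scalemxAl mxE. Qed.

Lemma edotZr c u w : edot w (c *: u) = c * edot w u.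
Proof. by rewrite /edot -scalemxAr mxE. Qed.

Lemma edotNl u w : edot (- u) w = - edot u w.
Proof. by rewrite -scaleN1r edotZl mulN1r. Qed.

Lemma edotNr u w : edot w (- u) = - edot w u.
Proof. by rewrite -scaleN1r edotZr mulN1r. Qed.

Lemma edotBl u v w : edot (u - v) w = edot u w - edot v w.
Proof. by rewrite edotDl edotNl. Qed.

Lemma edotBr u v w : edot w (u - v) = edot w u - edot w v.
Proof. by rewrite edotDr edotNr. Qed.

Lemma edot0l w : edot 0 w = 0.
Proof. by rewrite -(scale0r 0) edotZl mul0r. Qed.

Lemma edot0r w : edot w 0 = 0.
Proof. by rewrite edotC edot0l. Qed.

Lemma edot_suml I (r : seq I) (P : pred I) (F : I -> 'cV[R]_m) w :
  edot (\sum_(i <- r | P i) F i) w = \sum_(i <- r | P i) edot (F i) w.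
Proof.
elim/big_rec2: _ => [|i y1 y2 _ <-]; first by rewrite edot0l.
by rewrite edotDl.
Qed.

Lemma edot_sumr I (r : seq I) (P : pred I) (F : I -> 'cV[R]_m) w :
  edot w (\sum_(i <- r | P i) F i) = \sum_(i <- r | P i) edot w (F i).
Proof. by rewrite edotC edot_suml; under eq_bigr do rewrite edotC. Qed.

Lemma edot_ge0 u : 0 <= edot u u.
Proof. by rewrite edotE sumr_ge0// => i _; rewrite -expr2 sqr_ge0. Qed.

Lemma edot_eq0 u : (edot u u == 0) = (u == 0).
Proof.
apply/idP/eqP => [|->]; last by rewrite edot0l.
rewrite edotE psumr_eq0; last by move=> i _; rewrite -expr2 sqr_ge0.
move=> /allP H; apply/colP => i; rewrite mxE.
by have := H i (mem_index_enum _); rewrite mulf_eq0 orbb => /eqP.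
Qed.

Lemma edot_gt0 u : (0 < edot u u) = (u != 0).
Proof. by rewrite lt0r edot_eq0 edot_ge0 andbT. Qed.

Lemma edot_adj (A : 'M[R]_m) u v : edot (A *m u) v = edot u (A^T *m v).
Proof. by rewrite /edot trmx_mul mulmxA. Qed.

End EuclideanDot.

Section LorentzGeometry.
Context (R : realType) (m : nat).
Notation J := (@lorentz_form R m).
Notation O := (@lorentz_group R m).
Implicit Types u v w : 'cV[R]_(m + 2).
Implicit Types x y z : 'cV[R]_m.
Implicit Types A B X : 'M[R]_(m + 2).

Definition vec x (s t : R) : 'cV[R]_(m + 2) :=
  col_mx x (@col_mx R 1 1 1 s%:M t%:M).

Lemma vecP u : exists x s t, u = vec x s t.
Proof.
exists (usubmx u), (@usubmx _ 1 1 1 (dsubmx u) 0 0),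
  (@dsubmx _ 1 1 1 (dsubmx u) 0 0).
by rewrite /vec -!mx11_scalar !vsubmxK.
Qed.

Lemma vec_inj x s t x' s' t' : vec x s t = vec x' s' t' ->
  [/\ x = x', s = s' & t = t'].
Proof.
move=> /eq_col_mx[-> /(@eq_col_mx _ 1 1 1)[/matrixP/(_ 0 0) + /matrixP/(_ 0 0)]].
by rewrite !mxE !eqxx.
Qed.

Lemma vecD x s t x' s' t' :
  vec x s t + vec x' s' t' = vec (x + x') (s + s') (t + t').
Proof. by rewrite /vec add_col_mx (@add_col_mx _ 1 1) -!raddfD. Qed.

Lemma vecZ c x s t : c *: vec x s t = vec (c *: x) (c * s) (c * t).
Proof. by rewrite /vec scale_col_mx (@scale_col_mx _ 1 1) !scale_scalar_mx. Qed.

Lemma vecN x s t : - vec x s t = vec (- x) (- s) (- t).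
Proof. by rewrite -scaleN1r vecZ scaleN1r !mulN1r. Qed.

Lemma vecB x s t x' s' t' :
  vec x s t - vec x' s' t' = vec (x - x') (s - s') (t - t').
Proof. by rewrite vecN vecD. Qed.

Lemma vec0 : vec 0 0 0 = 0.
Proof. by rewrite /vec !raddf0 (@col_mx0 _ 1 1) col_mx0. Qed.

Definition ldot u v : R := (u^T *m J *m v) 0 0.

Lemma ldot_mx u v : u^T *m J *m v = (ldot u v)%:M.
Proof. exact: mx11_scalar. Qed.

Lemma Jvec x s t : J *m vec x s t = vec x s (- t).
Proof.
rewrite /lorentz_form /vec mul_block_col !mul0mx mul1mx addr0 add0r.
rewrite /mx22 (@mul_block_col _ 1 1 1 1).
by rewrite !mul_scalar_mx scale1r !scale0r scaleN1r addr0 add0r -raddfN.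
Qed.

Lemma ldot_vec x s t x' s' t' :
  ldot (vec x s t) (vec x' s' t') = edot x x' + s * s' - t * t'.
Proof.
rewrite /ldot -mulmxA Jvec /vec tr_col_mx mul_row_col (@tr_col_mx _ 1 1).
rewrite (@mul_row_col _ _ 1 1) !tr_scalar_mx !mul_scalar_mx !scale_scalar_mx.
by rewrite !mxE !eqxx /edot mxE addrA mulrN.
Qed.

Lemma J_tr : J^T = J.
Proof.
rewrite /lorentz_form tr_block_mx !trmx0 trmx1 (@tr_block_mx _ 1 1 1 1).
by rewrite !tr_scalar_mx.
Qed.

Lemma JK : J *m J = 1%:M.
Proof.
rewrite /lorentz_form mulmx_block !mulmx0 !mul0mx mulmx1 !addr0 add0r.
rewrite (@mulmx_block _ 1 1 1 1 1 1) !mul_scalar_mx.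
rewrite !scale_scalar_mx -!raddfD !(mul0r, mul1r, mulN1r, addr0, add0r, opprK).
by rewrite oppr0 !raddf0 /= -(@scalar_mx_block _ 1 1) -scalar_mx_block.
Qed.

Lemma ldotC u v : ldot u v = ldot v u.
Proof.
have /matrixP/(_ 0 0) : (u^T *m J *m v)^T = v^T *m J *m u.
  by rewrite !trmx_mul trmxK J_tr mulmxA.
by rewrite mxE.
Qed.

Lemma ldotDl u v w : ldot (u + v) w = ldot u w + ldot v w.
Proof. by rewrite /ldot linearD /= !mulmxDl mxE. Qed.

Lemma ldotZl c u w : ldot (c *: u) w = c * ldot u w.
Proof. by rewrite /ldot linearZ /= -!scalemxAl mxE. Qed.

Lemma ldotDr u v w : ldot w (u + v) = ldot w u + ldot w v.
Proof. by rewrite ldotC ldotDl !(ldotC w). Qed.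

Lemma ldotZr c u w : ldot w (c *: u) = c * ldot w u.
Proof. by rewrite ldotC ldotZl (ldotC w). Qed.

Lemma ldotNl u w : ldot (- u) w = - ldot u w.
Proof. by rewrite -scaleN1r ldotZl mulN1r. Qed.

Lemma ldotNr u w : ldot w (- u) = - ldot w u.
Proof. by rewrite -scaleN1r ldotZr mulN1r. Qed.

Lemma ldotBl u v w : ldot (u - v) w = ldot u w - ldot v w.
Proof. by rewrite ldotDl ldotNl. Qed.

Lemma ldotBr u v w : ldot w (u - v) = ldot w u - ldot w v.
Proof. by rewrite ldotDr ldotNr. Qed.

Lemma ldot0l w : ldot 0 w = 0.
Proof. by rewrite -(scale0r 0) ldotZl mul0r. Qed.

Lemma ldot0r w : ldot w 0 = 0.
Proof. by rewrite ldotC ldot0l. Qed.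

Definition ldotE := (ldotDl, ldotDr, ldotBl, ldotBr, ldotZl, ldotZr, ldotNl,
  ldotNr, ldot0l, ldot0r).

(** The group is defined by $AJA^t=J$, whereas preserving the form means $A^tJA=J$. As $J^2=1$, each
    says that two square matrices are inverse to each other, in opposite orders. *)
Lemma lorentzP A : O A <-> forall u v, ldot (A *m u) (A *m v) = ldot u v.
Proof.
have E : O A <-> A^T *m J *m A = J.
  split; rewrite /lorentz_group /= => H.
  - have : (A *m J) *m (A^T *m J) = 1%:M by rewrite !mulmxA H JK.
    move=> /mulmx1C; rewrite -!mulmxA => /(congr1 (mulmx^~ J)).
    by rewrite mul1mx -!mulmxA JK mulmx1.
  - have : (A^T *m J) *m (A *m J) = 1%:M by rewrite !mulmxA H JK.
    move=> /mulmx1C; rewrite -!mulmxA => /(congr1 (mulmx^~ J)).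
    by rewrite mul1mx -!mulmxA JK mulmx1.
rewrite E; split=> [H u v|H].
  by rewrite /ldot trmx_mul !mulmxA -(mulmxA _ _ J) -(mulmxA _ _ A) H.
apply/matrixP => i j; have := H (delta_mx i 0) (delta_mx j 0).
rewrite /ldot delta_form trmx_mul => <-.
by rewrite -[LHS]delta_form !mulmxA.
Qed.

Lemma lorentz_ldot A u v : O A -> ldot (A *m u) (A *m v) = ldot u v.
Proof. by move=> /lorentzP. Qed.

Lemma lorentz1 : O 1%:M.
Proof. by rewrite /lorentz_group /= mul1mx trmx1 mulmx1. Qed.

Lemma lorentzM A B : O A -> O B -> O (A *m B).
Proof. by rewrite !lorentzP => OA OB u v; rewrite -!mulmxA OA OB. Qed.

Lemma lorentz_unit A : O A -> A \in unitmx.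
Proof.
move=> OA; have /mulmx1_unit[] // : A *m (J *m A^T *m J) = 1%:M.
by rewrite !mulmxA OA JK.
Qed.

Lemma lorentz_mulV A : O A -> A *m invmx A = 1%:M.
Proof. by move=> /lorentz_unit /mulmxV. Qed.

Lemma lorentz_Vmul A : O A -> invmx A *m A = 1%:M.
Proof. by move=> /lorentz_unit /mulVmx. Qed.

Lemma lorentzV A : O A -> O (invmx A).
Proof.
move=> OA; apply/lorentzP => u v.
by rewrite -(lorentz_ldot _ _ OA) !(mulmxA A) lorentz_mulV// !mul1mx.
Qed.

Lemma det_lorentz A : O A -> \det A = 1 \/ \det A = -1.
Proof.
move=> OA; have := congr1 determinant OA.
rewrite !det_mulmx det_tr => H.
have JJ := congr1 determinant JK; rewrite det_mulmx det1 in JJ.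
have /eqP : (\det A) ^+ 2 = 1.
  have := congr1 ( *%R^~ (\det J)) H; rewrite JJ => <-.
  by rewrite -[LHS]mulr1 -JJ; ring.
by rewrite sqrf_eq1 => /orP[/eqP|/eqP]; [left|right].
Qed.

Lemma g_algP X : reflect (forall u v, ldot (X *m u) v = - ldot u (X *m v))
  (X \in g_alg R m).
Proof.
rewrite mem_g_alg.
have -> : (X *m J + J *m X^T == 0) = (X^T *m J + J *m X == 0).
  apply/eqP/eqP => H.
  - have : J *m (X *m J + J *m X^T) *m J = 0 by rewrite H mulmx0 mul0mx.
    rewrite mulmxDr mulmxDl !mulmxA JK mul1mx -(mulmxA _ J J) JK mulmx1.
    by rewrite addrC.
  - have : J *m (X^T *m J + J *m X) *m J = 0 by rewrite H mulmx0 mul0mx.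
    rewrite mulmxDr mulmxDl !mulmxA JK mul1mx -(mulmxA _ J J) JK mulmx1.
    by rewrite addrC.
apply: (iffP eqP) => [H u v|H].
  apply/eqP; rewrite -subr_eq0 opprK; apply/eqP.
  have /matrixP/(_ 0 0) : u^T *m (X^T *m J + J *m X) *m v = 0.
    by rewrite H mulmx0 mul0mx.
  by rewrite mulmxDr mulmxDl [LHS]mxE [RHS]mxE /ldot trmx_mul !mulmxA.
apply/matrixP => i j; have /eqP := H (delta_mx i 0) (delta_mx j 0).
rewrite -subr_eq0 opprK /ldot trmx_mul -(mulmxA _ _ J) delta_form.
by rewrite !mulmxA -(mulmxA _ J X) delta_form => /eqP; rewrite !mxE.
Qed.

Lemma g_ldot X u v : X \in g_alg R m -> ldot (X *m u) v = - ldot u (X *m v).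
Proof. by move=> /g_algP. Qed.

Lemma g_ldot_self X u : X \in g_alg R m -> ldot (X *m u) u = 0.
Proof.
move=> gX; have := g_ldot u u gX; rewrite (ldotC u) => H.
by apply/eqP; move/eqP: H; rewrite -addr_eq0 -mulr2n mulrn_eq0.
Qed.

Lemma g_conj A X : O A -> X \in g_alg R m -> A *m X *m invmx A \in g_alg R m.
Proof.
move=> OA gX; apply/g_algP => u v.
rewrite -[in LHS](mul1mx v) -(lorentz_mulV OA) -[in RHS](mul1mx u).
rewrite -(lorentz_mulV OA) -!(mulmxA _ _ u) -!(mulmxA _ _ v) -!(mulmxA A).
by rewrite !lorentz_ldot// g_ldot.
Qed.

Definition ep : 'cV[R]_(m + 2) := vec 0 1 1.
Definition em : 'cV[R]_(m + 2) := vec 0 1 (-1).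

Lemma ep_neq0 : ep != 0.
Proof. by apply/eqP; rewrite -vec0 => /vec_inj[_ /eqP]; rewrite oner_eq0. Qed.

Lemma ldot_pp : ldot ep ep = 0.
Proof. rewrite ldot_vec edot0l; lra. Qed.
Lemma ldot_mm : ldot em em = 0.
Proof. rewrite ldot_vec edot0l; lra. Qed.
Lemma ldot_pm : ldot ep em = 2.
Proof. rewrite ldot_vec edot0l; lra. Qed.

End LorentzGeometry.

Lemma det_sylvester (R : comNzRingType) p q (A : 'M[R]_(p, q)) (B : 'M[R]_(q, p)) :
  \det (1%:M - A *m B) = \det (1%:M - B *m A).
Proof.
have E1 : block_mx 1%:M A B 1%:M =
    block_mx 1%:M 0 B 1%:M *m block_mx 1%:M A 0 (1%:M - B *m A).
  by rewrite mulmx_block !mul1mx !mulmx1 !mulmx0 !mul0mx !addr0 addrCA subrr addr0.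
have E2 : block_mx 1%:M A B 1%:M =
    block_mx 1%:M A 0 1%:M *m block_mx (1%:M - A *m B) 0 B 1%:M.
  by rewrite mulmx_block !mul1mx !mulmx1 !mulmx0 !mul0mx !add0r subrK.
have := congr1 determinant E1; rewrite E2 !det_mulmx !det_ublock !det_lblock.
by rewrite !det1 !mul1r !mulr1.
Qed.

(** * The identity component of the Lorentz group *)

Section Reflections.
Context (R : realType) (m : nat).
Notation J := (@lorentz_form R m).
Notation O := (@lorentz_group R m).
Implicit Types u v w : 'cV[R]_(m + 2).
Implicit Types x y z : 'cV[R]_m.
Implicit Types A B X : 'M[R]_(m + 2).

Definition refl u : 'M[R]_(m + 2) :=
  1%:M - (2 / ldot u u) *: (u *m (u^T *m J)).

Lemma reflE u v : refl u *m v = v - (2 * ldot u v / ldot u u) *: u.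
Proof.
rewrite /refl mulmxBl mul1mx -scalemxAl -!mulmxA (mulmxA _ J) ldot_mx.
by rewrite mul_mx_scalar scalerA mulrAC.
Qed.

Lemma refl_lorentz u : ldot u u != 0 -> O (refl u).
Proof.
move=> u0; apply/lorentzP => v w; rewrite !reflE !ldotE (ldotC v u).
by field.
Qed.

Lemma refl_det u : ldot u u != 0 -> \det (refl u) = -1.
Proof.
move=> u0; rewrite /refl scalemxAl det_sylvester det_mx11 mxE mxE eqxx mulr1n.
rewrite -scalemxAr mxE [X in _ - X]mxE -/(ldot u u) divfK//; ring.
Qed.

Lemma refl_refl u : ldot u u != 0 -> refl u *m refl u = 1%:M.
Proof.
move=> u0; apply/matrixP => i j.
have : refl u *m refl u *m delta_mx j (0 : 'I_1) = delta_mx j 0.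
  rewrite -mulmxA !reflE -addrA -opprD -scalerDl [X in X *: _](_ : _ = 0).
    by rewrite scale0r subr0.
  by rewrite ldotBr ldotZr; field.
by move=> /matrixP/(_ i 0); rewrite -colE !mxE => ->; rewrite eqxx andbT.
Qed.

(** Sliding the mirror of [refl u] along the segment from [w] to [u] gives a path from
    [refl w *m refl w *m A = A] to the product. The sign condition on [ldot u w] keeps the whole
    segment spacelike. *)
Lemma refl_conn_pos u w A : 0 < ldot u u -> 0 < ldot w w -> 0 <= ldot u w ->
  @SOe R m A -> @SOe R m (refl w *m refl u *m A).
Proof.
move=> u0 w0 uw SA; apply: connected_component_trans (SA) _.
have OA : O A by apply: connected_component_sub SA.
pose ut (t : R) := w + t *: (u - w).
pose Qt (t : R) := ldot w w + t * (ldot w (u - w) *+ 2) +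
  t ^+ 2 * ldot (u - w) (u - w).
have QE t : ldot (ut t) (ut t) = Qt t.
  by rewrite /ut /Qt !ldotE (ldotC u w); ring.
have Qpos t : t \in `[0, 1] -> 0 < Qt t.
  rewrite in_itv /= => /andP[t0 t1].
  (* In the Bernstein form of the quadratic every coefficient is nonnegative on [[0, 1]]. *)
  have -> : Qt t = (1 - t) ^+ 2 * ldot w w + (t * (1 - t)) * (ldot u w *+ 2) +
      t ^+ 2 * ldot u u.
    by rewrite /Qt !ldotE (ldotC w u); ring.
  have [->|tn0] := eqVneq t 0; first by rewrite subr0 expr1n; lra.
  apply: ltr_wpDl; last by rewrite mulr_gt0// exprn_gt0// lt0r tn0.
  rewrite addr_ge0// mulr_ge0 ?sqr_ge0 ?mulrn_wge0 ?(ltW w0)//.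
  by rewrite mulr_ge0// subr_ge0.
pose g (t : R) := refl w *m refl (ut t) *m A.
have -> : refl w *m refl u *m A = g 1.
  by rewrite /g /ut scale1r addrC subrK.
have -> : A = g 0.
  by rewrite /g /ut scale0r addr0 refl_refl ?mul1mx// gt_eqF.
apply: (@connected_component_max _ _ (g @` `[0, 1])).
- by exists 0 => //=; rewrite in_itv /= lexx ler01.
- move=> _ [t /= ht <-]; apply: lorentzM => //.
  by apply: lorentzM; apply: refl_lorentz; rewrite gt_eqF// QE Qpos.
2: by exists 1 => //=; rewrite in_itv /= lexx ler01.
apply: connected_continuous_connected; first exact: segment_connected.
  apply: continuous_in_subspaceT => t /set_mem ht.
  pose P0 := w *m (w^T *m J).
  pose P1 := (u - w) *m (w^T *m J) + w *m ((u - w)^T *m J).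
  pose P2 := (u - w) *m ((u - w)^T *m J).
  (* The path is a matrix polynomial of degree two in [s] divided by the nonvanishing scalar [Qt s],
     so its continuity reduces to that of scalars. *)
  have gE s : g s = refl w *m A - (2 / Qt s) *: (refl w *m P0 *m A +
     s *: (refl w *m P1 *m A) + s ^+ 2 *: (refl w *m P2 *m A)).
    have -> : refl w *m P0 *m A + s *: (refl w *m P1 *m A) +
        s ^+ 2 *: (refl w *m P2 *m A) = refl w *m (ut s *m ((ut s)^T *m J)) *m A.
      have -> : ut s *m ((ut s)^T *m J) = P0 + s *: P1 + s ^+ 2 *: P2.
        have -> : (ut s)^T = w^T + s *: (u - w)^T by rewrite /ut linearD /= linearZ.
        rewrite /P0 /P1 /P2 /ut; move: (u - w) => d.
        rewrite !mulmxDl !mulmxDr -!scalemxAl -!scalemxAr !scalerDr !scalerA.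
        rewrite -expr2 !addrA; congr (_ + _).
        by rewrite -!addrA; congr (_ + _); rewrite addrC.
      rewrite 2!mulmxDr 2!mulmxDl; congr (_ + _ + _).
        by rewrite -scalemxAr -scalemxAl.
      by rewrite -scalemxAr -scalemxAl.
    rewrite /g {2}/refl QE mulmxBr mulmx1 mulmxBl.
    by rewrite -scalemxAr -scalemxAl.
  rewrite (funext gE).
  rewrite /continuous_at; apply: cvgB; first exact: cvg_cst.
  apply: cvgZ.
    apply: cvgM; first exact: cvg_cst.
    apply: cvgV; first by rewrite gt_eqF// Qpos.
    apply: cvgD; last by apply: cvgM; [exact: exprn_continuous|exact: cvg_cst].
    apply: cvgD; first exact: cvg_cst.
    by apply: cvgM; [exact: cvg_id|exact: cvg_cst].
  apply: cvgD; last by apply: cvgZ; [exact: exprn_continuous|exact: cvg_cst].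
  apply: cvgD; first exact: cvg_cst.
  by apply: cvgZ; [exact: cvg_id|exact: cvg_cst].
Qed.

Lemma reflN u : refl (- u) = refl u.
Proof. by rewrite /refl !ldotE opprK linearN /= !mulNmx mulmxN opprK. Qed.

Lemma refl_conn u w A : 0 < ldot u u -> 0 < ldot w w ->
  @SOe R m A -> @SOe R m (refl w *m refl u *m A).
Proof.
move=> u0 w0 SA; have [uw|uw] := leP 0 (ldot u w); first exact: refl_conn_pos.
by rewrite -reflN; apply: refl_conn_pos => //; rewrite !ldotE ?opprK// ltW// oppr_gt0.
Qed.

Lemma refl_swap u v : ldot u u = ldot v v -> ldot (u - v) (u - v) != 0 ->
  refl (u - v) *m u = v.
Proof.
move=> uv; rewrite reflE => w0; rewrite [X in X *: _](_ : _ = 1).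
  by rewrite scale1r opprB addrC subrK.
rewrite (_ : 2 * _ = ldot (u - v) (u - v)) ?divff//.
by rewrite !ldotE (ldotC v u) uv; ring.
Qed.

Lemma refl_fix w u : ldot w u = 0 -> refl w *m u = u.
Proof. by move=> wu; rewrite reflE wu mulr0 mul0r scale0r subr0. Qed.

(* Rotating [u] onto [w] joins [refl u *m refl w] to [1%:M] (see [refl_conn]), so
   in a product of spacelike reflections the factors cancel in pairs up to
   connectedness; only the parity, i.e. the determinant, survives. *)
Definition refl_class A := (@SOe R m A /\ \det A = 1) \/
  (exists u, [/\ 0 < ldot u u, @SOe R m (refl u *m A) & \det A = -1]).

Lemma refl_classM w A : 0 < ldot w w -> refl_class (refl w *m A) ->
  refl_class A.
Proof.
move=> w0; have wn0 : ldot w w != 0 by rewrite gt_eqF.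
case=> [[SA dA]|[u [u0 SA dA]]]; move: dA; rewrite det_mulmx refl_det// mulN1r.
- by move=> /eqP; rewrite eqr_oppLR => /eqP dA; right; exists w.
- move=> /oppr_inj dA; left; split=> //.
  have un0 : ldot u u != 0 by rewrite gt_eqF.
  have := refl_conn u0 w0 SA.
  by rewrite !mulmxA -(mulmxA (refl w)) refl_refl// mulmx1 refl_refl// mul1mx.
Qed.

Definition et : 'cV[R]_(m + 2) := vec 0 0 1.

Lemma ldot_et x s t : ldot (vec x s t) et = - t.
Proof. by rewrite ldot_vec edot0r mulr0 mulr1 addr0 add0r. Qed.

Lemma spacelike_perp w : ldot w et = 0 -> w != 0 -> 0 < ldot w w.
Proof.
have [x [s [t ->]]] := vecP w; rewrite ldot_et => /eqP.
rewrite oppr_eq0 => /eqP ->; rewrite ldot_vec mul0r subr0 -expr2 => w0.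
rewrite lt0r addr_ge0 ?edot_ge0 ?sqr_ge0// andbT; apply: contra w0.
rewrite paddr_eq0 ?edot_ge0 ?sqr_ge0// edot_eq0 sqrf_eq0.
by move=> /andP[/eqP-> /eqP->]; rewrite vec0.
Qed.

Definition basis_vec (i : 'I_(m + 2)) : 'cV[R]_(m + 2) := delta_mx i 0.

Definition moved A := [set i | A *m basis_vec i != basis_vec i]%SET.

(** Cartan-Dieudonne induction. If [A] moves a basis vector $e_i$, then $w=Ae_i-e_i$ is orthogonal
    to the fixed [et], hence spacelike; its reflection brings $Ae_i$ back to $e_i$ and keeps every
    basis vector already fixed, all of them being orthogonal to $w$. *)
Lemma refl_class_fix n A : O A -> A *m et = et ->
  (#|moved A| <= n)%N ->
  refl_class A.
Proof.
elim: n A => [|n IH] A OA Ae.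
  rewrite leqn0 cards_eq0 => /eqP A0; left.
  have -> : A = 1%:M.
    apply/matrixP => i j.
    have : j \notin moved A.
      by rewrite A0 inE.
    rewrite inE negbK /basis_vec -colE => /eqP/matrixP/(_ i 0).
    by rewrite !mxE eqxx andbT.
  by rewrite det1; split=> //; apply: connected_component_refl; exact: lorentz1.
have [A0 _|[i]] := finset.set_0Vmem (moved A).
  by apply: IH; rewrite ?A0 ?cards0.
rewrite inE => iA cA; set w := A *m basis_vec i - basis_vec i.
have wn0 : w != 0 by rewrite subr_eq0.
have w0 : 0 < ldot w w.
  by apply: spacelike_perp => //; rewrite ldotBl -{1}Ae lorentz_ldot// subrr.
have wne : ldot w w != 0 by rewrite gt_eqF.
apply: (refl_classM w0); apply: IH.
- by apply: lorentzM => //; exact: refl_lorentz.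
- rewrite -mulmxA Ae refl_fix//.
  by rewrite ldotBl -{1}Ae lorentz_ldot// subrr.
- rewrite -ltnS; apply: leq_trans cA; apply: proper_card.
  apply/properP; split.
    apply/fintype.subsetP => j; rewrite !inE; apply: contra => /eqP Aj.
    rewrite -mulmxA Aj refl_fix//.
    by rewrite ldotBl -{1}Aj lorentz_ldot// subrr.
  exists i; rewrite inE ?iA// negbK -mulmxA refl_swap//.
  by rewrite lorentz_ldot.
Qed.

(** One spacelike reflection brings [A *m et] back to [et], after which [refl_class_fix] applies;
    the determinant then excludes the odd class. *)
Lemma lorentz_SOe A : O A -> \det A = 1 -> ldot (A *m et) et < 0 ->
  @SOe R m A.
Proof.
move=> OA dA tA; suff : refl_class A.
  by case=> [[]//|[u [_ _]]]; rewrite dA => H; exfalso; lra.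
have [Ae|Ae] := eqVneq (A *m et) et.
  exact: (@refl_class_fix #|moved A|%N).
have Qe : ldot (A *m et) (A *m et) = ldot et et by rewrite lorentz_ldot.
set w := A *m et - et.
(* With $t$ the time coordinate of [A *m et], this norm is $2(t-1)$. A future unit timelike vector
   has $t\ge1$, with equality only for [et] itself. *)
have w0 : 0 < ldot w w.
  rewrite /w; move: tA Ae Qe; have [x [s [t ->]]] := vecP (A *m et).
  rewrite ldot_et oppr_lt0 => t0 Ae; rewrite ldot_et ldot_vec -!expr2 => Qe.
  have xs : 0 <= edot x x + s ^+ 2 by rewrite addr_ge0 ?edot_ge0 ?sqr_ge0.
  have t1 : 1 < t.
    rewrite ltNge; apply/negP => t1; case/eqP: Ae.
    have t2 : t ^+ 2 <= 1 by rewrite expr_le1// ltW.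
    have : edot x x + s ^+ 2 == 0 by rewrite eq_le xs andbT; lra.
    rewrite paddr_eq0 ?edot_ge0 ?sqr_ge0// edot_eq0 sqrf_eq0 => /andP[/eqP x0 /eqP s0].
    have : t ^+ 2 = 1 by move: Qe; rewrite x0 s0 edot0l; lra.
    by move=> /eqP; rewrite sqrp_eq1 ?ltW// x0 s0 => /eqP ->.
  rewrite !ldotE (ldotC et) !ldot_et ldot_vec -!expr2 Qe; lra.
apply: (refl_classM w0); have wne : ldot w w != 0 by rewrite gt_eqF.
apply: (@refl_class_fix #|moved (refl w *m A)|%N) => //.
- by apply: lorentzM => //; exact: refl_lorentz.
- by rewrite -mulmxA refl_swap.
Qed.

End Reflections.

Lemma mulmx_vec_inj (R : nzRingType) p q (A B : 'M[R]_(p, q)) :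
  (forall u : 'cV[R]_q, A *m u = B *m u) -> A = B.
Proof.
move=> H; apply/matrixP => i j.
by have /matrixP/(_ i 0) := H (delta_mx j 0); rewrite -!colE !mxE.
Qed.

(** * The parabolic subgroup *)

Section Exponentials.
Context (R : realType) (k : nat).
Implicit Types X : 'M[R]_k.

Lemma scale_mulmx c X Y : c *: X * Y = c *: (X * Y).
Proof. by rewrite [RHS]scalemxAl. Qed.

Lemma mulmx_scale c X Y : X * (c *: Y) = c *: (X * Y).
Proof. by rewrite [RHS]scalemxAr. Qed.

Lemma exprZmx c X i : (c *: X) ^+ i = c ^+ i *: X ^+ i.
Proof.
elim: i => [|i IH]; first by rewrite !expr0 scale1r.
by rewrite !exprS IH scale_mulmx mulmx_scale scalerA.
Qed.

Lemma expmx_nilp3 X : X ^+ 3 = 0 -> expmx X = 1 + X + 2^-1 *: X ^+ 2.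
Proof.
move=> X3; apply: cvg_lim; first exact: norm_hausdorff.
apply: cvg_near_cst; near=> n.
have n3 : (3 <= n)%N by near: n; exact: nbhs_infty_ge.
rewrite /series /= (@big_cat_nat _ _ _ 3)//= [X in _ + X]big1_seq ?addr0; last first.
  move=> i; rewrite mem_index_iota => /andP[_ /andP[i3 _]].
  by rewrite -(subnK i3) exprD X3 mulr0 scaler0.
rewrite !big_nat_recr//= big_geq// add0r !factS fact0 invr1 !scale1r expr0.
by rewrite expr1.
Unshelve. all: by end_near. Qed.

(** $X^3=X$ means that $X$ is diagonalizable with eigenvalues among 0, 1, -1. [P0], [Pp] and [Pm]
    are the spectral projectors, and the series splits into three scalar ones. *)
Lemma expmx_cube X t : X ^+ 3 = X ->
  expmx (t *: X) = (1 - X ^+ 2) + expR t *: (2^-1 *: (X ^+ 2 + X)) +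
    expR (- t) *: (2^-1 *: (X ^+ 2 - X)).
Proof.
move=> X3; apply: cvg_lim; first exact: norm_hausdorff.
set P0 := 1 - _; set Pp := 2^-1 *: _; set Pm := 2^-1 *: _.
have XE i : X ^+ i = (i == 0)%:R *: P0 + Pp + (-1) ^+ i *: Pm.
  elim: i => [|i IH].
    rewrite expr0 scale1r expr0 scale1r /P0 /Pp /Pm -addrA -scalerDr.
    rewrite addrACA subrr addr0 -[X ^+ 2 in X in _ *: X]scale1r -scalerDl scalerA.
    by rewrite mulVf ?pnatr_eq0// scale1r subrK.
  rewrite exprSr IH 2!mulrDl (scale_mulmx _ P0) (scale_mulmx _ Pm) scale0r add0r.
  have -> : P0 * X = 0 by rewrite /P0 mulrBl mul1r -exprSr X3 subrr.
  have -> : Pp * X = Pp by rewrite /Pp scale_mulmx mulrDl -exprSr X3 -expr2 addrC.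
  have -> : Pm * X = - Pm.
    by rewrite /Pm scale_mulmx mulrBl -exprSr X3 -expr2 -scalerN opprB.
  by rewrite scaler0 add0r exprS mulN1r scaleNr scalerN.
clearbody P0 Pp Pm.
have -> : series (fun i => i`!%:R^-1 *: (t *: X) ^+ i) =
    fun n => (n != 0)%:R *: P0 + series (exp_coeff t) n *: Pp +
      series (exp_coeff (- t)) n *: Pm.
  apply/funext => n; rewrite /series /= !scaler_suml.
  rewrite (_ : (n != 0)%:R *: P0 = \sum_(0 <= i < n) (i == 0)%:R *: P0); last first.
    case: n => [|n]; first by rewrite big_geq// scale0r.
    by rewrite big_nat_recl//= big1 ?addr0// => i _; rewrite scale0r.
  rewrite -!big_split /=; apply: eq_bigr => i _.
  rewrite exprZmx XE !scalerDr !scalerA /exp_coeff /=; congr (_ *: _ + _ *: _ + _ *: _).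
  - by case: i => [|i]; rewrite ?mulr0// fact0 invr1 expr0 !mul1r.
  - by rewrite mulrC.
  - by rewrite -[- t]mulN1r exprMn; ring.
apply: cvgD; last by apply: cvgZr_tmp; exact: is_cvg_series_exp_coeff.
apply: cvgD; last by apply: cvgZr_tmp; exact: is_cvg_series_exp_coeff.
apply: cvg_near_cst; near=> n.
have -> : (n != 0)%N by rewrite -lt0n; near: n; exact: nbhs_infty_gt.
by rewrite scale1r.
Unshelve. all: by end_near. Qed.

End Exponentials.

Section Parabolic.
Context (R : realType) (m : nat).
Notation J := (@lorentz_form R m).
Notation O := (@lorentz_group R m).
Notation ep := (ep R m).
Notation em := (em R m).
Notation et := (et R m).
Implicit Types u v w : 'cV[R]_(m + 2).
Implicit Types x y z : 'cV[R]_m.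
Implicit Types A B X : 'M[R]_(m + 2).
Implicit Types al : 'rV[R]_m.

(* Null coordinates: [nvec x p q] is [x + p ep + q em]. *)
Definition nvec x (p q : R) : 'cV[R]_(m + 2) := vec x (p + q) (p - q).

Lemma nvecP u : exists x p q, u = nvec x p q.
Proof.
have [x [s [t ->]]] := vecP u; exists x, ((s + t) / 2), ((s - t) / 2).
by congr vec; field.
Qed.

Lemma nvec_inj x p q x' p' q' : nvec x p q = nvec x' p' q' ->
  [/\ x = x', p = p' & q = q'].
Proof. by move=> /vec_inj[-> s t]; split=> //; lra. Qed.

Lemma nvecD x p q x' p' q' :
  nvec x p q + nvec x' p' q' = nvec (x + x') (p + p') (q + q').
Proof. by rewrite vecD; congr vec; ring. Qed.

Lemma nvecZ c x p q : c *: nvec x p q = nvec (c *: x) (c * p) (c * q).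
Proof. by rewrite vecZ; congr vec; ring. Qed.

Lemma nvecN x p q : - nvec x p q = nvec (- x) (- p) (- q).
Proof. by rewrite vecN; congr vec; ring. Qed.

Lemma nvecB x p q x' p' q' :
  nvec x p q - nvec x' p' q' = nvec (x - x') (p - p') (q - q').
Proof. by rewrite nvecN nvecD. Qed.

Lemma nvec0 : nvec 0 0 0 = 0.
Proof. by rewrite /nvec addr0 subr0 vec0. Qed.

Lemma epE : ep = nvec 0 1 0.
Proof. by congr vec; ring. Qed.

Lemma emE : em = nvec 0 0 1.
Proof. by congr vec; ring. Qed.

Lemma etE : et = nvec 0 2^-1 (- 2^-1).
Proof. by congr vec; field. Qed.

Lemma nvec_sum x p q : nvec x p q = nvec x 0 0 + p *: ep + q *: em.
Proof. by rewrite epE emE !nvecZ !nvecD; congr vec; rewrite ?scaler0 ?addr0//; ring. Qed.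

Lemma ldot_nvec x p q x' p' q' :
  ldot (nvec x p q) (nvec x' p' q') = edot x x' + 2 * (p * q' + q * p').
Proof. by rewrite ldot_vec; ring. Qed.

Lemma mulmx_nvec_inj A B :
  (forall x p q, A *m nvec x p q = B *m nvec x p q) -> A = B.
Proof.
move=> H; apply: mulmx_vec_inj => u.
by have [x [p [q ->]]] := nvecP u; exact: H.
Qed.

Lemma block_vec (k : 'M[R]_m) (B : 'M[R]_(m, 2)) (C : 'M[R]_(2, m)) (D : 'M[R]_2) x s t :
  block_mx k B C D *m vec x s t =
  col_mx (k *m x + B *m @col_mx R 1 1 1 s%:M t%:M)
         (C *m x + D *m @col_mx R 1 1 1 s%:M t%:M).
Proof. by rewrite /vec mul_block_col. Qed.

Lemma mx22_col (a b c d s t : R) :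
  mx22 a b c d *m @col_mx R 1 1 1 s%:M t%:M =
  @col_mx R 1 1 1 (a * s + b * t)%:M (c * s + d * t)%:M.
Proof.
rewrite /mx22 (@mul_block_col _ 1 1 1 1) !mul_scalar_mx !scale_scalar_mx.
by rewrite -!raddfD.
Qed.

Lemma H0_vec x s t : H0 *m vec x s t = vec 0 t s.
Proof.
rewrite block_vec /Hboost mx22_col !mul0mx !add0r !mul0r !mul1r add0r addr0.
by [].
Qed.

Lemma H0_nvec x p q : H0 *m nvec x p q = nvec 0 p (- q).
Proof. by rewrite H0_vec; congr vec; ring. Qed.

Lemma X_vec (al : 'rV[R]_m) x s t :
  X_ al *m vec x s t =
  vec ((t - s) *: al^T) (edot al^T x) (edot al^T x).
Proof.
rewrite block_vec !mul0mx add0r addr0 (@mul_row_col _ _ 1 1) (@mul_col_mx _ 1 1).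
rewrite !mul_mx_scalar scalerN addrC -scalerBl /vec /edot trmxK.
by rewrite -!mx11_scalar.
Qed.

Lemma X_nvec (al : 'rV[R]_m) x p q :
  X_ al *m nvec x p q = nvec (- (2 * q) *: al^T) (edot al^T x) 0.
Proof. by rewrite X_vec; congr vec; [congr (_ *: _)| |]; ring. Qed.

Lemma Xb_nvec (Y : 'M[R]_m) (b : 'rV[R]_m) x p q :
  X_Ybeta0 Y b *m nvec x p q =
  nvec (Y *m x + (2 * p) *: b^T) 0 (- edot b^T x).
Proof.
rewrite /nvec block_vec (@mul_row_col _ _ 1 1) (@mul_col_mx _ 1 1) !mul0mx addr0.
have bx : b *m x = (edot b^T x)%:M by rewrite -edot_mx trmxK.
rewrite !mul_mx_scalar -scalerDl mulNmx bx /vec -raddfN /=.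
by congr col_mx; [congr (_ + _ *: _) | congr (@col_mx _ 1 1 1 _%:M _%:M)]; ring.
Qed.

Lemma mul_is_mulmx A B : A * B = A *m B.
Proof. by []. Qed.

Lemma expmx_H0_nvec t x p q :
  expmx (t *: H0) *m nvec x p q = nvec x (expR t * p) (expR (- t) * q).
Proof.
rewrite expmx_cube; last first.
  apply: mulmx_nvec_inj => x' p' q'.
  by rewrite !exprS expr0 mulr1 !mul_is_mulmx -!mulmxA !H0_nvec opprK.
rewrite expr2 !mulmxDl mul1mx mulNmx -!scalemxAl !mulmxDl mulNmx.
rewrite !mul_is_mulmx -!mulmxA !H0_nvec opprK.
rewrite !(nvecN, nvecD, nvecZ) /nvec.
by congr vec; rewrite ?(subr0, addr0, oppr0, scaler0)//; field.
Qed.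

Lemma expmx_X_nvec al x p q :
  expmx (X_ al) *m nvec x p q =
  nvec (x - (2 * q) *: al^T) (p + edot al^T x - q * edot al^T al^T) q.
Proof.
rewrite expmx_nilp3; last first.
  apply: mulmx_nvec_inj => x' p' q'.
  rewrite !exprS expr0 mulr1 !mul_is_mulmx mul0mx -!mulmxA !X_nvec.
  by rewrite mulr0 oppr0 scale0r edot0r nvec0.
rewrite !mulmxDl mul1mx -scalemxAl expr2 mul_is_mulmx -mulmxA !X_nvec.
rewrite !(nvecN, nvecD, nvecZ) /nvec edotZr mulr0 oppr0 scale0r scaler0 addr0 scaleNr.
by congr vec; field.
Qed.

Definition kblock (k : 'M[R]_m) : 'M[R]_(m + 2) := block_mx k 0 0 1%:M.

Lemma kblock_nvec k x p q : kblock k *m nvec x p q = nvec (k *m x) p q.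
Proof. by rewrite block_vec !mul0mx mul1mx addr0 add0r. Qed.

Lemma kblock_lorentz k : k *m k^T = 1%:M -> O (kblock k).
Proof.
move=> /mulmx1C kk; apply/lorentzP => u v.
have [x [p [q ->]]] := nvecP u; have [x' [p' [q' ->]]] := nvecP v.
by rewrite !kblock_nvec !ldot_nvec edot_adj mulmxA kk mul1mx.
Qed.

Lemma det_kblock k : \det (kblock k) = \det k.
Proof. by rewrite /kblock det_ublock det1 mulr1. Qed.

Lemma expmx_H0_lorentz t : O (expmx (t *: H0)).
Proof.
apply/lorentzP => u v.
have [x [p [q ->]]] := nvecP u; have [x' [p' [q' ->]]] := nvecP v.
rewrite !expmx_H0_nvec !ldot_nvec expRN.
have : expR t != 0 by rewrite gt_eqF// expR_gt0.
by move=> e0; field.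
Qed.

Lemma expmx_X_lorentz al : O (expmx (X_ al)).
Proof.
apply/lorentzP => u v.
have [x [p [q ->]]] := nvecP u; have [x' [p' [q' ->]]] := nvecP v.
rewrite !expmx_X_nvec !ldot_nvec !(edotBl, edotBr, edotZl, edotZr).
by rewrite (edotC x al^T); ring.
Qed.

Lemma expmx_H0D s t :
  expmx (s *: H0) *m expmx (t *: H0) = expmx ((s + t) *: H0) :> 'M[R]_(m + 2).
Proof.
apply: mulmx_nvec_inj => x p q.
by rewrite -mulmxA !expmx_H0_nvec opprD !expRD !mulrA.
Qed.

Lemma expmx_XD al al' :
  expmx (X_ al) *m expmx (X_ al') = expmx (X_ (al + al')).
Proof.
apply: mulmx_nvec_inj => x p q.
rewrite -mulmxA !expmx_X_nvec linearD /=.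
rewrite !(edotBl, edotBr, edotZl, edotZr, edotDl, edotDr) (edotC al'^T al^T).
rewrite scalerDr opprD; congr nvec; last by ring.
by rewrite -addrA [X in _ + X]addrC.
Qed.

(** The matrix is the square of a Lorentz matrix, whose determinant is 1 or -1. The same halving
    works for [expmx (X_ al)]. *)
Lemma det_expmx_H0 t : \det (expmx (t *: H0 : 'M[R]_(m + 2))) = 1.
Proof.
have -> : t = t / 2 + t / 2 by field.
rewrite -expmx_H0D det_mulmx.
by case: (det_lorentz (expmx_H0_lorentz (t / 2))) => ->; ring.
Qed.

Lemma det_expmx_X al : \det (expmx (X_ al)) = 1.
Proof.
have -> : al = 2^-1 *: al + 2^-1 *: al.
  by rewrite -scalerDl -[LHS]scale1r; congr (_ *: _); field.
rewrite -expmx_XD det_mulmx.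
by case: (det_lorentz (expmx_X_lorentz (2^-1 *: al))) => ->; ring.
Qed.

(* The stabilizer of the null ray of [ep]; [Pmx_SOe] and [Pmx_decomp] identify it
   with the image of P in SO_e. *)
Definition Pmx : set 'M[R]_(m + 2) := [set A | [/\ O A, \det A = 1 &
  exists2 c, 0 < c & A *m ep = c *: ep]].

Lemma Pmx_lorentz A : Pmx A -> O A. Proof. by case. Qed.

Lemma Pmx1 : Pmx 1%:M.
Proof.
split; [exact: lorentz1|exact: det1|].
by exists 1 => //; rewrite mul1mx scale1r.
Qed.

Lemma PmxM A B : Pmx A -> Pmx B -> Pmx (A *m B).
Proof.
move=> [OA dA [c c0 cA]] [OB dB [d d0 dE]]; split.
- exact: lorentzM.
- by rewrite det_mulmx dA dB mulr1.
- exists (c * d); first exact: mulr_gt0.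
  by rewrite -mulmxA dE -scalemxAr cA scalerA mulrC.
Qed.

Lemma PmxV A : Pmx A -> Pmx (invmx A).
Proof.
move=> [OA dA [c c0 cA]]; split.
- exact: lorentzV.
- by rewrite det_inv dA invr1.
- exists c^-1; first by rewrite invr_gt0.
  rewrite -[in RHS](mul1mx ep) -(lorentz_Vmul OA) -mulmxA cA -scalemxAr scalerA.
  by rewrite mulVf ?scale1r// gt_eqF.
Qed.

(** Only the time orientation is at stake. Pairing [A *m et] with [A *m ep = c *: ep], $c>0$, makes
    its [em] coordinate negative; its norm being -1, the [ep] coordinate is then positive. *)
Lemma Pmx_SOe A : Pmx A -> @SOe R m A.
Proof.
move=> [OA dA [c c0 cA]]; apply: lorentz_SOe => //.
have E1 : c * ldot (A *m et) ep = -1.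
  by rewrite -ldotZr -cA lorentz_ldot// etE epE ldot_nvec edot0l; field.
have E2 : ldot (A *m et) (A *m et) = -1.
  by rewrite lorentz_ldot// etE ldot_nvec edot0l; field.
have [x [p [q E]]] := nvecP (A *m et); move: E1 E2; rewrite E etE epE !ldot_nvec.
rewrite !edot0r => E1 E2.
have q0 : q < 0.
  by rewrite -(pmulr_rlt0 _ c0); move: E1; nra.
have pq : p * q < 0 by have := edot_ge0 x; nra.
have p0 : 0 < p by rewrite -(nmulr_llt0 _ q0).
lra.
Qed.

(** Preserving both null lines forces [D] to preserve their orthogonal complement, where it is [k];
    on the plane of [ep] and [em] it is the boost of parameter [ln c]. *)
Lemma kblock_split D c : O D -> 0 < c -> D *m ep = c *: ep ->
  D *m em = c^-1 *: em ->
  exists2 k, k *m k^T = 1%:M & D = kblock k *m expmx (ln c *: H0).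
Proof.
move=> OD c0 Dp Dm; have cn0 : c != 0 by rewrite gt_eqF.
pose k := ulsubmx D.
have Dx x : D *m nvec x 0 0 = nvec (k *m x) 0 0.
  have [y [p [q E]]] := nvecP (D *m nvec x 0 0).
  have : ldot (D *m nvec x 0 0) (D *m ep) = 0.
    by rewrite lorentz_ldot// epE ldot_nvec edot0r; ring.
  have : ldot (D *m nvec x 0 0) (D *m em) = 0.
    by rewrite lorentz_ldot// emE ldot_nvec edot0r; ring.
  rewrite Dp Dm E !ldotZr epE emE !ldot_nvec !edot0r.
  move=> /eqP; rewrite mulf_eq0 invr_eq0 (negbTE cn0)/= => /eqP p0.
  move=> /eqP; rewrite mulf_eq0 (negbTE cn0)/= => /eqP q0.
  have {}p0 : p = 0 by lra.
  have {}q0 : q = 0 by lra.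
  subst p q; congr nvec; move: E.
  by rewrite /nvec -{1}(submxK D) block_vec => /eq_col_mx[<- _];
     rewrite addr0 subr0 !raddf0 (@col_mx0 _ 1 1) mulmx0 addr0.
exists k.
  apply: mulmx1C; apply: mulmx_vec_inj => y; rewrite mul1mx.
  apply/eqP; rewrite -subr_eq0 -edot_eq0; apply/eqP.
  set z := _ - y; rewrite {1}/z edotBl -mulmxA edot_adj trmxK.
  have := lorentz_ldot (nvec y 0 0) (nvec z 0 0) OD.
  by rewrite !Dx !ldot_nvec !mul0r addr0 mulr0 !addr0 => ->; rewrite subrr.
apply: mulmx_nvec_inj => x p q.
rewrite -mulmxA expmx_H0_nvec kblock_nvec expRN lnK ?posrE//.
rewrite nvec_sum !mulmxDr -!scalemxAr Dx Dp Dm [RHS]nvec_sum !scalerA.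
by rewrite (mulrC p) (mulrC q).
Qed.

(** The factor in N is the one that carries [invmx A *m em] back to the line of [em]; once it is
    removed from [A], both null lines are preserved and [kblock_split] applies. *)
Lemma Pmx_decomp A : Pmx A -> exists (k : 'M[R]_m) (t : R) (al : 'rV[R]_m),
  [/\ k *m k^T = 1%:M, \det k = 1 &
      A = kblock k *m expmx (t *: H0) *m expmx (X_ al)].
Proof.
move=> [OA dA [c c0 cA]]; have cn0 : c != 0 by rewrite gt_eqF.
have [x [p [q E]]] := nvecP (invmx A *m em).
have Eq : q = c.
  have := lorentz_ldot (invmx A *m em) ep OA.
  rewrite cA mulmxA lorentz_mulV// mul1mx E epE emE nvecZ !ldot_nvec !edot0r.
  by rewrite edot0l; lra.
have Ep : edot x x + 4 * (p * c) = 0.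
  have := lorentz_ldot (invmx A *m em) (invmx A *m em) OA.
  rewrite mulmxA lorentz_mulV// mul1mx E emE !ldot_nvec edot0r Eq; lra.
(* Chosen to cancel the component [x] in [expmx_X_nvec], where [al] is multiplied by [2 * q] and [q]
   equals [c]. *)
pose al := (2 * c)^-1 *: x^T.
have nE : expmx (X_ al) *m (invmx A *m em) = c *: em.
  rewrite E Eq expmx_X_nvec emE nvecZ; have -> : al^T = (2 * c)^-1 *: x.
    by rewrite /al linearZ /= trmxK.
  congr nvec.
  - by rewrite scalerA mulfV ?scale1r ?subrr ?scaler0// mulf_neq0.
  - rewrite !(edotZl, edotZr); have -> : edot x x = - (4 * (p * c)) by lra.
    by field.
  - by rewrite mulr1.
have nV : expmx (X_ al) *m expmx (X_ (- al)) = 1%:M.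
  apply: mulmx_nvec_inj => y p' q'.
  rewrite expmx_XD subrr expmx_X_nvec trmx0 !edot0l mulr0 scaler0 mul1mx.
  by rewrite subr0 addr0 subr0.
have nV' := mulmx1C nV.
have OX := expmx_X_lorentz (- al).
have Xp : expmx (X_ (- al)) *m ep = ep.
  rewrite epE expmx_X_nvec.
  by rewrite mulr0 scale0r subr0 edot0r mul0r subr0 addr0.
have dX := det_expmx_X al.
move: nE nV' OX Xp dX; move: (expmx (X_ (- al))) => N'.
have [N NE] : exists N, N = expmx (X_ al) by exists (expmx (X_ al)).
rewrite -NE => nE nV' OX Xp dX.
have [D DA] : exists D, D = A *m N' by exists (A *m N').
have AE : A = D *m N by rewrite DA -mulmxA nV' mulmx1.
have OD : O D by rewrite DA; exact: lorentzM.
have Dp : D *m ep = c *: ep by rewrite DA -mulmxA Xp.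
have Dm : D *m em = c^-1 *: em.
  have Dc : D *m (c *: em) = em.
    by rewrite -nE mulmxA -AE mulmxA lorentz_mulV// mul1mx.
  by rewrite -[in RHS]Dc -scalemxAr scalerA mulVf ?scale1r.
have [k kk DE] := kblock_split OD c0 Dp Dm.
exists k, (ln c), al; split=> //.
  by move: dA; rewrite AE DE !det_mulmx dX det_expmx_H0 !mulr1 det_kblock.
by rewrite -NE -DE.
Qed.

Lemma Pmx_X al : Pmx (expmx (X_ al)).
Proof.
split; [exact: expmx_X_lorentz|exact: det_expmx_X|exists 1 => //].
by rewrite scale1r epE expmx_X_nvec mulr0 scale0r edot0r mul0r !subr0 addr0.
Qed.

Lemma Pmx_comp k t al : k *m k^T = 1%:M -> \det k = 1 ->
  Pmx (kblock k *m expmx (t *: H0) *m expmx (X_ al)).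
Proof.
move=> kk dk.
have PH : Pmx (expmx (t *: H0)).
  split; [exact: expmx_H0_lorentz|exact: det_expmx_H0|].
  exists (expR t); first exact: expR_gt0.
  by rewrite epE expmx_H0_nvec nvecZ scaler0 !mulr0 mulr1.
have Pk : Pmx (kblock k).
  split; [exact: kblock_lorentz|by rewrite det_kblock|exists 1 => //].
  by rewrite scale1r epE kblock_nvec mulmx0.
exact: PmxM (PmxM Pk PH) (Pmx_X al).
Qed.

End Parabolic.

(** * The dual of p as a quotient of g *)

Section LieAlgebraElements.
Context (R : realType) (m : nat).
Notation J := (@lorentz_form R m).
Notation O := (@lorentz_group R m).
Notation ep := (ep R m).
Notation em := (em R m).
Implicit Types x y z : 'cV[R]_m.
Implicit Types b al : 'rV[R]_m.
Implicit Types A B X : 'M[R]_(m + 2).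
Implicit Types Y : 'M[R]_m.

(* The general element of g: [Y + c H_0 + X_{0,b,0} + X_al]. *)
Definition gmx Y (c : R) b al : 'M[R]_(m + 2) :=
  block_mx Y (@row_mx _ _ 1 1 (b - al)^T (b + al)^T)
    (@col_mx _ 1 1 _ (al - b) (al + b)) (c *: Hboost).

Lemma gmxE Y c b al : gmx Y c b al = upper_left Y + c *: H0 + X_Ybeta0 0 b + X_ al.
Proof.
rewrite /gmx /upper_left /H0 /X_Ybeta0 /X_ scale_block_mx !scaler0.
rewrite !add_block_mx !addr0 !add0r (@add_row_mx _ _ 1 1) (@add_col_mx _ 1 1).
by rewrite !linearD !linearN /= (addrC al (- b)) (addrC al b).
Qed.

Lemma upper_left_nvec Y x p q : upper_left Y *m nvec x p q = nvec (Y *m x) 0 0.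
Proof.
rewrite /upper_left /nvec block_vec !mul0mx !addr0 subr0 /vec.
by rewrite raddf0 (@col_mx0 _ 1 1).
Qed.

Lemma gmx_nvec Y c b al x p q : gmx Y c b al *m nvec x p q =
  nvec (Y *m x + (2 * p) *: b^T - (2 * q) *: al^T)
    (edot al^T x + c * p) (- edot b^T x - c * q).
Proof.
rewrite gmxE !mulmxDl -scalemxAl H0_nvec X_nvec Xb_nvec mul0mx add0r.
rewrite upper_left_nvec !(nvecZ, nvecD) scaleNr scaler0 addr0; congr nvec; ring.
Qed.

Lemma gmx_ep Y c b al : gmx Y c b al *m ep = nvec (2 *: b^T) c 0.
Proof.
rewrite epE gmx_nvec mulmx0 add0r !edot0r !mulr0 !mulr1 scale0r subr0 add0r.
by rewrite oppr0 addr0.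
Qed.

Lemma g_algE X : X \in g_alg R m -> exists Y c b al,
  Y \in so_m R m /\ X = gmx Y c b al.
Proof.
move=> gX.
have [x1 [p1 [q1 E1]]] := nvecP (X *m ep).
have [x2 [p2 [q2 E2]]] := nvecP (X *m em).
have H1 : q1 = 0.
  have := g_ldot_self ep gX; rewrite E1 epE ldot_nvec edot0r; lra.
have H2 : p2 = 0.
  have := g_ldot_self em gX; rewrite E2 emE ldot_nvec edot0r; lra.
have H3 : q2 = - p1.
  have := g_ldot ep em gX; rewrite E1 E2 epE emE !ldot_nvec edot0r edot0l; lra.
pose b := 2^-1 *: x1^T; pose al := - 2^-1 *: x2^T; pose Y := ulsubmx X.
have Hx x : X *m nvec x 0 0 = nvec (Y *m x) (edot al^T x) (- edot b^T x).
  have [y [p [q E]]] := nvecP (X *m nvec x 0 0).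
  have Hq : q = - edot b^T x.
    have := g_ldot (nvec x 0 0) ep gX; rewrite E1 E epE !ldot_nvec edot0r.
    rewrite /b linearZ /= trmxK edotZl (edotC x1); lra.
  have Hp : p = edot al^T x.
    have := g_ldot (nvec x 0 0) em gX; rewrite E2 E emE !ldot_nvec edot0r.
    rewrite /al linearZ /= trmxK edotZl (edotC x2); lra.
  rewrite -Hp -Hq E; congr nvec; move: E.
  by rewrite /nvec -{1}(submxK X) block_vec => /eq_col_mx[<- _];
     rewrite addr0 subr0 !raddf0 (@col_mx0 _ 1 1) mulmx0 addr0.
exists Y, p1, b, al; split.
  rewrite mem_so_m; apply/eqP; apply: mulmx_vec_inj => y; rewrite mul0mx.
  apply/eqP; rewrite -edot_eq0; apply/eqP; set z := (_ + _) *m y.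
  rewrite {1}/z mulmxDl edotDl (edotC (Y^T *m y)) -edot_adj.
  have := g_ldot (nvec y 0 0) (nvec z 0 0) gX.
  rewrite !Hx !ldot_nvec (edotC (Y *m z)); lra.
apply: mulmx_nvec_inj => x p q; rewrite gmx_nvec nvec_sum !mulmxDr Hx.
rewrite -!scalemxAr E1 E2 H1 H2 H3 !nvecZ !nvecD /b /al !linearZ /= !trmxK.
rewrite !scalerA; congr nvec; [|by rewrite mulr0 addr0 mulrC|]; last first.
  by rewrite mulr0 addr0 mulrN mulrC -mulrN.
by rewrite scalerN -scaleNr; congr (_ + _ *: _ + _ *: _); field.
Qed.

Lemma gmx_g Y c b al : Y \in so_m R m -> gmx Y c b al \in g_alg R m.
Proof.
rewrite mem_so_m => /eqP Y0; apply/g_algP => u v.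
have [x [p [q ->]]] := nvecP u; have [x' [p' [q' ->]]] := nvecP v.
have YE : edot (Y *m x) x' = - edot x (Y *m x').
  rewrite edot_adj; apply/eqP; rewrite -subr_eq0 opprK -edotDr -mulmxDl.
  by rewrite addrC Y0 mul0mx edot0r.
rewrite !gmx_nvec !ldot_nvec !(edotDl, edotDr, edotNl, edotNr, edotZl, edotZr) YE.
by rewrite !(edotC x); ring.
Qed.

Lemma Xb_gmx Y b al : X_Ybeta0 Y b + X_ al = gmx Y 0 b al.
Proof.
rewrite gmxE scale0r addr0; congr (_ + _).
by rewrite /upper_left /X_Ybeta0 add_block_mx !addr0 !add0r.
Qed.

Lemma gmxB Y c b al Y' c' b' al' : gmx Y c b al - gmx Y' c' b' al' =
  gmx (Y - Y') (c - c') (b - b') (al - al').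
Proof.
apply: mulmx_nvec_inj => x p q; rewrite mulmxBl !gmx_nvec nvecB.
rewrite !linearB /= mulmxBl ?scalerBr !edotBl; congr nvec; last 2 first.
- by ring.
- by ring.
by rewrite addrACA opprD; congr (_ + _); rewrite addrACA.
Qed.

Lemma gmxX al : X_ al = gmx 0 0 0 al.
Proof.
by rewrite -Xb_gmx /X_Ybeta0 trmx0 oppr0 (@row_mx0 _ _ 1 1) (@col_mx0 _ 1 1) block_mx0 add0r.
Qed.

Lemma gmxBX Y c b al al' : gmx Y c b al - gmx Y c b al' = X_ (al - al').
Proof. by rewrite gmxB !subrr -gmxX. Qed.

(** In these coordinates n pairs only with the [b] component, and the form is definite on so(m) and
    on a. This is the identification of the dual of p with g / n. *)
Lemma gmx_tr Y c b al Y' c' b' al' :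
  2^-1 * \tr (gmx Y c b al *m gmx Y' c' b' al') =
  2^-1 * \tr (Y *m Y') + c * c' + 2 * (edot b^T al'^T + edot al^T b'^T).
Proof.
rewrite /gmx mulmx_block (@mul_row_col _ _ 1 1) (@mul_col_row _ 1 1 m 1 1).
rewrite mxtrace_block !mxtraceD (@mxtrace_block _ 1 1).
have HH : \tr ((c *: Hboost) *m (c' *: Hboost)) = 2 * (c * c').
  rewrite -scalemxAl -scalemxAr scalerA mxtraceZ mulrC; congr (_ * _).
  rewrite /Hboost /mx22 (@mulmx_block _ 1 1 1 1 1 1) (@mxtrace_block _ 1 1).
  rewrite !mul_scalar_mx !scale_scalar_mx -!raddfD /= !mxtrace_scalar.
  by rewrite !mul0r !mul1r add0r addr0 mulr1n.
have dE (u v : 'rV[R]_m) : \tr (u *m v^T) = edot u^T v^T.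
  by rewrite /edot trmxK /mxtrace big_ord1.
rewrite HH !(mxtrace_mulC _^T) !dE !linearB !linearD /=.
rewrite !(edotDl, edotDr, edotNl, edotNr).
rewrite (edotC al'^T) (edotC b'^T b^T) (edotC b'^T al^T) (edotC al'^T al^T).
by field.
Qed.

Lemma p_algE Y c al : Y \in so_m R m -> gmx Y c 0 al \in p_alg R m.
Proof.
move=> sY; rewrite gmxE /X_Ybeta0 trmx0 oppr0 (@row_mx0 _ _ 1 1) (@col_mx0 _ 1 1).
rewrite block_mx0 addr0; apply: memv_add; first apply: memv_add.
- by apply/memv_imgP; exists Y => //; rewrite lfunE.
- exact: memvZ (memv_line _).
- by apply/mem_n_alg; exists al.
Qed.

Lemma p_algP X : reflect (X \in g_alg R m /\ exists c, X *m ep = c *: ep)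
  (X \in p_alg R m).
Proof.
apply: (iffP idP) => [pX|[gX [c cX]]].
  split; first exact: (subvP (p_sub_g R m)).
  have /memv_addP[L /memv_addP[M /memv_imgP[Y _ ->] [H /vlineP[c ->] ->]] [N + ->]] := pX.
  move=> /mem_n_alg[al ->]; rewrite lfunE /=; exists c.
  rewrite epE !mulmxDl -scalemxAl H0_nvec X_nvec !edot0r mulr0 oppr0 scale0r nvec0 addr0.
  by rewrite upper_left_nvec mulmx0 nvec0 add0r ?oppr0 nvecZ scaler0 mulr1 mulr0.
have [Y [c' [b [al [sY XE]]]]] := g_algE gX.
have b0 : b = 0.
  move: cX; rewrite XE gmx_ep epE nvecZ scaler0 => /nvec_inj[/eqP + _ _].
  by rewrite scaler_eq0 pnatr_eq0 /= => /eqP bT; rewrite -(trmxK b) bT trmx0.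
by rewrite XE b0; exact: p_algE.
Qed.

Lemma so_m_tr Y : Y \in so_m R m -> Y^T = - Y.
Proof. by rewrite mem_so_m addrC addr_eq0 => /eqP. Qed.

Lemma so_m_tr0 Y : Y \in so_m R m -> \tr (Y *m Y) = 0 -> Y = 0.
Proof.
move=> sY trY; apply/matrixP => i j; rewrite mxE.
have : \tr (Y *m Y^T) == 0 by rewrite so_m_tr// mulmxN raddfN /= trY oppr0.
rewrite /mxtrace psumr_eq0; last first.
  move=> k _; rewrite mxE sumr_ge0// => l _.
  by rewrite mxE -expr2 sqr_ge0.
move=> /allP/(_ i (mem_index_enum _)); rewrite mxE psumr_eq0; last first.
  by move=> l _; rewrite mxE -expr2 sqr_ge0.
by move=> /allP/(_ j (mem_index_enum _)); rewrite mxE mulf_eq0 orbb => /eqP.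
Qed.

Lemma prE X (Y : subvs_of (p_alg R m)) :
  pr X Y = 2^-1 * \tr (X *m vsval Y).
Proof.
rewrite /pr /moment lfunE /= /restrict_fun /iotag lfunE /= /iotag_fun vsprojK//.
exact: (subvP (p_sub_g R m)) (subvsP Y).
Qed.

Lemma pr_proj X (Y : 'M[R]_(m + 2)) : Y \in p_alg R m ->
  pr X (vsproj _ Y) = 2^-1 * \tr (X *m Y).
Proof. by move=> pY; rewrite prE vsprojK. Qed.

Lemma pr_eqP X X' : X \in g_alg R m -> X' \in g_alg R m ->
  pr X = pr X' <-> exists al, X = X' + X_ al.
Proof.
move=> gX gX'; split=> [H|[al ->]]; last first.
  apply/lfunP => Y; rewrite !prE mulmxDl mxtraceD mulrDr.
  have /p_algP[gY [c cY]] := subvsP Y.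
  have [Y' [c' [b [al' [sY XE]]]]] := g_algE gY.
  have b0 : b = 0.
    move: cY; rewrite XE gmx_ep epE nvecZ scaler0 => /nvec_inj[/eqP + _ _].
    by rewrite scaler_eq0 pnatr_eq0 /= => /eqP bT; rewrite -(trmxK b) bT trmx0.
  rewrite XE b0 gmxX gmx_tr mul0mx raddf0 trmx0 edot0l edot0r.
  by rewrite !(mul0r, mulr0, addr0).
have [Y [c [b [al [sY XE]]]]] := g_algE gX.
have [Y' [c' [b' [al' [sY' XE']]]]] := g_algE gX'.
have sD : Y - Y' \in so_m R m by exact: memvB.
(* Testing on elements of p. The choices [U := Y - Y'], [d := 1] and [ga := b - b'] isolate the
   three components that p sees, by definiteness. *)
have key U d ga : U \in so_m R m -> 2^-1 * \tr ((Y - Y') *m U) +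
    (c - c') * d + 2 * edot (b - b')^T ga^T = 0.
  move=> sU; have := congr1 (fun h : lin_dual (p_alg R m) =>
    h (vsproj _ (gmx U d 0 ga))) H.
  rewrite /= !pr_proj ?p_algE// => /eqP; rewrite -subr_eq0 -mulrBr -raddfB /=.
  by rewrite -mulmxBl XE XE' gmxB gmx_tr trmx0 edot0r addr0 => /eqP.
have s0 : (0 : 'M[R]_m) \in so_m R m by exact: mem0v.
have YY : Y = Y'.
  have := key _ 0 0 sD; rewrite mulr0 trmx0 edot0r mulr0 !addr0 => /eqP.
  rewrite mulf_eq0 invr_eq0 pnatr_eq0 /= => /eqP /(so_m_tr0 sD) /eqP.
  by rewrite subr_eq0 => /eqP.
have cc : c = c'.
  have := key _ 1 0 s0; rewrite mulmx0 raddf0 trmx0 edot0r; lra.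
have bb : b = b'.
  have := key _ 0 (b - b') s0; rewrite mulmx0 raddf0 !mulr0 !add0r => /eqP.
  rewrite mulf_eq0 pnatr_eq0 /= edot_eq0 => /eqP H0.
  by apply/eqP; rewrite -subr_eq0 -(trmxK (b - b')) H0 trmx0.
exists (al - al'); rewrite XE XE' -YY -cc -bb -(gmxBX Y c b).
by rewrite addrC subrK.
Qed.

(** The pairing with [X_ b] is $2|b|^2$, and [b = 0] is exactly the condition that [ep] be an
    eigenvector. *)
Lemma pr_n0 X : X \in g_alg R m ->
  (forall N, N \in n_alg R m -> pr X (vsproj _ N) = 0) <->
  exists c, X *m ep = c *: ep.
Proof.
move=> gX; have [Y [c [b [al [sY XE]]]]] := g_algE gX.
have Nal ga : X_ ga \in p_alg R m.
  by rewrite gmxX; apply: p_algE; exact: mem0v.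
split=> [H|[c' cX]].
  have nb : X_ b \in n_alg R m by apply/mem_n_alg; exists b.
  exists c; have := H _ nb; rewrite pr_proj// XE gmxX gmx_tr.
  rewrite mulmx0 raddf0 trmx0 edot0r !mulr0 !add0r addr0 => /eqP.
  rewrite mulf_eq0 pnatr_eq0 /= edot_eq0 => /eqP b0.
  by rewrite gmx_ep b0 epE nvecZ !scaler0 mulr0 mulr1.
move=> _ /mem_n_alg[ga ->]; rewrite pr_proj// XE gmxX gmx_tr.
have -> : b^T = 0.
  move: cX; rewrite XE gmx_ep epE nvecZ scaler0 => /nvec_inj[/eqP + _ _].
  by rewrite scaler_eq0 pnatr_eq0 /= => /eqP bT.
by rewrite mulmx0 raddf0 trmx0 edot0r edot0l !(mulr0, addr0).
Qed.

Lemma Pmx_p_alg A (Y : 'M[R]_(m + 2)) : Pmx A -> Y \in p_alg R m ->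
  invmx A *m Y *m A \in p_alg R m.
Proof.
move=> PA /p_algP[gY [c cY]]; have OA := Pmx_lorentz PA.
case: (PA) => _ _ [d d0 dA]; apply/p_algP; split.
  have := g_conj (lorentzV OA) gY; by rewrite invmxK.
exists c; rewrite -!mulmxA dA -!scalemxAr cY -scalemxAr scalerA mulrC -scalerA.
by rewrite scalemxAr -dA mulmxA lorentz_Vmul// mul1mx.
Qed.

End LieAlgebraElements.

Section CoadjointOrbits.
Context (R : realType) (m : nat).
Context (G : topologicalGroupType) (cov : G -> 'M[R]_(m + 2)).
Hypothesis G_Spin : is_Spin cov.
Notation O := (@lorentz_group R m).
Implicit Types A B X : 'M[R]_(m + 2).

Lemma cov_lorentz g : O (cov g).
Proof.
have [_ _ [_ rg _]] := G_Spin.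
have : (range cov) (cov g) by exists g.
by rewrite rg => /connected_component_sub.
Qed.

Lemma covM g h : cov (g * h)%g = cov g *m cov h.
Proof. by have [_ cM _] := G_Spin; exact: cM. Qed.

Lemma cov1 : cov 1%g = 1%:M.
Proof.
have O1 := cov_lorentz 1%g.
have : cov 1%g *m cov 1%g = cov 1%g by rewrite -covM mulg1.
move=> /(congr1 (mulmx (invmx (cov 1%g)))).
by rewrite mulmxA lorentz_Vmul// mul1mx.
Qed.

Lemma covV g : cov g^-1%g = invmx (cov g).
Proof.
have Og := cov_lorentz g.
have : cov g *m cov g^-1%g = 1%:M by rewrite -covM mulgV cov1.
move=> /(congr1 (mulmx (invmx (cov g)))).
by rewrite mulmxA lorentz_Vmul// mul1mx mulmx1.
Qed.

Lemma cov_surj A : @SOe R m A -> exists g, cov g = A.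
Proof. by have [_ _ [_ <- _]] := G_Spin; case=> g _ <-; exists g. Qed.

Lemma P_grpP g : P_grp cov g <-> Pmx (cov g).
Proof.
split=> [[k [t [al [kk dk ->]]]]|/Pmx_decomp[k [t [al [kk dk E]]]]].
  exact: Pmx_comp.
by exists k, t, al.
Qed.

Lemma Pmx_lift A : Pmx A -> exists2 g, P_grp cov g & cov g = A.
Proof.
move=> PA; have [g gA] := cov_surj (Pmx_SOe PA).
by exists g => //; apply/P_grpP; rewrite gA.
Qed.

Lemma P_grp1 : P_grp cov 1%g.
Proof. by apply/P_grpP; rewrite cov1; exact: Pmx1. Qed.

Lemma P_grpM g h : P_grp cov g -> P_grp cov h -> P_grp cov (g * h)%g.
Proof. by rewrite !P_grpP covM; exact: PmxM. Qed.

Lemma P_grpV g : P_grp cov g -> P_grp cov g^-1%g.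
Proof. by rewrite !P_grpP covV; exact: PmxV. Qed.

Lemma AdE g X : Ad cov g X = cov g *m X *m invmx (cov g).
Proof. by rewrite /Ad covV. Qed.

Lemma Ad1 X : Ad cov 1%g X = X.
Proof. by rewrite /Ad invg1 cov1 mul1mx mulmx1. Qed.

Lemma AdM g h X : Ad cov (g * h)%g X = Ad cov g (Ad cov h X).
Proof. by rewrite /Ad invgM !covM !mulmxA. Qed.

(** [coad] passes through [vsproj], which is faithful only on [V]; stability is what makes it an
    action. *)
Definition Ad_stable (V : {vspace 'M[R]_(m + 2)}) (g : G) :=
  forall Y, Y \in V -> Ad cov g Y \in V.

Lemma Ad_g_stable g : Ad_stable (g_alg R m) g.
Proof. by move=> Y gY; rewrite AdE; apply: g_conj => //; exact: cov_lorentz. Qed.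

Lemma Ad_p_stable g : P_grp cov g -> Ad_stable (p_alg R m) g.
Proof.
move=> /P_grpV /P_grpP PA Y pY.
have := Pmx_p_alg PA pY; rewrite covV invmxK AdE; exact.
Qed.

Lemma coadE V g (h : lin_dual V) (Y : subvs_of V) :
  coad cov g h Y = h (vsproj V (Ad cov g^-1%g (vsval Y))).
Proof. by rewrite /coad lfunE. Qed.

Lemma coad1 V (h : lin_dual V) : coad cov 1%g h = h.
Proof. by apply/lfunP => Y; rewrite coadE invg1 Ad1 vsvalK. Qed.

Lemma coadM V g1 g2 (h : lin_dual V) : Ad_stable V g1^-1%g ->
  coad cov (g1 * g2)%g h = coad cov g1 (coad cov g2 h).
Proof.
move=> st; apply/lfunP => Y; rewrite !coadE invgM AdM vsprojK//.
by apply: st; exact: subvsP.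
Qed.

Lemma coad_iotag g X : coad cov g (iotag X) = iotag (Ad cov g X).
Proof.
apply/lfunP => Y; rewrite coadE /iotag !lfunE /= /iotag_fun vsprojK; last first.
  by apply: Ad_g_stable; exact: subvsP.
congr (_ * _); rewrite /Ad invgK mxtrace_mulC -!mulmxA mxtrace_mulC.
by rewrite -!mulmxA mxtrace_mulC -!mulmxA.
Qed.

Lemma coad_pr g X : P_grp cov g -> coad cov g (pr X) = pr (Ad cov g X).
Proof.
move=> Pg; have st := Ad_p_stable (P_grpV Pg).
apply/lfunP => Y; rewrite coadE !prE vsprojK; last exact/st/subvsP.
congr (_ * _); rewrite /Ad invgK mxtrace_mulC -!mulmxA mxtrace_mulC.
by rewrite -!mulmxA mxtrace_mulC -!mulmxA.
Qed.

Lemma moment_coad g X : P_grp cov g ->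
  moment (coad cov g (iotag X)) = coad cov g (moment (iotag X)).
Proof. by move=> Pg; rewrite coad_iotag -/(pr X) coad_pr. Qed.

Definition P_stable V := forall g, P_grp cov g -> Ad_stable V g.

Lemma P_orbit_refl V (h : lin_dual V) : P_orbit cov h h.
Proof. by exists 1%g; [exact: P_grp1|exact: coad1]. Qed.

Lemma P_orbit_eq V (h h' : lin_dual V) : P_stable V ->
  P_orbit cov h h' -> P_orbit cov h' = P_orbit cov h.
Proof.
move=> st [g Pg <-]; apply/seteqP; split=> _ [g' Pg' <-].
  exists (g' * g)%g; first exact: P_grpM.
  by rewrite coadM//; exact/st/P_grpV.
exists (g' * g^-1)%g; first by apply: P_grpM => //; exact: P_grpV.
rewrite coadM; last exact/st/P_grpV.
congr (coad cov g' _); rewrite -coadM ?mulVg ?coad1//.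
by rewrite invgK; exact: st.
Qed.

Lemma P_stable_p : P_stable (p_alg R m).
Proof. exact: Ad_p_stable. Qed.

Lemma P_stable_g : P_stable (g_alg R m).
Proof. by move=> g _; exact: Ad_g_stable. Qed.

Lemma is_P_orbitE V (O1 : set (lin_dual V)) h : P_stable V ->
  is_P_orbit cov O1 -> O1 h -> O1 = P_orbit cov h.
Proof. by move=> st [h0 ->] O1h; rewrite (P_orbit_eq st O1h). Qed.

Lemma P_orbit_pr X h : P_orbit cov (pr X) h <->
  exists2 A, Pmx A & h = pr (A *m X *m invmx A).
Proof.
split=> [[g Pg <-]|[A PA ->]].
  by exists (cov g); [exact/P_grpP|rewrite coad_pr// AdE].
by have [g Pg <-] := Pmx_lift PA; exists g => //; rewrite coad_pr// AdE.
Qed.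

Lemma P_orbit_iotag X h : P_orbit cov (iotag X) h <->
  exists2 A, Pmx A & h = iotag (A *m X *m invmx A).
Proof.
split=> [[g Pg <-]|[A PA ->]].
  by exists (cov g); [exact/P_grpP|rewrite coad_iotag// AdE].
by have [g Pg <-] := Pmx_lift PA; exists g => //; rewrite coad_iotag// AdE.
Qed.

Lemma moment_P_orbit X :
  (@moment R m) @` (P_orbit cov (iotag X)) = P_orbit cov (pr X).
Proof.
apply/seteqP; split=> [_ [_ [g Pg <-] <-]|_ [g Pg <-]].
  by exists g => //; rewrite moment_coad.
exists (coad cov g (iotag X)); first by exists g.
by rewrite moment_coad.
Qed.

(** Depth zero concerns the whole orbit, but having [ep] as an eigenvector is invariant under P, so
    that one representative decides. *)
Lemma depth_zero_pr X : X \in g_alg R m ->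
  depth_zero cov (P_orbit cov (pr X)) <-> exists c, X *m ep R m = c *: ep R m.
Proof.
move=> gX; split=> [[_ H]|cX].
  by apply/pr_n0 => // N nN; apply: (H _ (P_orbit_refl _)).
split; first by exists (pr X).
move=> h /P_orbit_pr[A PA ->]; apply/pr_n0.
  by apply: g_conj => //; exact: Pmx_lorentz.
have pX : X \in p_alg R m by apply/p_algP.
by have := Pmx_p_alg (PmxV PA) pX; rewrite invmxK => /p_algP[].
Qed.

Lemma depth_one_pr X : X \in g_alg R m ->
  depth_one cov (P_orbit cov (pr X)) <->
  ~ exists c, X *m ep R m = c *: ep R m.
Proof.
move=> gX; rewrite -depth_zero_pr//; split=> [[]//|H]; split=> //.
by exists (pr X).
Qed.

End CoadjointOrbits.

(** * Resolvents of elements of g *)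

Lemma det_schur (F : fieldType) p q (A : 'M[F]_p) B C (D : 'M[F]_q) :
  A \in unitmx ->
  \det (block_mx A B C D) = \det A * \det (D - C *m invmx A *m B).
Proof.
move=> uA; have -> : block_mx A B C D =
    block_mx A 0 C 1%:M *m block_mx 1%:M (invmx A *m B) 0 (D - C *m invmx A *m B).
  rewrite mulmx_block !mulmx1 !mulmx0 !mul0mx !addr0 !mul1mx !mulmxA mulmxV//.
  by rewrite mul1mx addrC subrK.
by rewrite det_mulmx det_lblock det_ublock !det1 mulr1 mul1r.
Qed.

Lemma unitmx_ker (F : fieldType) p (A : 'M[F]_p) :
  (forall x : 'cV[F]_p, A *m x = 0 -> x = 0) -> A \in unitmx.
Proof.
move=> H; rewrite -unitmx_tr unitmxE unitfE; apply/negP => /det0P[v v0 vA].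
case/eqP: v0; rewrite -(trmxK v) (H v^T) ?trmx0//.
by apply: trmx_inj; rewrite trmx_mul trmxK vA trmx0.
Qed.

Lemma det_mx2 (F : comNzRingType) (M : 'M[F]_2) :
  \det M = M 0 0 * M 1 1 - M 0 1 * M 1 0.
Proof.
rewrite (expand_det_row _ 0) !big_ord_recl big_ord0 addr0 /cofactor !det_mx11.
rewrite !mxE /= expr0 mul1r expr1 mulN1r mulrN.
by congr (_ * M _ _ - M _ _ * M _ _); exact/val_inj.
Qed.

Lemma det_mx22 (R : realType) (a b c d : R) : \det (mx22 a b c d) = a * d - b * c.
Proof.
have i0 : (0 : 'I_2) = @lshift 1 1 0 by exact/val_inj.
have i1 : (1 : 'I_2) = @rshift 1 1 0 by exact/val_inj.
rewrite det_mx2 i0 i1 /mx22 (@block_mxEul _ 1 1 1 1) (@block_mxEur _ 1 1 1 1).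
rewrite (@block_mxEdl _ 1 1 1 1) (@block_mxEdr _ 1 1 1 1).
by rewrite !mxE !eqxx.
Qed.

Section SkewResolvent.
Context (R : realType) (m : nat).
Variables (Y : 'M[R]_m) (t : R).
Hypotheses (sY : Y \in so_m R m) (t0 : t != 0).
Implicit Types x y : 'cV[R]_m.

Lemma skew_edot x y : edot (Y *m x) y = - edot x (Y *m y).
Proof. by rewrite edot_adj so_m_tr// mulNmx edotNr. Qed.

Lemma skew_edot0 x : edot x (Y *m x) = 0.
Proof.
have := skew_edot x x; rewrite edotC => /eqP.
by rewrite -addr_eq0 -mulr2n mulrn_eq0 /= => /eqP.
Qed.

Definition resm : 'M[R]_m := t%:M - Y.

Lemma resmE x : resm *m x = t *: x - Y *m x.
Proof. by rewrite mulmxBl mul_scalar_mx. Qed.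

(** A real skew matrix has no nonzero real eigenvalue, because $\langle x,Yx\rangle=0$. *)
Lemma resm_unit : resm \in unitmx.
Proof.
apply: unitmx_ker => x; rewrite resmE => /(congr1 (edot x)).
rewrite edotBr edotZr skew_edot0 subr0 edot0r => /eqP.
by rewrite mulf_eq0 (negbTE t0) /= edot_eq0 => /eqP.
Qed.

Lemma resm_inv x y : resm *m x = y -> invmx resm *m y = x.
Proof. by move=> <-; rewrite mulmxA mulVmx ?resm_unit// mul1mx. Qed.

Lemma resmK x : resm *m (invmx resm *m x) = x.
Proof. by rewrite mulmxA mulmxV ?resm_unit// mul1mx. Qed.

Variable B : 'cV[R]_m.
Hypothesis YB : Y *m B = 0.

Lemma resm_kerr : invmx resm *m B = t^-1 *: B.
Proof.
by apply: resm_inv; rewrite resmE -scalemxAr YB scaler0 subr0 scalerA mulfV ?scale1r.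
Qed.

Lemma resm_kerl x : edot B (invmx resm *m x) = t^-1 * edot B x.
Proof.
rewrite -[in RHS](resmK x) resmE edotBr edotZr.
by rewrite -[edot B (Y *m _)]opprK -skew_edot YB edot0l oppr0 subr0 mulKf.
Qed.

End SkewResolvent.

Section NormalForm.
Context (R : realType) (m : nat).
Notation O := (@lorentz_group R m).
Notation ep := (ep R m).
Notation em := (em R m).
Implicit Types x y z : 'cV[R]_m.
Implicit Types A X : 'M[R]_(m + 2).

Section Determinant.
Variables (Y : 'M[R]_m) (b al : 'rV[R]_m) (t : R).
Hypotheses (sY : Y \in so_m R m) (Yb : Y *m b^T = 0) (t0 : t != 0).
Let Ai := invmx (resm Y t).
Let Z := gmx Y 0 b al.
Let c := edot al^T b^T.
Let b2 := edot b^T b^T.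
Let a2 := edot al^T (Ai *m al^T).

(** The second factor is the determinant of the 2 by 2 Schur complement of [t - Y]. Since [Y] kills
    [b], the resolvent acts on [b] as $1/t$ from either side, and the three scalars [c], [b2], [a2]
    suffice. *)
Lemma det_resolvent_gmx :
  \det (t%:M - Z) = \det (resm Y t) *
    (t ^+ 2 - 4 * c + 4 * c ^+ 2 / t ^+ 2 - 4 * a2 * b2 / t).
Proof.
have -> : t%:M - Z = block_mx (resm Y t)
    (- @row_mx _ _ 1 1 (b - al)^T (b + al)^T)
    (- @col_mx _ 1 1 _ (al - b) (al + b)) (mx22 t 0 0 t).
  rewrite /Z /gmx scale0r (scalar_mx_block m 2) opp_block_mx add_block_mx.
  rewrite !add0r oppr0 addr0; congr block_mx.
  by rewrite (@scalar_mx_block _ 1 1) /mx22 !raddf0.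
rewrite det_schur ?resm_unit//; congr (_ * _).
have rE (u v : 'rV[R]_m) : u *m Ai *m v^T = (edot u^T (Ai *m v^T))%:M.
  by rewrite -edot_mx trmxK mulmxA.
rewrite mulNmx mulmxN mulNmx opprK (@mul_col_mx _ 1 1) (@mul_col_row _ 1 1 m 1 1).
rewrite !rE /mx22 (@opp_block_mx _ 1 1 1 1) (@add_block_mx _ 1 1 1 1) -!raddfB.
rewrite /= -/(mx22 _ _ _ _) det_mx22 !linearB !linearD /= ?mulmxBr ?mulmxDr.
rewrite !(edotDl, edotDr, edotBl, edotBr, edotNl, edotNr).
rewrite (resm_kerr sY t0 Yb) !(resm_kerl sY t0 Yb) !(edotZr, edotZl) -/c -/b2 -/a2.
rewrite (edotC b^T al^T) -/c.
by field.
Qed.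

(* Cramer's rule for the [(ep, ep)] coefficient of the resolvent of [Z]. *)
Lemma det_resolvent_ep w : (t%:M - Z) *m w = ep ->
  \det (t%:M - Z) * (t * ldot w ep) = - 4 * b2 * \det (resm Y t).
Proof.
have [y [p [q ->]]] := nvecP w.
rewrite mulmxBl mul_scalar_mx gmx_nvec nvecZ nvecB !epE => /nvec_inj[E1 E2 E3].
have Ey : y = (2 * p / t) *: b^T - (2 * q) *: (Ai *m al^T).
  rewrite -[LHS](resm_inv sY t0 (erefl _)) resmE.
  have -> : t *: y - Y *m y = (2 * p) *: b^T - (2 * q) *: al^T.
    by apply/eqP; rewrite -subr_eq0 -E1 !opprD !opprK !addrA.
  by rewrite mulmxBr -!scalemxAr (resm_kerr sY t0 Yb) scalerA.
have Ea : edot al^T y = 2 * p * c / t - 2 * q * a2.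
  by rewrite Ey edotBr !edotZr -/c -/a2; field.
have Eb : edot b^T y = 2 * p * b2 / t - 2 * q * c / t.
  rewrite Ey edotBr !edotZr (resm_kerl sY t0 Yb) (edotC b^T al^T) -/b2 -/c.
  by field.
rewrite Ea in E2; rewrite Eb in E3.
rewrite det_resolvent_gmx ldot_nvec edot0r.
rewrite [LHS](_ : _ = \det (resm Y t) * (2 * (q * t *
  (t ^+ 2 - 4 * c + 4 * c ^+ 2 / t ^+ 2 - 4 * a2 * b2 / t)))); last by ring.
(* Elimination of [p]: [E3] gives the product [2 * p * b2] in terms of [q], and [E2] is multiplied
   by [2 * b2] so that only this product occurs and nothing is divided by [b2]. *)
have -> : q * t * (t ^+ 2 - 4 * c + 4 * c ^+ 2 / t ^+ 2 - 4 * a2 * b2 / t) =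
    - 2 * b2; last by ring.
have F3 : 2 * p * b2 = 2 * q * c - q * t ^+ 2.
  have : t * (t * q - (- (2 * p * b2 / t - 2 * q * c / t) - 0 * q)) = 0.
    by rewrite E3 mulr0.
  have -> : t * (t * q - (- (2 * p * b2 / t - 2 * q * c / t) - 0 * q)) =
    t ^+ 2 * q + 2 * p * b2 - 2 * q * c by field.
  lra.
have : 2 * b2 * (t * p - (2 * p * c / t - 2 * q * a2 + 0 * p)) = 2 * b2.
  by rewrite E2 mulr1.
have -> : 2 * b2 * (t * p - (2 * p * c / t - 2 * q * a2 + 0 * p)) =
  (t - 2 * c / t) * (2 * p * b2) + 4 * q * a2 * b2 by field.
rewrite F3 => H; have -> : - 2 * b2 = - (2 * b2) by ring.
by rewrite -H; field.
Qed.

(** $(t-Y)^{-1}=(t+Y)(t^2-Y^2)^{-1}$, and the term with the single [Y] drops out of the quadratic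
    form by skewness. The vector [y] stands for $(t^2-Y^2)^{-1}\alpha^t$, which can be written down
    in eigenvectors of $Y^2$. *)
Lemma det_resolvent_sq y : (t ^+ 2)%:M *m y - Y *m (Y *m y) = al^T ->
  \det (t%:M - Z) = \det (resm Y t) *
    (t ^+ 2 - 4 * c + 4 * c ^+ 2 / t ^+ 2 - 4 * edot al^T y * b2).
Proof.
move=> Ey; rewrite det_resolvent_gmx; congr (_ * (_ - _)).
have -> : a2 = t * edot al^T y; last by field.
rewrite /a2; have -> : Ai *m al^T = t *: y + Y *m y.
  apply: (resm_inv sY t0); rewrite resmE -Ey mul_scalar_mx scalerDr scalerA.
  by rewrite mulmxDr -scalemxAr opprD addrA addrK expr2.
rewrite edotDr edotZr; suff -> : edot al^T (Y *m y) = 0 by rewrite addr0.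
rewrite -Ey mul_scalar_mx edotBl edotZl skew_edot0// mulr0.
by rewrite edotC skew_edot0// subrr.
Qed.

End Determinant.

(** The Lorentzian counterpart: $(t-X)^{-1}=(t+X)(t^2-X^2)^{-1}$, and the diagonal coefficient only
    sees the even part. *)
Lemma g_resolvent_sq X (t : R) w u : X \in g_alg R m ->
  (t ^+ 2) *: w - X *m (X *m w) = u ->
  (t%:M - X) *m (t *: w + X *m w) = u /\
  ldot (t *: w + X *m w) u = t * ldot w u.
Proof.
move=> gX E; split.
  rewrite mulmxBl mul_scalar_mx -E scalerDr scalerA mulmxDr -scalemxAr.
  by rewrite opprD addrA addrK expr2.
rewrite ldotDl ldotZl; suff -> : ldot (X *m w) u = 0 by rewrite addr0.
rewrite -E ldotBr ldotZr g_ldot_self// mulr0 sub0r.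
by rewrite ldotC g_ldot_self// oppr0.
Qed.

Lemma expmx_X_ep al : expmx (X_ al) *m ep = ep.
Proof.
by rewrite epE expmx_X_nvec mulr0 scale0r edot0r mul0r !subr0 addr0.
Qed.

Lemma null_normalize u : ldot u u = 0 -> ldot u ep = 2 ->
  exists A, [/\ Pmx A, A *m ep = ep & A *m u = em].
Proof.
have [x [p [q ->]]] := nvecP u; rewrite epE !ldot_nvec edot0r => E1 E2.
have q1 : q = 1 by lra.
exists (expmx (X_ (2^-1 *: x^T))); split; first exact: Pmx_X.
  by rewrite -epE expmx_X_ep.
have aT : (2^-1 *: x^T)^T = 2^-1 *: x by rewrite linearZ /= trmxK.
rewrite expmx_X_nvec aT emE scalerA q1.
rewrite !(edotZl, edotZr); congr nvec.
  by rewrite mulr1 mulfV// scale1r subrr.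
by move: E1; rewrite q1; lra.
Qed.

(** The second null line is chosen in the span of [ep] and [X *m (X *m ep)]. After moving it to
    [em], the image of [ep] under the square lies in the plane of [ep] and [em], which says
    [Y *m b^T = 0]; and [X *m ep] is orthogonal to [u], which says [c = 0]. *)
Lemma normal_form X : X \in g_alg R m -> ~ (exists c, X *m ep = c *: ep) ->
  exists A Y b al, [/\ Pmx A, Y \in so_m R m, b != 0, Y *m b^T = 0 &
    A *m X *m invmx A = gmx Y 0 b al].
Proof.
move=> gX NX; have [Y0 [c0 [b0 [al0 [sY0 XE]]]]] := g_algE gX.
have Qe : ldot (X *m ep) (X *m ep) = 4 * edot b0^T b0^T.
  by rewrite XE gmx_ep ldot_nvec edotZl edotZr; ring.
have b0n : edot b0^T b0^T != 0.
  rewrite edot_eq0; apply/eqP => b00; apply: NX; exists c0.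
  by rewrite XE gmx_ep b00 scaler0 epE nvecZ scaler0 mulr0 mulr1.
(* As [ep] and [X *m (X *m ep)] pair to $-4|b_0|^2$, the condition [ldot u ep = 2] determines [la];
   then [ldot u u = 0] determines [mu]. *)
pose la := - (2 * edot b0^T b0^T)^-1.
have E2 : ldot ep (X *m (X *m ep)) = - (4 * edot b0^T b0^T).
  by rewrite -Qe ldotC g_ldot// opprK ldotC g_ldot ?opprK// g_ldot// opprK.
pose mu := - la ^+ 2 * ldot (X *m (X *m ep)) (X *m (X *m ep)) / 4.
pose u := la *: (X *m (X *m ep)) + mu *: ep.
have lan : la != 0 by rewrite oppr_eq0 invr_eq0 mulf_neq0.
have ue : ldot u ep = 2.
  by rewrite /u !ldotE ldot_pp ldotC E2 mulr0 addr0 /la; field.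
have uu : ldot u u = 0.
  rewrite /u !ldotE ldot_pp (ldotC _ ep) E2 /mu /la; by field.
have Xu : ldot (X *m ep) u = 0.
  by rewrite /u !ldotE g_ldot_self// mulr0 addr0 ldotC g_ldot_self// mulr0.
have [A [PA Ae Au]] := null_normalize uu ue.
have OA := Pmx_lorentz PA.
have gA : A *m X *m invmx A \in g_alg R m by exact: g_conj.
have [Y [c [b [al [sY E]]]]] := g_algE gA.
have AV v : A *m X *m invmx A *m (A *m v) = A *m (X *m v).
  by rewrite -[in LHS]mulmxA (mulmxA (invmx A)) lorentz_Vmul// mul1mx mulmxA.
have Ze : gmx Y c b al *m ep = A *m (X *m ep) by rewrite -E -{1}Ae AV.
have Zee : gmx Y c b al *m (gmx Y c b al *m ep) = A *m (X *m (X *m ep)).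
  by rewrite Ze -E AV.
have c00 : c = 0.
  have : ldot (A *m (X *m ep)) (A *m u) = 0 by rewrite lorentz_ldot.
  rewrite Au -Ze gmx_ep emE ldot_nvec edot0r; lra.
have bn : b != 0.
  apply/eqP => b00; apply: NX; exists c.
  have : A *m (X *m ep) = A *m (c *: ep).
    rewrite -Ze gmx_ep b00 trmx0 scaler0 -scalemxAr Ae epE nvecZ scaler0.
    by rewrite mulr0 mulr1.
  move=> /(congr1 (mulmx (invmx A))).
  by rewrite !mulmxA lorentz_Vmul// mul1mx mul1mx.
exists A, Y, b, al; split=> //; last by rewrite E c00.
have Hu : A *m (X *m (X *m ep)) = la^-1 *: (em - mu *: ep).
  by rewrite -Au -{2}Ae /u mulmxDr -!scalemxAr addrK scalerA mulVf// scale1r.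
move: Zee; rewrite Hu gmx_ep gmx_nvec epE emE !nvecZ nvecB nvecZ => /nvec_inj[+ _ _].
rewrite c00 !mulr0 !scale0r addr0 subr0 -scalemxAr !scaler0 subr0 scaler0.
by move=> /eqP; rewrite scaler_eq0 pnatr_eq0 /= => /eqP.
Qed.

End NormalForm.

(** * Interlacing and partial fractions *)

Section Interlacing.
Variable R : rcfType.
Implicit Types (N xi : seq R) (g h : {poly R}) (L D : seq (R * R)).

(* [N_0 <= xi_0 <= N_1 <= ...]: increasing order, as the squares enter with a
   minus sign in [- a_i ^+ 2] and [- x_i ^+ 2]. *)
Fixpoint interl N xi : bool :=
  match N, xi with
  | y0 :: N', x :: xi' =>
      if N' is y1 :: _ then [&& y0 <= x, x <= y1 & interl N' xi'] else false
  | [:: _], [::] => true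
  | _, _ => false
  end.

Lemma interl_size N xi : interl N xi -> size N = (size xi).+1.
Proof.
elim: N xi => [|y0 N IH] [|x xi] //=; first by case: N {IH}.
by case: N IH => [|y1 N] IH //= /and3P[_ _ /IH] /= ->.
Qed.

Lemma interl_nth N xi i : interl N xi -> (i < size xi)%N ->
  N`_i <= xi`_i <= N`_i.+1.
Proof.
elim: N xi i => [|y0 N IH] [|x xi] //= i.
case: N IH => [|y1 N] IH //= /and3P[yx xy I]; case: i => [_|i].
  by rewrite /= yx xy.
by rewrite ltnS => /(IH _ _ I).
Qed.

Lemma interl_ge y N xi : sorted <%R (y :: N) -> interl (y :: N) xi ->
  {in xi, forall x, y <= x}.
Proof.
elim: N y xi => [|y1 N IH] y [|x xi] //= /andP[yy1 sN] /and3P[yx xy I] z.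
rewrite inE => /orP[/eqP->//|zxi]; apply: le_trans (ltW yy1) _.
exact: IH zxi.
Qed.

(* The values of [g] on [N] have weakly alternating signs, starting with that of
   [s]. *)
Fixpoint alt (s : R) g N : Prop :=
  if N is y :: N' then 0 <= s * g.[y] /\ alt (- s) g N' else True.

Lemma alt_div s h x N : {in N, forall y, x < y} ->
  alt s (h * ('X - x%:P)) N <-> alt s h N.
Proof.
elim: N s => [|y N IH] s //= xN.
rewrite IH; last by move=> z zN; apply: xN; rewrite inE zN orbT.
have xy : 0 < y - x by rewrite subr_gt0 xN// mem_head.
by rewrite hornerM hornerXsubC mulrA pmulr_lge0.
Qed.

Lemma alt_ext s g h N : {in N, forall y, g.[y] = h.[y]} -> alt s g N -> alt s h N.
Proof.
elim: N s => [|y N IH] s //= gh [gy aN]; split; first by rewrite -gh ?mem_head.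
by apply: IH aN => z zN; apply: gh; rewrite inE zN orbT.
Qed.

Lemma weak_ivt g s a b : s != 0 -> a <= b -> 0 <= s * g.[a] -> 0 <= - s * g.[b] ->
  exists2 x, a <= x <= b & root g x.
Proof.
move=> s0 ab ga gb.
have [|x xab rx] := @poly_ivt R (- s *: g) a b ab.
  by rewrite !hornerZ gb andbT mulNr oppr_le0.
by exists x => //; move: rx; rewrite rootZ// oppr_eq0.
Qed.

(** A root in the first interval is divided out, and the quotient still alternates on a list of
    nodes with one element less. Which node is dropped depends on whether the root is the right
    endpoint. *)
Lemma alt_roots n N s g : size N = n.+1 -> sorted <%R N -> s != 0 ->
  alt s g N -> size g = size N ->
  exists2 xi, interl N xi & g = lead_coef g *: \prod_(x <- xi) ('X - x%:P).
Proof.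
elim: n N s g => [|n IH] [|y0 [|y1 N]] //= s g.
  move=> _ _ _ _ sg; exists [::] => //.
  have /size_poly1P[c c0 ->] : size g == 1%N by rewrite sg.
  by rewrite big_nil lead_coefC -mul_polyC mulr1.
move=> [sN] /andP[y01 sN1] s0 [g0 [g1 aN]] sg.
have [x /andP[yx xy] rx] := weak_ivt s0 (ltW y01) g0 g1.
have /factor_theorem[h gE] := rx.
have h0 : h != 0.
  by apply: contra_eq_neq sg => h0; rewrite gE h0 mul0r size_poly0.
have sh : size h = (size N).+1.
  by move: sg; rewrite gE size_Mmonic ?monicXsubC// size_XsubC addn2 => -[].
have lh : lead_coef g = lead_coef h by rewrite gE lead_coef_Mmonic ?monicXsubC.
have N1 : {in N, forall y, y1 < y}.
  by apply/allP; rewrite path_sortedE in sN1; [case/andP: sN1|exact: lt_trans].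
have [xlt|xge] := ltP x y1.
  have ah : alt (- s) h (y1 :: N).
    rewrite -(@alt_div _ _ x) -?gE// => y; rewrite inE => /orP[/eqP->//|/N1].
    exact: lt_trans.
  have sn : - s != 0 by rewrite oppr_eq0.
  have sN' : size (y1 :: N) = n.+1 by rewrite /= sN.
  have [xi I E] := IH (y1 :: N) (- s) h sN' sN1 sn ah sh.
  exists (x :: xi); first by rewrite /= yx xy.
  by rewrite big_cons {1}gE {1}E lh -scalerAl (mulrC _ ('X - x%:P)).
(* The sign of the quotient at [y1] is now unknown, so [y1] is dropped instead of [y0]; the sign at
   [y0] flips because [y0 - y1 < 0]. *)
have {xge}xE : x = y1 by apply/eqP; rewrite eq_le xy xge.
subst x.
have ah : alt (- s) h (y0 :: N).
  split.
    move: g0; rewrite gE hornerM hornerXsubC mulrA => g0.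
    by rewrite mulNr oppr_ge0 -(nmulr_lge0 _ (_ : y0 - y1 < 0)) ?subr_lt0.
  by rewrite -(@alt_div _ _ y1) -?gE// opprK -(opprK s).
have sN0 : sorted <%R (y0 :: N).
  rewrite /= path_sortedE ?(path_sorted sN1) ?andbT; last exact: lt_trans.
  by apply/allP => y /N1; exact: lt_trans.
have sn : - s != 0 by rewrite oppr_eq0.
have sN' : size (y0 :: N) = n.+1 by rewrite /= sN.
have [xi I E] := IH (y0 :: N) (- s) h sN' sN0 sn ah sh.
(* The remaining roots interlace [y0], [y2], ...; the root [y1] has to be inserted before or after
   the first of them. *)
case: N xi {IH sN sN' sN1 aN sg sh ah sN0 g1} N1 I E => [|y2 N] [|z xi] //=.
  move=> _ _ E; exists [:: y1]; first by rewrite /= yx lexx.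
  by rewrite big_seq1 {1}gE {1}E lh big_nil -scalerAl mul1r.
move=> N1 /and3P[y0z zy2 I] E.
have y12 : y1 <= y2.
  by rewrite ltW// N1// mem_head.
have [zy|yz] := leP z y1.
  exists (z :: y1 :: xi); first by rewrite /= y0z zy lexx y12.
  rewrite 2!big_cons {1}gE {1}E lh big_cons -scalerAl; congr (_ *: _).
  by rewrite mulrAC -mulrA.
exists (y1 :: z :: xi); first by rewrite /= yx lexx (ltW yz) zy2.
rewrite 2!big_cons {1}gE {1}E lh big_cons -scalerAl; congr (_ *: _).
by rewrite [RHS]mulrC.
Qed.

(* The numerator of [\sum_(p <- L) p.2 / ('X - p.1)] over the common denominator. *)
Fixpoint nodepoly L : {poly R} :=
  if L is p :: L' then
    p.2 *: \prod_(q <- L') ('X - (q.1)%:P) + ('X - (p.1)%:P) * nodepoly L'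
  else 0.

Definition weight L := \sum_(p <- L) p.2.

Lemma nodepoly_horner L s : {in L, forall p, s != p.1} ->
  (nodepoly L).[s] = \prod_(p <- L) (s - p.1) * \sum_(p <- L) p.2 / (s - p.1).
Proof.
elim: L => [|p L IH] sL; first by rewrite !big_nil horner0 mulr0.
have sp : s - p.1 != 0 by rewrite subr_eq0 sL// mem_head.
rewrite /= !big_cons hornerD hornerZ hornerM hornerXsubC horner_prod.
rewrite IH; last by move=> q qL; apply: sL; rewrite inE qL orbT.
under eq_bigr do rewrite hornerXsubC.
by field.
Qed.

Lemma nodepoly_size L : (size (nodepoly L) <= size L)%N.
Proof.
elim: L => [|p L IH] /=; first by rewrite size_poly0.
apply: leq_trans (size_polyD _ _) _; rewrite geq_max; apply/andP; split.
  by apply: leq_trans (size_scale_leq _ _) _; rewrite size_prod_XsubC.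
have [->|n0] := eqVneq (nodepoly L) 0; first by rewrite mulr0 size_poly0.
by rewrite mulrC size_Mmonic ?monicXsubC// size_XsubC addn2.
Qed.

Lemma nodepoly_coef L : (nodepoly L)`_(size L).-1 = weight L.
Proof.
elim: L => [|p L IH] /=; first by rewrite coef0 /weight big_nil.
rewrite coefD coefZ /weight big_cons; congr (_ + _).
  have := monicP (monic_prod_XsubC L predT (fun q : R * R => q.1)).
  by rewrite lead_coefE size_prod_XsubC /= => ->; rewrite mulr1.
rewrite mulrBl coefB coefXM coefCM [(nodepoly L)`_(size L)]nth_default ?nodepoly_size//.
rewrite mulr0 subr0 -/(weight L) -IH; case: L {IH} => [|q L] //=.
by rewrite coef0.
Qed.

Lemma nodepoly_lead L : 0 < weight L ->
  size (nodepoly L) = size L /\ lead_coef (nodepoly L) = weight L.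
Proof.
move=> w0; have L0 : (0 < size L)%N by case: L w0 => //; rewrite /weight big_nil ltxx.
have sz : size (nodepoly L) = size L.
  apply/eqP; rewrite eqn_leq nodepoly_size/= leqNgt; apply/negP => lt.
  have := nodepoly_coef L; rewrite nth_default; last by rewrite -ltnS prednK.
  by move=> E; rewrite -E ltxx in w0.
by split=> //; rewrite lead_coefE sz nodepoly_coef.
Qed.

Lemma prod_neg_sign L s : {in L, forall p, s < p.1} ->
  0 <= (-1) ^+ size L * \prod_(p <- L) (s - p.1).
Proof.
elim: L => [|p L IH] sL; first by rewrite big_nil mulr1.
rewrite big_cons /= exprS mulrACA mulr_ge0//.
  by rewrite mulN1r opprB subr_ge0 ltW// sL// mem_head.
by apply: IH => q qL; apply: sL; rewrite inE qL orbT.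
Qed.

(** At its own node each weight is multiplied by as many negative factors as there are larger nodes.
    At the later nodes the first term vanishes and a factor ['X - p.1], positive there, is left. *)
Lemma nodepoly_alt L : sorted <%R [seq p.1 | p <- L] -> {in L, forall p, 0 <= p.2} ->
  alt ((-1) ^+ (size L).-1) (nodepoly L) [seq p.1 | p <- L].
Proof.
elim: L => [|p L IH] //= sL wL.
have pL : {in L, forall q, p.1 < q.1}.
  move=> q qL; move: sL; rewrite path_sortedE; last exact: lt_trans.
  by move=> /andP[/allP + _]; apply; exact: map_f.
split.
  rewrite hornerD hornerZ hornerM hornerXsubC subrr mul0r addr0 horner_prod.
  under eq_bigr do rewrite hornerXsubC.
  by rewrite mulrCA mulr_ge0 ?wL ?mem_head// prod_neg_sign.
have {}IH : alt ((-1) ^+ (size L).-1) (nodepoly L) [seq q.1 | q <- L].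
  by apply: IH; [exact: path_sorted sL|move=> q qL; apply: wL; rewrite inE qL orbT].
case: L pL IH {sL wL} => [|q L] // pL IH.
have sE : - (-1) ^+ size (q :: L) = (-1) ^+ (size (q :: L)).-1 :> R.
  by rewrite /= exprS mulN1r opprK.
set L' := q :: L in pL IH sE *; rewrite sE.
have : alt ((-1) ^+ (size L').-1) (nodepoly L' * ('X - (p.1)%:P)) [seq q.1 | q <- L'].
  by apply/alt_div => // _ /mapP[r rL ->]; exact: pL.
apply: alt_ext => _ /mapP[r rL ->].
rewrite hornerD hornerZ horner_prod (big_rem r)//= hornerXsubC subrr mul0r mulr0.
by rewrite add0r mulrC.
Qed.

Lemma nodepoly_roots L : sorted <%R [seq p.1 | p <- L] ->
  {in L, forall p, 0 <= p.2} -> 0 < weight L ->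
  exists2 xi, interl [seq p.1 | p <- L] xi &
    nodepoly L = weight L *: \prod_(x <- xi) ('X - x%:P).
Proof.
move=> sL wL w0; have [sz lc] := nodepoly_lead w0.
have L0 : (0 < size L)%N by case: L w0 {sL wL sz lc} => //; rewrite /weight big_nil ltxx.
have := @alt_roots (size L).-1 [seq p.1 | p <- L] ((-1) ^+ (size L).-1) (nodepoly L).
rewrite size_map prednK// signr_eq0 lc; apply=> //; exact: nodepoly_alt.
Qed.

(** There is one node more than roots, so this is a product of an odd number of nonpositive
    factors. *)
Lemma interl_sign y N xi z : interl (y :: N) xi -> z <= y ->
  {in N, forall t, z <= t} -> {in xi, forall x, z <= x} ->
  (\prod_(t <- y :: N) (z - t)) * (\prod_(x <- xi) (z - x)) <= 0.
Proof.
elim: N y xi => [|y1 N IH] y [|x xi] //.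
  by move=> _ zy _ _; rewrite big_seq1 big_nil mulr1 subr_le0.
move=> /= /and3P[yx xy1 I] zy zN zxi.
rewrite big_cons [X in _ * X]big_cons mulrACA mulr_ge0_le0//.
  by rewrite mulr_le0// subr_le0// zxi// mem_head.
apply: IH => //; first by rewrite zN// mem_head.
  by move=> t tN; rewrite zN// inE tN orbT.
by move=> t tN; rewrite zxi// inE tN orbT.
Qed.

(** Induction on the number of nodes: the expansion $f$ of the tail is multiplied by
    $(s-y_0)/(s-x)$, with $y_0$ the smallest node and $x$ the smallest root. [D] lists distinct
    poles only, whatever the multiplicities in [xi]. *)
Lemma partial_fractions N xi : sorted <%R N -> interl N xi ->
  exists c D, [/\ uniq [seq p.1 | p <- D], {subset [seq p.1 | p <- D] <= xi},
    {in D, forall p, 0 <= p.2} &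
    forall s, s \notin xi ->
      \prod_(y <- N) (s - y) = \prod_(x <- xi) (s - x) *
        (s - c - \sum_(p <- D) p.2 / (s - p.1))].
Proof.
move: {2}(size N) (leqnn (size N)) => n; elim: n N xi => [|n IH].
  by case=> // -[].
move=> [|y0 [|y1 N]] [|x xi] // sz sN.
  move=> _; exists y0, [::]; split=> // s _.
  by rewrite big_seq1 !big_nil mul1r subr0.
move=> /= /and3P[yx xy I].
have /= /andP[y01 sN1] := sN.
have xi_ge : {in xi, forall z, y1 <= z} by exact: interl_ge I.
(* If [x] recurs in [xi], it equals both [y1] and the next root. The factor [s - y1] then cancels
   [s - x], and the induction hypothesis is applied without that node. *)
have [xin|xnin] := boolP (x \in xi).
  have xE : x = y1 by apply/eqP; rewrite eq_le xy xi_ge.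
  case: N xi I sz sN sN1 xi_ge xin => [|y2 N] [|x0 xi] // I sz sN sN1 xi_ge xin.
  move: I => /= /and3P[yx0 xy2 I].
  have y12 : y1 < y2 by case/andP: sN1.
  have y2xi : {in xi, forall z, y2 <= z}.
    by apply: interl_ge I; case/andP: sN1.
  have xx0 : x0 = x.
    move: xin; rewrite inE => /orP[/eqP->//|/y2xi]; rewrite xE => /(lt_le_trans y12).
    by rewrite ltxx.
  have [|||c [D [uD sD wD E]]] := IH (y0 :: y2 :: N) (x0 :: xi).
  - exact: sz.
  - by rewrite /= (lt_trans y01 y12); case/andP: sN1.
  - by rewrite /= I xy2 xx0 yx.
  exists c, D; split=> //.
    by move=> z /sD zxi; rewrite in_cons zxi orbT.
  move=> s sxi; have sxi' : s \notin x0 :: xi.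
    by move: sxi; rewrite in_cons negb_or => /andP[].
  have := E s sxi'; rewrite !big_cons => E'.
  by rewrite mulrCA E' xE !mulrA.
have [||c [D [uD sD wD E]]] := IH (y1 :: N) xi _ _ I; [exact: sz|exact: sN1|].
have xxi : {in xi, forall z, x < z}.
  move=> z zxi; rewrite lt_neqAle (le_trans xy (xi_ge _ zxi)) andbT.
  by apply: contra xnin => /eqP ->.
have xD : {in D, forall p, x < p.1} by move=> p pD; apply/xxi/sD/map_f.
pose f s := s - c - \sum_(p <- D) p.2 / (s - p.1).
pose de := x - y0.
have de0 : 0 <= de by rewrite subr_ge0.
(* [f x] has the sign of the product in [interl_sign] taken at [x], since the two differ by a
   square. *)
have fx : f x <= 0.
  have Q0 : \prod_(z <- xi) (x - z) != 0.
    by rewrite prodf_seq_neq0; apply/allP => z zxi /=; rewrite subr_eq0 lt_eqF// xxi.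
  have := interl_sign I xy _ _ (z := x); rewrite (E _ xnin) -/(f x).
  rewrite mulrAC -expr2 pmulr_rle0; last by rewrite lt0r sqrf_eq0 Q0 sqr_ge0.
  apply; last by move=> z /xxi /ltW.
  move=> t tN; apply: le_trans xy _; move: sN1; rewrite path_sortedE; last exact: lt_trans.
  by move=> /andP[/allP/(_ _ tN) /ltW].
(* Since $(s-y_0)/(s-x)=1+\delta/(s-x)$ with $\delta=x-y_0$, the residue at $x$ is $\delta f(x)$, an
   old residue at $p$ is multiplied by $(p-y_0)/(p-x)$, and the constant moves by $\delta$. *)
exists (c - de), ((x, - de * f x) :: [seq (p.1, p.2 * ((p.1 - y0) / (p.1 - x))) | p <- D]).
split.
- rewrite /= -map_comp (eq_map (_ : _ =1 fst))// uD andbT.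
  by apply: contra xnin => /sD.
- move=> z; rewrite /= inE -map_comp (eq_map (_ : _ =1 fst))// in_cons.
  by move=> /orP[->//|/sD ->]; rewrite orbT.
- move=> p; rewrite inE => /orP[/eqP->/=|/mapP[q qD ->]/=].
    by rewrite mulNr oppr_ge0 mulr_ge0_le0.
  by rewrite mulr_ge0 ?wD// divr_ge0// subr_ge0 ltW ?xD// (le_lt_trans yx) ?xD.
move=> s; rewrite inE negb_or => /andP[sx sxi].
rewrite big_cons (E _ sxi) -/(f s) [in RHS]big_cons [X in s - _ - X]big_cons big_map /=.
rewrite mulrCA -mulrA [in RHS]mulrCA; congr (_ * _).
have sx0 : s - x != 0 by rewrite subr_eq0.
pose T := \sum_(p <- D) p.2 / ((s - p.1) * (x - p.1)).
have sD0 p : p \in D -> s - p.1 != 0.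
  by move=> pD; rewrite subr_eq0; apply: contraNneq sxi => ->; exact/sD/map_f.
have xD0 p : p \in D -> x - p.1 != 0 by move=> pD; rewrite subr_eq0 lt_eqF ?xD.
(* [T] is, up to sign, the divided difference of the polar part between [s] and [x]. *)
have fE : f s = f x + (s - x) + (s - x) * T.
  rewrite /f /T mulr_sumr; apply/eqP; rewrite -subr_eq0; apply/eqP.
  rewrite [LHS](_ : _ = \sum_(p <- D) p.2 / (x - p.1) -
    (\sum_(p <- D) p.2 / (s - p.1) +
     \sum_(p <- D) (s - x) * (p.2 / ((s - p.1) * (x - p.1))))); last by ring.
  rewrite -big_split /= -sumrB big_seq big1// => p pD.
  by field; rewrite sD0// xD0.
have SE : \sum_(p <- D) p.2 * ((p.1 - y0) / (p.1 - x)) / (s - p.1) =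
    \sum_(p <- D) p.2 / (s - p.1) - de * T.
  rewrite /T mulr_sumr -sumrB big_seq [RHS]big_seq; apply: eq_bigr => p pD.
  have px0 : p.1 - x != 0 by rewrite -oppr_eq0 opprB xD0.
  by rewrite /de; field; rewrite sD0// xD0// px0.
rewrite SE mulNr.
rewrite [RHS](_ : _ = (s - x) * (f s + de + de * T) + de * f x); last first.
  by rewrite /f; field.
by rewrite fE /de; ring.
Qed.

End Interlacing.

(** * Orthogonal determinants and comparison of characteristic polynomials *)

Section OrthogonalDeterminant.
Context (R : realFieldType) (m : nat).
Implicit Types (x y z : 'cV[R]_m).

Lemma orth_edot (k : 'M[R]_m) x y : k *m k^T = 1%:M ->
  edot (k *m x) (k *m y) = edot x y.
Proof. by move=> /mulmx1C kk; rewrite edot_adj mulmxA kk mul1mx. Qed.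

Lemma det_orth_no_eigen (k : 'M[R]_m) : k *m k^T = 1%:M ->
  (forall x, k *m x = - x -> x = 0) -> \det k = 1.
Proof.
move=> kk H.
have : 1%:M + k \in unitmx.
  apply: unitmx_ker => x; rewrite mulmxDl mul1mx => /eqP.
  by rewrite addrC addr_eq0 => /eqP /H.
rewrite unitmxE unitfE => d0.
(* k (1 + k)^t = 1 + k *)
have : \det (1%:M + k) = \det k * \det (1%:M + k).
  rewrite -[\det (1%:M + k) in RHS]det_tr -det_mulmx linearD /= trmx1.
  by rewrite mulmxDr mulmx1 kk addrC.
by rewrite -{1}[\det (1%:M + k)]mul1r => /(mulIf d0).
Qed.

Lemma skew_unit_even d (S : 'M[R]_d) : S^T = - S -> S \in unitmx -> ~~ odd d.
Proof.
rewrite unitmxE unitfE => ST S0; apply/negP => od; have := det_tr S.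
rewrite ST -scaleN1r detZ -signr_odd od expr1 mulN1r => /eqP.
by rewrite eq_sym -addr_eq0 -mulr2n mulrn_eq0 (negbTE S0).
Qed.

(** The eigenspace of [k] for -1 is stable under [Y] and orthogonal to [b], so [Y] is injective on
    it and, being skew, forces even dimension. Composing [k] with the reflection [1 - 2 Pi] in that
    eigenspace, of determinant 1, removes the eigenvalue -1. *)
Lemma det_orth_commute (Y k : 'M[R]_m) b : Y^T = - Y -> k *m k^T = 1%:M ->
  k *m Y = Y *m k -> k *m b = b ->
  (forall x, Y *m x = 0 -> edot b x = 0 -> x = 0) -> \det k = 1.
Proof.
move=> YT kk kY kb Yb.
have [d [W [rW WE]]] : exists d (W : 'M[R]_(d, m)),
    row_free W /\ (W :=: kermx (k + 1%:M))%MS.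
  exists (\rank (kermx (k + 1%:M))), (row_base _); split.
    exact: row_base_free.
  exact: eq_row_base.
have Wk : W *m k = - W.
  apply/eqP; rewrite -addr_eq0 -{2}[W]mulmx1 -mulmxDr; apply/eqP/sub_kermxP.
  by rewrite WE.
have inV x : k *m x = - x -> exists y : 'cV[R]_d, x = W^T *m y.
  move=> kx; have : (x^T <= W)%MS.
    rewrite WE; apply/sub_kermxP; rewrite mulmxDr mulmx1.
    have -> : x^T *m k = (k^T *m x)^T by rewrite trmx_mul trmxK.
    have -> : k^T *m x = - x.
      by rewrite -[in LHS](opprK x) -kx mulmxN mulmxA (mulmx1C kk) mul1mx.
    by rewrite linearN /= addNr.
  by move=> /submxP[D E]; exists D^T; rewrite -trmx_mul -E trmxK.
have Winj (y : 'cV[R]_d) : W^T *m y = 0 -> y = 0.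
  move=> Wy; have /row_freeP[E WE'] := rW.
  apply: trmx_inj; rewrite trmx0 -[y^T]mulmx1 -WE' mulmxA.
  by rewrite -(trmxK W) -trmx_mul Wy trmx0 mul0mx.
have GI (y : 'cV[R]_d) : W *m (W^T *m y) = 0 -> y = 0.
  move=> Gy; apply: Winj; apply/eqP; rewrite -edot_eq0 /edot trmx_mul trmxK.
  by rewrite -mulmxA Gy mulmx0 mxE.
have uG : W *m W^T \in unitmx.
  by apply: unitmx_ker => y; rewrite -mulmxA; exact: GI.
have kW (y : 'cV[R]_d) : k *m (W^T *m y) = - (W^T *m y).
  have E : k^T *m (W^T *m y) = - (W^T *m y).
    by rewrite mulmxA -trmx_mul Wk linearN mulNmx.
  by rewrite -[LHS]opprK -mulmxN -[in LHS]E (mulmxA k) kk mul1mx.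
have dE : ~~ odd d.
  (* The rows of [W] are a basis of the eigenspace, so this is the matrix of the skew form of [Y]
     restricted to it. *)
  apply: (@skew_unit_even d (W *m Y *m W^T)).
    by rewrite !trmx_mul trmxK YT mulNmx mulmxN mulmxA.
  apply: unitmx_ker => y Sy; apply: Winj.
  have [y' E] : exists y' : 'cV[R]_d, Y *m (W^T *m y) = W^T *m y'.
    by apply: inV; rewrite mulmxA kY -mulmxA kW mulmxN.
  apply: Yb.
    rewrite E (GI y') ?mulmx0// -E !mulmxA //.
  have := orth_edot b (W^T *m y) kk; rewrite kb kW edotNr => /eqP.
  by rewrite eq_sym -addr_eq0 -mulr2n mulrn_eq0 /= => /eqP.
pose Pi := W^T *m (invmx (W *m W^T) *m W).
have PT : Pi^T = Pi.
  rewrite /Pi !trmx_mul trmxK trmx_inv trmx_mul trmxK mulmxA.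
  by rewrite -mulmxA.
have WPi : W *m Pi = W by rewrite /Pi !mulmxA mulmxV// mul1mx.
have PP : Pi *m Pi = Pi by rewrite {1}/Pi -!mulmxA WPi.
have PiE x : exists y : 'cV[R]_d, Pi *m x = W^T *m y.
  by exists (invmx (W *m W^T) *m W *m x); rewrite /Pi -mulmxA.
(* Sylvester's identity turns this into the determinant of $-1$ in size $d$, and $d$ is even. *)
have dP : \det (1%:M - 2 *: Pi) = 1.
  rewrite /Pi scalemxAl det_sylvester -!mulmxA -!scalemxAr mulVmx//.
  have -> : 1%:M - 2 *: 1%:M = - 1%:M :> 'M[R]_d.
    by rewrite -{1}[1%:M]scale1r -scalerBl -[RHS]scaleN1r; congr (_ *: _); ring.
  by rewrite -scaleN1r detZ det1 mulr1 -signr_odd (negbTE dE).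
clearbody Pi.
pose Q : 'M[R]_m := 1%:M - 2 *: Pi.
have dQ : \det Q = 1 by exact: dP.
have QQ : Q *m Q^T = 1%:M.
  have -> : Q^T = Q by rewrite /Q linearB linearZ /= trmx1 PT.
  rewrite /Q mulmxBr mulmx1 -scalemxAr mulmxBl mul1mx -scalemxAl PP.
  rewrite -addrA -opprD scalerBr scalerA -{1 2}[Pi]scale1r !scalerA.
  rewrite -scalerBl -scalerDl [X in X *: _](_ : _ = 0) ?scale0r ?subr0//.
  by ring.
have : \det (k *m Q) = 1.
  apply: det_orth_no_eigen.
    by rewrite trmx_mul mulmxA -(mulmxA k) QQ mulmx1.
  move=> x; set a := Pi *m x; set c := x - a.
  have xE : x = c + a by rewrite /c subrK.
  have Qx : Q *m x = c - a.
    rewrite /Q mulmxBl mul1mx -scalemxAl -/a /c -addrA -opprD; congr (_ - _).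
    by rewrite -[2]/(1 + 1) scalerDl scale1r.
  have [y0 ay] := PiE x.
  have ka : k *m a = - a by rewrite /a ay kW.
  have Wc : W *m c = 0 by rewrite /c mulmxBr /a mulmxA WPi subrr.
  have ac : edot a c = 0.
    by rewrite /edot /a ay trmx_mul trmxK -mulmxA Wc mulmx0 mxE.
  rewrite -mulmxA Qx mulmxBr ka opprK => kc; clearbody c; clearbody a.
  have {}kc : k *m c = - c - 2 *: a.
    have := congr1 (fun z => z - a) kc; rewrite addrK => ->.
    by rewrite xE opprD -addrA -opprD -[2]/(1 + 1) scalerDl scale1r.
  (* [k] is an isometry and [a] is orthogonal to [c], so $|c|^2=|c|^2+4|a|^2$. *)
  have a0 : a = 0.
    have := orth_edot c c kk; rewrite kc.
    rewrite !(edotBl, edotBr, edotNl, edotNr, edotZl, edotZr) (edotC c a) ac => H.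
    by apply/eqP; rewrite -edot_eq0; apply/eqP; lra.
  have [y cy] : exists y : 'cV[R]_d, c = W^T *m y.
    by apply: inV; rewrite kc a0 scaler0 subr0.
  have yz : y = 0 by apply: GI; rewrite -cy.
  by rewrite xE a0 cy yz mulmx0 addr0.
by rewrite det_mulmx dQ mulr1.
Qed.
End OrthogonalDeterminant.

Section CharPoly.
Context (R : rcfType).
Implicit Types p q : {poly R}.

Lemma poly_eq_seq (f : nat -> R) p q : injective f ->
  (forall i, p.[f i] = q.[f i]) -> p = q.
Proof.
move=> fi H; apply/eqP; rewrite -subr_eq0; apply/eqP; set r := p - q.
apply/eqP/negPn/negP => r0.
have := @max_poly_roots _ r [seq f i | i <- iota 0 (size r)] r0.
rewrite size_map size_iota ltnn map_inj_uniq ?iota_uniq// => H'.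
have : false by apply: H' => //; apply/allP => _ /mapP[i _ ->];
  rewrite /root hornerD hornerN H subrr.
by [].
Qed.

Lemma poly_eq_large (M : R) p q : (forall t, M < t -> p.[t] = q.[t]) -> p = q.
Proof.
move=> H; apply: (@poly_eq_seq (fun i => `|M| + 1 + i%:R)).
  by move=> i j /addrI /eqP; rewrite eqr_nat => /eqP.
move=> i; apply: H; rewrite -addrA; apply: le_lt_trans (ler_norm M) _.
by rewrite ltrDl ltr_wpDr// ler0n.
Qed.

Lemma char_poly_horner n (A : 'M[R]_n) t : (char_poly A).[t] = \det (t%:M - A).
Proof.
rewrite /char_poly -horner_evalE -det_map_mx; congr (\det _).
apply/matrixP => i j; rewrite !mxE /= horner_evalE hornerD hornerN hornerC.
by rewrite hornerMn hornerX.
Qed.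

Lemma monic_sqr_inj p q : p \is monic -> q \is monic -> p ^+ 2 = q ^+ 2 -> p = q.
Proof.
move=> mp mq /eqP; rewrite eqf_sqr => /orP[/eqP->//|/eqP pq].
have := monicP mp; rewrite pq lead_coefN (monicP mq) => /eqP.
by rewrite eq_sym -addr_eq0 (_ : 1 + 1 = 2%:R)// pnatr_eq0.
Qed.

Lemma nodepoly_eq0 (L : seq (R * R)) : uniq [seq x.1 | x <- L] -> nodepoly L = 0 ->
  {in L, forall x, x.2 = 0}.
Proof.
elim: L => [|p L IH] //= /andP[pL uL] E.
have p0 : p.2 = 0.
  have := congr1 (horner^~ p.1) E; rewrite hornerD hornerZ hornerM hornerXsubC.
  rewrite subrr mul0r addr0 horner0 horner_prod => /eqP.
  rewrite mulf_eq0 => /orP[/eqP//|]; rewrite prodf_seq_eq0 => /hasP[q qL /=].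
  rewrite hornerXsubC subr_eq0 => /eqP pq.
  by case/negP: pL; rewrite pq; exact: map_f.
move=> q; rewrite inE => /orP[/eqP->//|]; apply: IH => //.
move: E; rewrite p0 scale0r add0r => /eqP; rewrite mulf_eq0.
by rewrite polyXsubC_eq0 /= => /eqP.
Qed.

Lemma sum_by_value (I : finType) (mu : I -> R) (s : seq R) (F : I -> R) :
  uniq s -> (forall i, mu i \in s) ->
  \sum_i F i = \sum_(y <- s) \sum_(i | mu i == y) F i.
Proof.
move=> us mus; under [RHS]eq_bigr do rewrite big_mkcond.
rewrite exchange_big /=; apply: eq_bigr => i _.
rewrite -big_mkcond /= (big_rem (mu i))//= eqxx big1_seq ?addr0// => y.
by rewrite mem_rem_uniq// inE eq_sym => /andP[/eqP-> /andP[/=]]; rewrite eqxx.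
Qed.

End CharPoly.

Section SkewCharPoly.
Context (R : realType) (m : nat).

(** $(t-Y)(t-Y)^t=t^2-Y^2$. Characteristic polynomials are compared through those of squares, and
    [monic_sqr_inj] removes the resulting sign ambiguity. *)
Lemma det_skew_sq (Y : 'M[R]_m) t : Y \in so_m R m ->
  \det ((t ^+ 2)%:M - Y *m Y) = \det (t%:M - Y) ^+ 2.
Proof.
move=> sY; rewrite [RHS]expr2 -[X in _ * X]det_tr linearB /= tr_scalar_mx so_m_tr// opprK.
rewrite -det_mulmx mulmxBl !mulmxDr -scalar_mxM mul_scalar_mx mul_mx_scalar.
by congr (\det _); rewrite opprD addrA addrK -expr2.
Qed.

Lemma det_g_sq (X : 'M[R]_(m + 2)) t : X \in g_alg R m ->
  \det ((t ^+ 2)%:M - X *m X) = \det (t%:M - X) ^+ 2.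
Proof.
rewrite mem_g_alg addr_eq0 => /eqP XJ.
set J := (@lorentz_form R m) in XJ.
have E : t%:M + X = J *m (t%:M - X)^T *m J.
  rewrite linearB /= tr_scalar_mx mulmxBr mulmxBl mul_mx_scalar -scalemxAl JK scalemx1.
  by congr (_ + _); rewrite -mulNmx -XJ -mulmxA JK mulmx1.
have JJ : \det J * \det J = 1 by rewrite -det_mulmx JK det1.
have -> : \det (t%:M - X) ^+ 2 = \det ((t%:M - X) *m (t%:M + X)).
  rewrite E !det_mulmx det_tr -[LHS]mulr1 -JJ; ring.
rewrite mulmxBl !mulmxDr -scalar_mxM mul_scalar_mx mul_mx_scalar.
by congr (\det _); rewrite opprD addrA addrK -expr2.
Qed.

End SkewCharPoly.

(** * Conjugates of the Cartan element *)

Section CartanElement.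
Context (R : realType) (k : nat).
Notation m := (k.*2.+1).
Notation O := (@lorentz_group R m).
Notation ep := (ep R m).
Notation em := (em R m).
Variable a : seq R.
Implicit Types (x : 'cV[R]_m) (Z : 'M[R]_(m + 2)).
Notation T := (t' m a).
Notation ak := (a`_k).

Definition rsign (i : nat) : R := if odd i then - a`_(i./2) else a`_(i./2).

(** The partner of an index in its 2 by 2 block: row [i] of [rot_blocks] has [rsign i] in column
    [swp i] as its only entry. It is meaningful below [k.*2] only. *)
Definition swp (i : 'I_m) : 'I_m := inord (if odd i then i.-1 else i.+1).

Lemma swpE (i : 'I_m) : (i < k.*2)%N ->
  swp i = (if odd i then i.-1 else i.+1) :> nat.
Proof. by move=> ik; rewrite inordK//; case: ifP; lia. Qed.

Lemma swp_lt (i : 'I_m) : (i < k.*2)%N -> (swp i < k.*2)%N.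
Proof. by move=> ik; rewrite swpE//; case: ifP; lia. Qed.

Lemma swpK (i : 'I_m) : (i < k.*2)%N -> swp (swp i) = i.
Proof.
move=> ik; apply: val_inj; rewrite /= swpE ?swp_lt// swpE//.
by case: (boolP (odd i)) => oi; case: ifP; lia.
Qed.

Lemma swp_odd (i : 'I_m) : (i < k.*2)%N -> odd (swp i) = ~~ odd i.
Proof. by move=> ik; rewrite swpE//; case: ifP; lia. Qed.

Lemma swp_half (i : 'I_m) : (i < k.*2)%N -> (swp i)./2 = i./2.
Proof. by move=> ik; rewrite swpE//; case: ifP; lia. Qed.

Lemma rsign_swp (i : 'I_m) : (i < k.*2)%N -> rsign (swp i) = - rsign i.
Proof.
by move=> ik; rewrite /rsign swp_odd// swp_half//; case: odd; rewrite ?opprK.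
Qed.

Lemma rot_entry (i j : 'I_m) : rot_blocks m a i j =
  if (i < k.*2)%N && (j == swp i) then rsign i else 0.
Proof.
rewrite mxE /rsign; have [ik|ik] /= := ltnP i k.*2; last first.
  have im := ltn_ord i; have jm := ltn_ord j.
  case: ifP => [/andP[oi /eqP ji]|_]; first by exfalso; lia.
  by case: ifP => // /andP[oj /eqP ij]; exfalso; lia.
have -> : (j == swp i) = (j == (if odd i then i.-1 else i.+1) :> nat).
  by rewrite -val_eqE /= swpE.
have [oi|ei] /= := boolP (odd i).
  have -> : (~~ odd j && (i == j.+1 :> nat)) = (j == i.-1 :> nat) by lia.
  by case: eqP => // ji; have -> : j./2 = i./2 by lia.
by case: eqP => // ji; case: ifP => // /andP[? /eqP ?]; exfalso; lia.
Qed.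

Lemma rot_mulE x i : (rot_blocks m a *m x) i 0 =
  if (i < k.*2)%N then rsign i * x (swp i) 0 else 0.
Proof.
rewrite mxE; have [ik|ik] := ltnP i k.*2; last first.
  by rewrite big1// => j _; rewrite rot_entry ltnNge ik mul0r.
rewrite (bigD1 (swp i))//= rot_entry ik eqxx big1 ?addr0// => j ji.
by rewrite rot_entry (negbTE ji) andbF mul0r.
Qed.

(* The eigenvalues of the square of [rot_blocks m a]. *)
Definition mu (i : nat) : R := if (i < k.*2)%N then - a`_(i./2) ^+ 2 else 0.

Lemma rsign_sq i : rsign i ^+ 2 = a`_(i./2) ^+ 2.
Proof. by rewrite /rsign; case: odd; rewrite ?sqrrN. Qed.

Lemma rot_sqE x i : (rot_blocks m a *m (rot_blocks m a *m x)) i 0 = mu i * x i 0.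
Proof.
rewrite rot_mulE /mu; case: ifP => [ik|]; last by rewrite mul0r.
rewrite rot_mulE swp_lt// swpK// rsign_swp// mulrA mulrN -expr2.
by rewrite rsign_sq.
Qed.

Lemma rot_so : rot_blocks m a \in so_m R m.
Proof.
rewrite mem_so_m; apply/eqP/matrixP => i j; rewrite mxE [_^T _ _]mxE !rot_entry mxE.
have [ik|ik] := ltnP i k.*2; have [jk|jk] := ltnP j k.*2 => /=; rewrite ?addr0 ?add0r//.
- have [ji|ji] := eqVneq j (swp i).
    by rewrite ji swpK// eqxx rsign_swp// subrr.
  case: eqP => [ij|]; last by rewrite addr0.
  by case/eqP: ji; rewrite ij swpK.
- case: eqP => // ji; have := swp_lt ik; rewrite -ji; lia.
- case: eqP => // ji; have := swp_lt jk; rewrite -ji; lia.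
Qed.

Hypothesis size_a : size a = k.+1.
Hypothesis a_decr : forall i j : nat, (i < j < k)%N -> a`_j < a`_i.
Hypothesis a_pos : forall i : nat, (i < k.+1)%N -> 0 < a`_i.

Lemma a_neq0 i : (i < k.+1)%N -> a`_i != 0.
Proof. by move=> ik; rewrite gt_eqF// a_pos. Qed.

Lemma a_sq_inj i j : (i < k)%N -> (j < k)%N -> a`_i ^+ 2 = a`_j ^+ 2 -> i = j.
Proof.
move=> ik jk; have ai : 0 <= a`_i by rewrite ltW// a_pos// ltnW.
have aj : 0 <= a`_j by rewrite ltW// a_pos// ltnW.
move=> /eqP; rewrite eqrXn2// => /eqP E.
case: (ltngtP i j) => // ij.
  by have := @a_decr i j; rewrite ij jk E ltxx => /(_ isT).
by have := @a_decr j i; rewrite ij ik E ltxx => /(_ isT).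
Qed.

Lemma t'_nvec x p q :
  T *m nvec x p q = nvec (rot_blocks m a *m x) (ak * p) (- (ak * q)).
Proof.
have -> : T = upper_left (rot_blocks m a) + ak *: H0.
  rewrite /t' /upper_left /H0 (last_nth 0) size_a /= scale_block_mx !scaler0.
  by rewrite add_block_mx !addr0 add0r; case: (a) size_a => // b a' [<-].
rewrite mulmxDl upper_left_nvec -scalemxAl H0_nvec nvecZ nvecD.
by rewrite scaler0 addr0 !add0r mulrN.
Qed.

Lemma t'_gmx : T = gmx (rot_blocks m a) ak 0 0.
Proof.
apply: mulmx_nvec_inj => x p q; rewrite t'_nvec gmx_nvec trmx0 !edot0l.
by rewrite !scaler0 subr0 addr0 add0r oppr0 add0r.
Qed.

Lemma t'_g : T \in g_alg R m.
Proof. by rewrite t'_gmx; apply: gmx_g; exact: rot_so. Qed.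

Lemma t'_sq x p q : T *m (T *m nvec x p q) =
  nvec (\col_i (mu i * x i 0)) (ak ^+ 2 * p) (ak ^+ 2 * q).
Proof.
rewrite !t'_nvec; congr nvec; [|ring|ring].
by apply/colP => i; rewrite rot_sqE mxE.
Qed.

Lemma prod_double (f : nat -> R) : \prod_(i < k.*2) f i./2 = \prod_(j < k) f j ^+ 2.
Proof.
elim: k => [|l IH]; first by rewrite !big_ord0.
by rewrite doubleS !big_ord_recr /= IH -mulrA doubleK uphalf_double expr2.
Qed.

Definition chi : {poly R} :=
  'X * \prod_(j < k) ('X^2 + (a`_j ^+ 2)%:P) * ('X^2 - (ak ^+ 2)%:P).

Lemma chi_horner t : chi.[t] =
  t * \prod_(j < k) (t ^+ 2 + a`_j ^+ 2) * (t ^+ 2 - ak ^+ 2).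
Proof.
rewrite /chi !hornerM hornerX horner_prod !hornerE; congr (_ * _ * _).
by apply: eq_bigr => j _; rewrite !hornerE.
Qed.

Lemma chi_monic : chi \is monic.
Proof.
rewrite /chi !monicMl ?monicX//.
- rewrite monicE lead_coefDl ?lead_coefXn// size_polyN size_polyXn.
  exact: leq_ltn_trans (size_polyC_leq1 _) _.
- apply: monic_prod => j _; rewrite monicE lead_coefDl ?lead_coefXn// size_polyXn.
  exact: leq_ltn_trans (size_polyC_leq1 _) _.
Qed.

Lemma prod_mu s : \prod_(i < m) (s - mu i) = \prod_(j < k) (s + a`_j ^+ 2) ^+ 2 * s.
Proof.
rewrite big_ord_recr /= {2}/mu ltnn subr0; congr (_ * _).
rewrite -(prod_double (fun j => s + a`_j ^+ 2)); apply: eq_bigr => i _.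
by rewrite /mu /= ltn_ord opprK.
Qed.

Lemma char_poly_t' : char_poly T = chi.
Proof.
apply: monic_sqr_inj; [exact: char_poly_monic|exact: chi_monic|].
apply: (@poly_eq_large _ 0) => t _.
rewrite !horner_exp char_poly_horner -det_g_sq ?t'_g//.
have -> : (t ^+ 2)%:M - T *m T =
  block_mx (diag_mx (\row_(i < m) (t ^+ 2 - mu i))) 0 0 ((t ^+ 2 - ak ^+ 2)%:M : 'M[R]_2).
  apply: mulmx_nvec_inj => x p q; rewrite mulmxBl mul_scalar_mx -mulmxA t'_sq.
  rewrite nvecZ nvecB /nvec block_vec !mul0mx addr0 add0r mul_scalar_mx.
  rewrite (@scale_col_mx _ 1 1) !scale_scalar_mx /vec; congr (col_mx _ (@col_mx _ 1 1 1 _%:M _%:M)).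
  - apply/colP => i; rewrite mul_diag_mx !mxE; ring.
  - ring.
  - ring.
rewrite det_ublock det_diag det_scalar chi_horner.
under eq_bigr do rewrite mxE.
by rewrite prod_mu prodrXl; ring.
Qed.

Lemma det_t' t : \det (t%:M - T) =
  t * \prod_(j < k) (t ^+ 2 + a`_j ^+ 2) * (t ^+ 2 - ak ^+ 2).
Proof. by rewrite -char_poly_horner char_poly_t' chi_horner. Qed.

End CartanElement.

Section LorentzSpectrum.
Context (R : realType) (m : nat).
Implicit Types (X : 'M[R]_(m + 2)) (u v w : 'cV[R]_(m + 2)).

Lemma ldot_suml I (r : seq I) (P : pred I) (F : I -> 'cV[R]_(m + 2)) w :
  ldot (\sum_(i <- r | P i) F i) w = \sum_(i <- r | P i) ldot (F i) w.
Proof.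
elim/big_rec2: _ => [|i y1 y2 _ <-]; first by rewrite ldot0l.
by rewrite ldotDl.
Qed.

Lemma g_sq_adj X u v : X \in g_alg R m ->
  ldot (X *m (X *m u)) v = ldot u (X *m (X *m v)).
Proof. by move=> gX; rewrite !g_ldot// opprK. Qed.

Lemma g_sq_orth X u v (la nu : R) : X \in g_alg R m -> la != nu ->
  X *m (X *m u) = la *: u -> X *m (X *m v) = nu *: v -> ldot u v = 0.
Proof.
move=> gX ln Eu Ev; have := g_sq_adj u v gX; rewrite Eu Ev ldotZl ldotZr => /eqP.
by rewrite -subr_eq0 -mulrBl mulf_eq0 subr_eq0 (negbTE ln) /= => /eqP.
Qed.

Lemma g_eigen_null X u (la : R) : X \in g_alg R m -> la != 0 ->
  X *m u = la *: u -> ldot u u = 0.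
Proof.
move=> gX l0 E; have := g_ldot_self u gX; rewrite E ldotZl => /eqP.
by rewrite mulf_eq0 (negbTE l0) /= => /eqP.
Qed.

(** The form is semidefinite on the orthogonal complement of a null vector [u], with the line of [u]
    as radical: subtracting a multiple of [u] from [v] kills the time coordinate without changing
    the norm. *)
Lemma null_perp u v : u != 0 -> ldot u u = 0 -> ldot u v = 0 ->
  0 <= ldot v v /\ (ldot v v = 0 -> exists c, v = c *: u).
Proof.
have [x [s [t ->]]] := vecP u; have [y [r [l ->]]] := vecP v => u0 uu uv.
have t0 : t != 0.
  apply: contra u0 => /eqP t0; move: uu; rewrite t0 ldot_vec mulr0 subr0 -expr2.
  move=> /eqP; rewrite paddr_eq0 ?edot_ge0 ?sqr_ge0// edot_eq0 sqrf_eq0.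
  by move=> /andP[/eqP-> /eqP->]; rewrite vec0.
have E : ldot (vec y r l) (vec y r l) =
    ldot (vec y r l - (l / t) *: vec x s t) (vec y r l - (l / t) *: vec x s t).
  by rewrite !ldotE uu (ldotC (vec y r l)) uv; ring.
have VE : vec y r l - (l / t) *: vec x s t =
    vec (y - (l / t) *: x) (r - l / t * s) 0.
  by rewrite vecZ vecB divfK// subrr.
rewrite E VE ldot_vec mul0r subr0 -expr2.
split; first by rewrite addr_ge0 ?edot_ge0 ?sqr_ge0.
move=> /eqP; rewrite paddr_eq0 ?edot_ge0 ?sqr_ge0// edot_eq0 sqrf_eq0.
move=> /andP[/eqP E1 /eqP E2]; exists (l / t).
by apply/eqP; rewrite -subr_eq0 VE E1 E2 vec0.
Qed.

End LorentzSpectrum.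

Section Frames.
Context (R : realType) (k : nat).
Notation m := (k.*2.+1).
Notation O := (@lorentz_group R m).
Notation ep := (ep R m).
Notation em := (em R m).
Variable a : seq R.
Hypothesis size_a : size a = k.+1.
Hypothesis a_decr : forall i j : nat, (i < j < k)%N -> a`_j < a`_i.
Hypothesis a_pos : forall i : nat, (i < k.+1)%N -> 0 < a`_i.
Implicit Types (x : 'cV[R]_m) (Z : 'M[R]_(m + 2)).
Notation T := (t' m a).
Notation ak := (a`_k).

(** Mirrors the action of t' on the standard basis, which sends $e_{2j}$ to $-a_je_{2j+1}$; [z]
    spans the kernel and takes the last place. *)
Definition frame_vec Z (v : nat -> 'cV[R]_(m + 2)) z (i : nat) :=
  if (i < k.*2)%N then
    if odd i then - (a`_(i./2))^-1 *: (Z *m v i./2) else v i./2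
  else z.

Lemma mu_neq_ak (i : nat) : mu k a i != ak ^+ 2.
Proof.
have : 0 < ak ^+ 2 by rewrite exprn_gt0// a_pos.
apply: contraTneq => <-; rewrite /mu -leNgt.
by case: ifP => // _; rewrite oppr_le0 sqr_ge0.
Qed.

Lemma mu_inj (i j : 'I_m) : mu k a i = mu k a j ->
  (i < k.*2)%N = (j < k.*2)%N /\ ((i < k.*2)%N -> i./2 = j./2).
Proof.
have half l : (l < k.*2)%N -> (l./2 < k)%N by lia.
have an l : (l < k.*2)%N -> a`_(l./2) ^+ 2 != 0.
  by move=> lk; rewrite sqrf_eq0 (a_neq0 a_pos)// ltnW// ltnS; exact: half.
rewrite /mu; have [ik|ik] := ltnP i k.*2; have [jk|jk] := ltnP j k.*2 => //.
- by move=> /oppr_inj /(a_sq_inj a_decr a_pos (half _ ik) (half _ jk)).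
- by move=> /eqP; rewrite oppr_eq0 (negbTE (an _ ik)).
- by move=> /eqP; rewrite eq_sym oppr_eq0 (negbTE (an _ jk)).
Qed.

Section FrameMatrix.
Variables (Z : 'M[R]_(m + 2)) (v : nat -> 'cV[R]_(m + 2)) (z u w : 'cV[R]_(m + 2)).
Hypothesis gZ : Z \in g_alg R m.
Hypothesis Zv : forall j, (j < k)%N -> Z *m (Z *m v j) = - a`_j ^+ 2 *: v j.
Hypothesis v1 : forall j, (j < k)%N -> ldot (v j) (v j) = 1.
Hypothesis Zz : Z *m z = 0.
Hypothesis z1 : ldot z z = 1.
Hypothesis Zu : Z *m u = ak *: u.
Hypothesis Zw : Z *m w = - ak *: w.
Hypothesis uw : ldot u w = 2.
Notation F := (frame_vec Z v z).

Let half l : (l < k.*2)%N -> (l./2 < k)%N. Proof. lia. Qed.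
Let an l : (l < k.*2)%N -> a`_(l./2) != 0.
Proof. by move=> lk; rewrite (a_neq0 a_pos)// ltnW// ltnS; exact: half. Qed.

Lemma frame_mul (i : 'I_m) : Z *m F i =
  if (i < k.*2)%N then rsign a (swp i) *: F (swp i) else 0.
Proof.
rewrite /frame_vec; case: ifP => // ik.
rewrite swp_lt// swp_half// swp_odd// rsign_swp// /rsign; case: ifP => oi /=.
  rewrite -scalemxAr Zv ?half// scalerA opprK; congr (_ *: _).
  by field; exact: an.
by rewrite scalerA mulrNN mulfV ?scale1r// an.
Qed.

Lemma frame_sq (i : 'I_m) : Z *m (Z *m F i) = mu k a i *: F i.
Proof.
rewrite frame_mul /mu; case: ifP => ik; last by rewrite mulmx0 scale0r.
rewrite -scalemxAr frame_mul swp_lt// swpK// scalerA rsign_swp//.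
by rewrite mulNr -expr2 rsign_sq.
Qed.

(** Vectors from different eigenspaces of $Z^2$ are orthogonal because $Z^2$ is self-adjoint; within
    an eigenplane, [v] and [Z *m v] are orthogonal because [Z] is skew. *)
Lemma frame_gram (i j : 'I_m) : ldot (F i) (F j) = (i == j)%:R.
Proof.
have [mm|mn] := eqVneq (mu k a i) (mu k a j); last first.
  rewrite (g_sq_orth gZ mn (frame_sq i) (frame_sq j)).
  by have -> : (i == j) = false by apply: contraNF mn => /eqP ->.
have [ij hh] := mu_inj mm; rewrite /frame_vec -ij.
case: ifP => ik; last first.
  have -> : i = j by apply: val_inj => /=; have := ltn_ord i; have := ltn_ord j; lia.
  by rewrite eqxx z1.
rewrite -hh//; set h := i./2.
have hk : (h < k)%N by exact: half.
have ah : a`_h != 0 by exact: an.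
have hE : i./2 = j./2 by exact: hh.
have -> : (i == j) = (odd i == odd j) by rewrite -val_eqE /=; case: eqP; lia.
case: (odd i); case: (odd j) => /=; rewrite ?ldotZl ?ldotZr.
- rewrite g_ldot// Zv// ldotZr v1//; field; exact: ah.
- by rewrite g_ldot_self// mulr0.
- by rewrite ldotC g_ldot_self// mulr0.
- by rewrite v1.
Qed.

Let Zuu : Z *m (Z *m u) = ak ^+ 2 *: u.
Proof. by rewrite Zu -scalemxAr Zu scalerA expr2. Qed.

Let Zww : Z *m (Z *m w) = ak ^+ 2 *: w.
Proof. by rewrite Zw -scalemxAr Zw scalerA mulrNN expr2. Qed.

(** The last two columns are such that [ep] goes to [u] and [em] to [w]. *)
Definition frame_mx : 'M[R]_(m + 2) :=
  row_mx (\matrix_(r < m + 2, i < m) F i r 0)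
    (@row_mx _ _ 1 1 (2^-1 *: (u + w)) (2^-1 *: (u - w))).

Lemma frame_mxE x p q :
  frame_mx *m nvec x p q = \sum_i x i 0 *: F i + p *: u + q *: w.
Proof.
rewrite /frame_mx /nvec /vec mul_row_col (@mul_row_col _ _ 1 1) -addrA.
congr (_ + _).
  apply/colP => r; rewrite mxE summxE; apply: eq_bigr => i _.
  by rewrite !mxE mulrC.
rewrite !mul_mx_scalar !scalerA !scalerDr !scalerN addrACA -scalerDl -scalerBl.
by congr (_ *: _ + _ *: _); field.
Qed.

Lemma frame_lorentz : O frame_mx.
Proof.
have uu : ldot u u = 0 by apply: (g_eigen_null gZ _ Zu); rewrite gt_eqF// a_pos.
have ww : ldot w w = 0.
  by apply: (g_eigen_null gZ _ Zw); rewrite oppr_eq0 gt_eqF// a_pos.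
have Fu (i : 'I_m) : ldot (F i) u = 0.
  exact: g_sq_orth gZ (mu_neq_ak i) (frame_sq i) Zuu.
have Fw (i : 'I_m) : ldot (F i) w = 0.
  exact: g_sq_orth gZ (mu_neq_ak i) (frame_sq i) Zww.
have sum_u x y : (forall i : 'I_m, ldot (F i) y = 0) ->
    ldot (\sum_i x i 0 *: F i) y = 0.
  by move=> Fy; rewrite ldot_suml big1// => i _; rewrite ldotZl Fy mulr0.
have sum_sum (x y : 'cV[R]_m) : ldot (\sum_i x i 0 *: F i) (\sum_i y i 0 *: F i) = edot x y.
  have FS (i : 'I_m) : ldot (\sum_j y j 0 *: F j) (F i) = y i 0.
    transitivity (\sum_(j < m) y j 0 * (j == i)%:R).
      by rewrite ldot_suml; apply: eq_bigr => j _; rewrite ldotZl frame_gram.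
    rewrite (bigD1 i)//= eqxx mulr1 big1 ?addr0// => j /negbTE ->.
    by rewrite mulr0.
  rewrite edotE ldot_suml; apply: eq_bigr => i _.
  by rewrite ldotZl ldotC FS.
apply/lorentzP => U V.
have [x [p [q ->]]] := nvecP U; have [y [p' [q' ->]]] := nvecP V.
rewrite !frame_mxE ldot_nvec; set S := \sum_i _; set S' := \sum_i _.
have Su : ldot S u = 0 by exact: sum_u.
have Sw : ldot S w = 0 by exact: sum_u.
have Su' : ldot S' u = 0 by exact: sum_u.
have Sw' : ldot S' w = 0 by exact: sum_u.
have SS : ldot S S' = edot x y by exact: sum_sum.
move: S S' Su Sw Su' Sw' SS => S S' Su Sw Su' Sw' SS.
rewrite !(ldotDl, ldotDr, ldotZl, ldotZr) SS Su Sw (ldotC _ S') (ldotC w S') Su' Sw'.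
by rewrite (ldotC w u) uu ww uw; ring.
Qed.

Lemma frame_t' : Z *m frame_mx = frame_mx *m T.
Proof.
apply: mulmx_nvec_inj => x p q; rewrite -!mulmxA t'_nvec// !frame_mxE.
rewrite !mulmxDr -!scalemxAr Zu Zw !scalerA (mulrC p) mulrN.
rewrite (mulrC q); congr (_ + _ + _).
rewrite mulmx_sumr.
rewrite (reindex_onto (fun i : 'I_m => if (i < k.*2)%N then swp i else i)
  (fun i : 'I_m => if (i < k.*2)%N then swp i else i)) /=; last first.
  by move=> i _; case: (boolP (i < k.*2)%N) => ik; rewrite ?swp_lt ?swpK ?(negbTE ik).
apply: eq_big => [i|i _].
  by case: (boolP (i < k.*2)%N) => ik; rewrite ?swp_lt ?swpK ?(negbTE ik) ?eqxx.
rewrite -scalemxAr frame_mul rot_mulE; case: (ltnP i k.*2) => ik.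
  by rewrite swp_lt// swpK// scalerA mulrC.
by rewrite ltnNge ik scaler0 scale0r.
Qed.

End FrameMatrix.
End Frames.

Lemma char_poly_tr (R : comNzRingType) p (A : 'M[R]_p) : char_poly A^T = char_poly A.
Proof.
rewrite /char_poly -det_tr; congr (\det _); apply/matrixP => i j.
by rewrite !mxE eq_sym.
Qed.

Lemma root_char_polyP (F : fieldType) p (A : 'M[F]_p) la :
  root (char_poly A) la <-> exists2 v : 'cV[F]_p, A *m v = la *: v & v != 0.
Proof.
rewrite -char_poly_tr -eigenvalue_root_char; split.
  move=> /eigenvalueP[v Av v0]; exists v^T.
    by rewrite -[A]trmxK -trmx_mul Av linearZ.
  by apply: contra v0 => /eqP vT; rewrite -(trmxK v) vT trmx0.
move=> [v Av v0]; apply/eigenvalueP; exists v^T.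
  by rewrite -trmx_mul Av linearZ.
by apply: contra v0 => /eqP vT; rewrite -(trmxK v) vT trmx0.
Qed.

Lemma eigen_transfer (F : fieldType) p (A B : 'M[F]_p) la (u : 'cV[F]_p) :
  char_poly A = char_poly B -> B *m u = la *: u -> u != 0 ->
  exists2 v : 'cV[F]_p, A *m v = la *: v & v != 0.
Proof.
by move=> AB Bu u0; apply/root_char_polyP; rewrite AB; apply/root_char_polyP; exists u.
Qed.

Section ConjugatesOfCartan.
Context (R : realType) (k : nat).
Notation m := (k.*2.+1).
Notation O := (@lorentz_group R m).
Notation ep := (ep R m).
Notation em := (em R m).
Notation et := (et R m).
Variable a : seq R.
Hypothesis size_a : size a = k.+1.
Hypothesis a_decr : forall i j : nat, (i < j < k)%N -> a`_j < a`_i.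
Hypothesis a_pos : forall i : nat, (i < k.+1)%N -> 0 < a`_i.
Implicit Types (x : 'cV[R]_m) (X Z g h : 'M[R]_(m + 2)).
Notation T := (t' m a).
Notation ak := (a`_k).

Definition flip_last : 'M[R]_m :=
  diag_mx (\row_(i < m) if i == k.*2 :> nat then -1 else 1).

Lemma flip_lastE x i :
  (flip_last *m x) i 0 = (if i == k.*2 :> nat then -1 else 1) * x i 0.
Proof. by rewrite mul_diag_mx !mxE. Qed.

(* [det_flip] and [time_flip] centralize t' and [ginf_mx], and change the
   determinant and the time orientation, respectively: modulo the centralizer the
   whole Lorentz group acts as SO_e. *)
Definition det_flip : 'M[R]_(m + 2) := kblock flip_last.
Definition time_flip : 'M[R]_(m + 2) := block_mx 1%:M 0 0 (- 1%:M).

Lemma det_flip_nvec x p q : det_flip *m nvec x p q = nvec (flip_last *m x) p q.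
Proof. exact: kblock_nvec. Qed.

Lemma time_flip_nvec x p q : time_flip *m nvec x p q = nvec x (- p) (- q).
Proof.
rewrite block_vec !mul0mx mul1mx addr0 add0r mulNmx mul1mx (@opp_col_mx _ 1 1).
by rewrite -!raddfN /nvec /vec; congr (col_mx _ (@col_mx _ 1 1 1 _%:M _%:M)); ring.
Qed.

Lemma det_flip_lorentz : O det_flip.
Proof.
apply: kblock_lorentz; rewrite /flip_last tr_diag_mx; apply/matrixP => i j.
rewrite mul_diag_mx !mxE; have [->|ij] /= := eqVneq i j; last by rewrite ?mulr0n mulr0.
by case: ifP => _; rewrite mulr1n ?mulrNN mulr1.
Qed.

Lemma det_det_flip : \det det_flip = -1.
Proof.
rewrite det_kblock det_diag big_ord_recr /= big1 ?mul1r ?mxE /= ?eqxx//.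
by move=> i _; rewrite mxE /= ltn_eqF.
Qed.

Lemma time_flip_lorentz : O time_flip.
Proof.
apply/lorentzP => u v.
have [x [p [q ->]]] := nvecP u; have [y [p' [q' ->]]] := nvecP v.
by rewrite !time_flip_nvec !ldot_nvec; ring.
Qed.

Lemma det_time_flip : \det time_flip = 1.
Proof.
by rewrite /time_flip det_ublock det1 mul1r -scaleN1r detZ det1 mulr1 sqrrN expr1n.
Qed.

Lemma det_flip_t' : det_flip *m T = T *m det_flip.
Proof.
apply: mulmx_nvec_inj => x p q; rewrite -!mulmxA det_flip_nvec !t'_nvec//.
rewrite det_flip_nvec; congr nvec; apply/colP => i.
rewrite flip_lastE !rot_mulE flip_lastE.
have [ik|ik] := ltnP i k.*2; last by rewrite mulr0.
have -> : (i == k.*2 :> nat) = false by lia.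
have -> : (swp i == k.*2 :> nat) = false by have := swp_lt ik; lia.
by rewrite !mul1r.
Qed.

Lemma time_flip_t' : time_flip *m T = T *m time_flip.
Proof.
apply: mulmx_nvec_inj => x p q; rewrite -!mulmxA time_flip_nvec !t'_nvec//.
by rewrite time_flip_nvec; congr nvec; ring.
Qed.

Lemma det_flip_ep : det_flip *m ep = ep.
Proof. by rewrite epE det_flip_nvec mulmx0. Qed.

Lemma time_flip_ep : time_flip *m ep = - ep.
Proof. by rewrite epE time_flip_nvec nvecN !oppr0. Qed.

Lemma ginf_nvec x p q :
  ginf_mx R m *m nvec x p q = nvec (flip_last *m x) (- q) (- p).
Proof.
apply/colP => i; rewrite /ginf_mx mul_diag_mx mxE.
case: (split_ordP i) => j ->.
  rewrite !col_mxEu flip_lastE !mxE /=; congr (_ * _).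
  by rewrite [(_ == m)%N]ltn_eqF ?orbF.
case: (@split_ordP 1 1 j) => l ->; rewrite !col_mxEd !ord1.
  rewrite !(@col_mxEu _ 1 1) !mxE /= addn0 gtn_eqF//= !eqxx /=; ring.
rewrite !(@col_mxEd _ 1 1) !mxE /= !gtn_eqF ?addn1 ?ltnS//=; ring.
Qed.

Lemma ginf_lorentz : O (ginf_mx R m).
Proof.
apply/lorentzP => u v.
have [x [p [q ->]]] := nvecP u; have [y [p' [q' ->]]] := nvecP v.
rewrite !ginf_nvec !ldot_nvec; have := lorentz_ldot (nvec x 0 0) (nvec y 0 0) det_flip_lorentz.
by rewrite !det_flip_nvec !ldot_nvec !mul0r addr0 mulr0 !addr0 => ->; ring.
Qed.

Lemma ginf_em : ginf_mx R m *m em = - ep.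
Proof. by rewrite emE epE ginf_nvec mulmx0 nvecN !oppr0. Qed.

Lemma det_flip_ginf : det_flip *m ginf_mx R m = ginf_mx R m *m det_flip.
Proof.
apply: mulmx_nvec_inj => x p q.
by rewrite -!mulmxA ginf_nvec !det_flip_nvec ginf_nvec.
Qed.

Lemma time_flip_ginf : time_flip *m ginf_mx R m = ginf_mx R m *m time_flip.
Proof.
apply: mulmx_nvec_inj => x p q.
by rewrite -!mulmxA ginf_nvec !time_flip_nvec ginf_nvec.
Qed.

Lemma time_flip_et : time_flip *m et = - et.
Proof. by rewrite etE time_flip_nvec nvecN !oppr0. Qed.

Lemma t'_conjM g h : O g -> O h -> h *m T = T *m h ->
  (g *m h) *m T *m invmx (g *m h) = g *m T *m invmx g.
Proof.
move=> Og Oh hT; have Ogh := lorentzM Og Oh.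
have E : g *m T *m invmx g *m (g *m h) = (g *m h) *m T.
  by rewrite mulmxA mulmxKV ?lorentz_unit// -!mulmxA hT.
by rewrite -E mulmxK// lorentz_unit.
Qed.

Lemma det_adjust g : O g -> exists h,
  [/\ O h /\ h *m ginf_mx R m = ginf_mx R m *m h, h *m T = T *m h,
  h *m ep = ep, h *m et = et & \det (g *m h) = 1].
Proof.
move=> Og; case: (det_lorentz Og) => dg.
  by exists 1%:M; rewrite !mul1mx !mulmx1; split=> //; split=> //; exact: lorentz1.
exists det_flip; split.
- by split; [exact: det_flip_lorentz|exact: det_flip_ginf].
- exact: det_flip_t'.
- exact: det_flip_ep.
- by rewrite etE det_flip_nvec mulmx0.
- by rewrite det_mulmx dg det_det_flip mulrNN mulr1.
Qed.

Lemma SOe_adjust g : O g -> exists h, [/\ O h, h *m T = T *m h &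
  @SOe R m (g *m h)].
Proof.
move=> Og; have [h [[Oh _] hT hp he dh]] := det_adjust Og.
have Ogh := lorentzM Og Oh.
have Qe : ldot (g *m h *m et) (g *m h *m et) = -1.
  by rewrite lorentz_ldot// /et ldot_vec edot0l; ring.
have tn : ldot (g *m h *m et) et != 0.
  move: Qe; have [x [s [t ->]]] := vecP (g *m h *m et).
  rewrite ldot_et oppr_eq0 ldot_vec => Qe; apply/eqP => t0.
  by have := edot_ge0 x; have := sqr_ge0 s; move: Qe; rewrite t0 expr2; lra.
have [tl|tg] := ltP (ldot (g *m h *m et) et) 0.
  by exists h; split=> //; exact: lorentz_SOe.
exists (h *m time_flip); split.
- exact: lorentzM time_flip_lorentz.
- by rewrite -mulmxA time_flip_t' mulmxA hT mulmxA.
- rewrite mulmxA; apply: lorentz_SOe.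
  + exact: lorentzM time_flip_lorentz.
  + by rewrite det_mulmx dh det_time_flip mulr1.
  + have -> : g *m h *m time_flip *m et = - (g *m h *m et).
      by rewrite -mulmxA time_flip_et mulmxN.
    by rewrite ldotNl oppr_lt0 lt0r tn tg.
Qed.

(** Commutation with [ginf_mx] is what lets the same correction serve for the conjugate of t' by
    g'_infinity. *)
Lemma Pmx_adjust g c : O g -> c != 0 -> g *m ep = c *: ep ->
  exists h, [/\ O h, h *m T = T *m h, h *m ginf_mx R m = ginf_mx R m *m h &
    Pmx (g *m h)].
Proof.
move=> Og c0 gp; have [h [[Oh hg] hT hp he dh]] := det_adjust Og.
have Ogh := lorentzM Og Oh.
have [cp|cn] := ltP 0 c.
  exists h; split=> //; split=> //; exists c => //.
  by rewrite -mulmxA hp.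
exists (h *m time_flip); split.
- exact: lorentzM time_flip_lorentz.
- by rewrite -mulmxA time_flip_t' mulmxA hT mulmxA.
- by rewrite -mulmxA time_flip_ginf mulmxA hg mulmxA.
- rewrite mulmxA; split.
  + exact: lorentzM time_flip_lorentz.
  + by rewrite det_mulmx dh det_time_flip mulr1.
  + exists (- c); first by rewrite oppr_gt0 lt_neqAle c0 cn.
    by rewrite -!mulmxA time_flip_ep mulmxN hp mulmxN gp scaleNr.
Qed.

Lemma t'_ep : T *m ep = ak *: ep.
Proof. by rewrite epE t'_nvec// mulmx0 nvecZ scaler0 !mulr0 oppr0. Qed.

Lemma t'_em : T *m em = - ak *: em.
Proof. by rewrite emE t'_nvec// mulmx0 nvecZ scaler0 !mulr0 !mulr1. Qed.

Definition dvec (i : 'I_m) : 'cV[R]_(m + 2) := nvec (delta_mx i 0) 0 0.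

Lemma dvec_ldot i : ldot (dvec i) (dvec i) = 1.
Proof.
rewrite ldot_nvec edotE (bigD1 i)//= big1 ?mxE ?eqxx /=; first by ring.
by move=> j ji; rewrite mxE (negbTE ji) mul0r.
Qed.

Lemma dvec_neq0 i : dvec i != 0.
Proof.
apply/eqP => d0; have := dvec_ldot i; rewrite d0 ldot0l => /eqP.
by rewrite eq_sym oner_eq0.
Qed.

Lemma t'_dvec i : T *m (T *m dvec i) = mu k a i *: dvec i.
Proof.
rewrite t'_sq// nvecZ !mulr0; congr nvec; apply/colP => j; rewrite !mxE eqxx andbT.
by case: eqP => [->|]; rewrite ?mulr0.
Qed.

Lemma t'_dvec_last : T *m dvec ord_max = 0.
Proof.
rewrite t'_nvec// !mulr0 oppr0 -nvec0; congr nvec; apply/colP => j.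
rewrite rot_mulE !mxE eqxx andbT; case: ifP => // jk.
by rewrite -val_eqE /= ltn_eqF ?swp_lt// mulr0.
Qed.

(** The eigenvalues of t', and those of its square, have eigenvectors for [Z] too. The signature
    makes them a frame: the two null eigenvectors pair nontrivially, and all the others are
    spacelike. *)
Lemma char_poly_conj Z : Z \in g_alg R m -> char_poly Z = chi k a ->
  exists2 g, O g & Z = g *m T *m invmx g.
Proof.
move=> gZ; rewrite -(char_poly_t' size_a) => ZT.
have gT := t'_g size_a.
have akn : ak != 0 by rewrite gt_eqF// a_pos.
have ZZ : char_poly (Z *m Z) = char_poly (T *m T).
  apply: (@poly_eq_seq R (fun i => i%:R ^+ 2)).
    move=> i j /eqP; rewrite eqrXn2 ?ler0n// eqr_nat => /eqP //.
  by move=> i; rewrite !char_poly_horner !det_g_sq// -!char_poly_horner ZT.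
have epn : ep != 0 := ep_neq0 R m.
have emn : em != 0.
  by apply/eqP => e0; have := ldot_pm R m; rewrite e0 ldot0r => /eqP; rewrite eq_sym pnatr_eq0.
have [u Zu u0] := eigen_transfer ZT t'_ep epn.
have [w Zw w0] := eigen_transfer ZT t'_em emn.
have [z Zz z0] : exists2 z : 'cV[R]_(m + 2), Z *m z = 0 & z != 0.
  have [|z Zz z0] := @eigen_transfer _ _ Z T 0 (dvec ord_max) ZT _ (dvec_neq0 _).
    by rewrite t'_dvec_last scale0r.
  by exists z => //; rewrite Zz scale0r.
have uu := g_eigen_null gZ akn Zu.
have nakn : - ak != 0 by rewrite oppr_eq0.
have ww := g_eigen_null gZ nakn Zw.
(* Orthogonal null vectors are proportional, which would identify the eigenvalues [ak] and
   [- ak]. *)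
have uw : ldot u w != 0.
  apply/eqP => uw; have [_ /(_ ww)[c wE]] := null_perp u0 uu uw.
  case/eqP: w0; have := Zw; rewrite wE -scalemxAr Zu !scalerA => /eqP.
  rewrite -subr_eq0 -scalerBl scaler_eq0 (negbTE u0) orbF => /eqP H.
  have : c * ak *+ 2 == 0 by rewrite mulr2n; apply/eqP; rewrite -[RHS]H; ring.
  by rewrite mulrn_eq0 /= mulf_eq0 (negbTE akn) orbF => /eqP ->; rewrite scale0r.
have Zuu : Z *m (Z *m u) = ak ^+ 2 *: u by rewrite Zu -scalemxAr Zu scalerA.
(* Such a [v] is orthogonal to [u]; by [null_perp] it could fail to be spacelike only as a multiple
   of [u], whose eigenvalue is [ak ^+ 2]. *)
have pos v la : Z *m (Z *m v) = la *: v -> la != ak ^+ 2 -> v != 0 -> 0 < ldot v v.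
  move=> Zv lak v0; have uv : ldot u v = 0.
    by apply: (g_sq_orth gZ _ Zuu Zv); rewrite eq_sym.
  have [vv0 H] := null_perp u0 uu uv; rewrite lt0r vv0 andbT.
  apply/eqP => /H[c vE]; case/eqP: v0.
  move: Zv; rewrite vE -!scalemxAr Zuu !scalerA => /eqP.
  rewrite -subr_eq0 -scalerBl scaler_eq0 (negbTE u0) orbF mulrC -mulrBl.
  by rewrite mulf_eq0 subr_eq0 eq_sym (negbTE lak) /= => /eqP ->; rewrite scale0r.
have norm v : 0 < ldot v v ->
    ldot ((Num.sqrt (ldot v v))^-1 *: v) ((Num.sqrt (ldot v v))^-1 *: v) = 1.
  move=> v0; rewrite ldotZl ldotZr mulrA -invfM -expr2 sqr_sqrtr ?ltW//.
  by rewrite mulVf// gt_eqF.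
have [v Hv] : exists v : nat -> 'cV[R]_(m + 2), forall j, (j < k)%N ->
    Z *m (Z *m v j) = - a`_j ^+ 2 *: v j /\ ldot (v j) (v j) = 1.
  have H j : exists v : 'cV[R]_(m + 2), (j < k)%N ->
    Z *m (Z *m v) = - a`_j ^+ 2 *: v /\ ldot v v = 1.
    have [jk|jk] := ltnP j k; last by exists 0.
    have jm : (j.*2 < m)%N by lia.
    have muj : mu k a (Ordinal jm) = - a`_j ^+ 2.
      by rewrite /mu /= ltn_double jk doubleK.
    have := t'_dvec (Ordinal jm); rewrite muj mulmxA => Td.
    have [v Zv v0] := eigen_transfer ZZ Td (dvec_neq0 _).
    rewrite -mulmxA in Zv.
    exists ((Num.sqrt (ldot v v))^-1 *: v) => _; split; last first.
      by apply/norm/(pos _ _ Zv) => //; rewrite -muj mu_neq_ak.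
    by rewrite -!scalemxAr Zv !scalerA mulrC.
  by have [v Hv] := choice H; exists v.
have zz : 0 < ldot z z.
  apply: (pos z 0) => //; first by rewrite Zz mulmx0 scale0r.
  by rewrite eq_sym sqrf_eq0.
pose z' := (Num.sqrt (ldot z z))^-1 *: z.
pose w' := (2 / ldot u w) *: w.
have Zw' : Z *m w' = - ak *: w' by rewrite /w' -scalemxAr Zw !scalerA mulrC.
have Zz' : Z *m z' = 0 by rewrite /z' -scalemxAr Zz scaler0.
have uw' : ldot u w' = 2 by rewrite /w' ldotZr divfK.
exists (frame_mx a Z v z' u w').
  apply: frame_lorentz => //; try (by move=> j /Hv[]).
  exact: norm.
rewrite -(@frame_t' R k a size_a a_pos Z v z' u w')//; last by move=> j /Hv[].
rewrite mulmxK//; apply: lorentz_unit; apply: frame_lorentz => //; try (by move=> j /Hv[]).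
exact: norm.
Qed.

End ConjugatesOfCartan.

Section NullVectors.
Context (R : realType) (k : nat).
Notation m := (k.*2.+1).
Notation O := (@lorentz_group R m).
Notation ep := (ep R m).
Notation em := (em R m).
Variable a : seq R.
Hypothesis size_a : size a = k.+1.
Hypothesis a_decr : forall i j : nat, (i < j < k)%N -> a`_j < a`_i.
Hypothesis a_pos : forall i : nat, (i < k.+1)%N -> 0 < a`_i.
Implicit Types (x : 'cV[R]_m) (X Z g h : 'M[R]_(m + 2)).
Notation T := (t' m a).
Notation ak := (a`_k).
Notation mu := (mu k a).

Definition nodes : seq R := rcons [seq - a`_j ^+ 2 | j <- iota 0 k] 0.

Lemma mu_nodes (i : nat) : mu i \in nodes.
Proof.
rewrite /nodes mem_rcons inE /mu; case: ifP => ik; last by rewrite eqxx.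
by apply/orP; right; apply/mapP; exists i./2 => //; rewrite mem_iota; lia.
Qed.

Lemma size_nodes : size nodes = k.+1.
Proof. by rewrite size_rcons size_map size_iota. Qed.

Lemma nth_nodes i : (i < k)%N -> nodes`_i = - a`_i ^+ 2.
Proof.
by move=> ik; rewrite nth_rcons size_map size_iota ik (nth_map 0%N) ?size_iota// nth_iota.
Qed.

Lemma nth_nodes_last : nodes`_k = 0.
Proof. by rewrite nth_rcons size_map size_iota ltnn eqxx. Qed.

Lemma nodes_sorted : sorted <%R nodes.
Proof.
apply/(sortedP 0) => i; rewrite size_nodes ltnS => ik.
rewrite nth_nodes//; have [ik1|ik1] := ltnP i.+1 k.
  by rewrite nth_nodes// ltrN2 ltr_pXn2r ?nnegrE ?ltW ?a_decr ?a_pos ?ltnSn//; lia.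
have -> : i.+1 = k by lia.
by rewrite nth_nodes_last oppr_lt0 exprn_gt0// a_pos// ltnW.
Qed.

Lemma nodes_le0 : {in nodes, forall y, y <= 0}.
Proof.
move=> y; rewrite mem_rcons inE => /orP[/eqP->//|/mapP[j _ ->]].
by rewrite oppr_le0 sqr_ge0.
Qed.

Lemma nodes_uniq : uniq nodes.
Proof. exact: lt_sorted_uniq nodes_sorted. Qed.

(* The squared norm of the component of [x] in the [y]-eigenspace of
   [rot_blocks m a ^+ 2]. *)
Definition Wv x y : R := \sum_(i < m | mu i == y) x i 0 ^+ 2.

Lemma Wv_ge0 x y : 0 <= Wv x y.
Proof. by rewrite sumr_ge0// => i _; rewrite sqr_ge0. Qed.

Lemma sum_nodes (F : 'I_m -> R) :
  \sum_i F i = \sum_(y <- nodes) \sum_(i < m | mu i == y) F i.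
Proof. by apply: sum_by_value => [|i]; [exact: nodes_uniq|exact: mu_nodes]. Qed.

Lemma edot_Wv x : edot x x = \sum_(y <- nodes) Wv x y.
Proof. by rewrite edotE sum_nodes; apply: eq_bigr => y _; apply: eq_bigr. Qed.

(** Every eigenspace of the square contains exactly one even index, including [k.*2] for the kernel;
    that coordinate receives the whole length of the component. *)
Definition canon_coord x : 'cV[R]_m :=
  \col_i (if odd i then 0 else Num.sqrt (Wv x (mu i))).

Definition proj x y : 'cV[R]_m := \col_i (if mu i == y then x i 0 else 0).

Lemma proj_norm x y : edot (proj x y) (proj x y) = Wv x y.
Proof.
rewrite edotE /Wv [RHS]big_mkcond; apply: eq_bigr => i _.
by rewrite mxE; case: ifP; rewrite ?mulr0// expr2.
Qed.

Lemma proj_sq x y : T *m (T *m nvec (proj x y) 0 0) = y *: nvec (proj x y) 0 0.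
Proof.
rewrite t'_sq// nvecZ !mulr0; congr nvec; apply/colP => i; rewrite !mxE.
by case: eqP => [->//|]; rewrite !mulr0.
Qed.

Lemma mu_last : mu k.*2 = 0.
Proof. by rewrite /mu ltnn. Qed.

Lemma mu_eq0 (i : 'I_m) : mu i = 0 -> i = ord_max.
Proof.
rewrite -mu_last -[k.*2]/(val (@ord_max k.*2)) => /(mu_inj size_a a_decr a_pos)[] /=.
rewrite ltnn => ik _; apply: val_inj => /=; have := ltn_ord i.
by rewrite ltnS leq_eqVlt ik orbF => /eqP.
Qed.

Lemma proj0_ker x : T *m nvec (proj x 0) 0 0 = 0.
Proof.
rewrite t'_nvec// !mulr0 oppr0 -nvec0; congr nvec; apply/colP => i.
rewrite rot_mulE !mxE; case: ifP => // ik; case: eqP => [/mu_eq0 E|]; last by rewrite mulr0.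
by have := swp_lt ik; rewrite E /= ltnn.
Qed.

(* [h] rotates each eigenplane of [T^2] so that the component of the vector in
   it becomes a nonnegative multiple of the first coordinate vector. *)
Lemma t'_canonical x p q : p != 0 -> exists h, [/\ O h, T *m h = h *m T &
  nvec x p q = h *m nvec (canon_coord x) 1 (p * q)].
Proof.
move=> p0; have gT := t'_g size_a.
(* A unit vector along the component of [x], or a standard basis vector when that component
   vanishes, so that a full frame is always available. *)
pose e y (i : 'I_m) := if Wv x y == 0 then dvec R i
  else (Num.sqrt (Wv x y))^-1 *: nvec (proj x y) 0 0 : 'cV[R]_(m + 2).
have e1 y i : ldot (e y i) (e y i) = 1.
  rewrite /e; case: eqP => [_|/eqP W0]; first exact: dvec_ldot.
  rewrite ldotZl ldotZr mulrA -invfM -expr2 sqr_sqrtr ?Wv_ge0// ldot_nvec proj_norm.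
  by field.
have esq y (i : 'I_m) : mu i = y -> T *m (T *m e y i) = y *: e y i.
  move=> <-; rewrite /e; case: eqP => _; first exact: t'_dvec.
  by rewrite -!scalemxAr proj_sq !scalerA mulrC.
have eT : T *m e 0 ord_max = 0.
  rewrite /e; case: eqP => _; first exact: t'_dvec_last.
  by rewrite -scalemxAr proj0_ker scaler0.
have eE y (i : 'I_m) : Num.sqrt (Wv x y) *: e y i = nvec (proj x y) 0 0.
  rewrite /e; case: eqP => [W0|/eqP W0].
    rewrite W0 sqrtr0 scale0r; have -> : proj x y = 0; last by rewrite nvec0.
    by apply/eqP; rewrite -edot_eq0 proj_norm W0.
  by rewrite scalerA mulfV ?scale1r// sqrtr_eq0 -ltNge lt0r W0 Wv_ge0.
have im j : (j < k)%N -> (inord j.*2 : 'I_m) = j.*2 :> nat.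
  by move=> jk; rewrite inordK//; lia.
have muj j : (j < k)%N -> mu (inord j.*2 : 'I_m) = - a`_j ^+ 2.
  by move=> jk; rewrite im// /mu ltn_double jk doubleK.
pose v j := e (- a`_j ^+ 2) (inord j.*2).
have Tv j : (j < k)%N -> T *m (T *m v j) = - a`_j ^+ 2 *: v j.
  by move=> jk; apply/esq/muj.
have v1 j : (j < k)%N -> ldot (v j) (v j) = 1 by move=> _; exact: e1.
have Tu : T *m (p *: ep) = ak *: (p *: ep).
  by rewrite -scalemxAr t'_ep// !scalerA mulrC.
have Tw : T *m (p^-1 *: em) = - ak *: (p^-1 *: em).
  by rewrite -scalemxAr t'_em// !scalerA mulrC.
have uw : ldot (p *: ep) (p^-1 *: em) = 2.
  by rewrite ldotZl ldotZr ldot_pm mulrA mulfV// mul1r.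
exists (frame_mx a T v (e 0 ord_max) (p *: ep) (p^-1 *: em)); split.
- exact: frame_lorentz.
- exact: frame_t'.
rewrite frame_mxE scale1r nvec_sum scalerA mulrAC mulfV// mul1r; congr (_ + _ + _).
(* Restricting to even indices counts each eigenspace once. *)
transitivity (\sum_(i < m) if odd i then 0 else nvec (proj x (mu i)) 0 0 : 'cV[R]_(m + 2)).
  have big_nvec (G : 'I_m -> 'cV[R]_m) :
      \sum_i nvec (G i) 0 0 = nvec (\sum_i G i) 0 0 :> 'cV[R]_(m + 2).
    apply: (big_ind2 (fun s t => s = nvec t 0 0)) => [|s t s' t' -> ->|//].
      by rewrite nvec0.
    by rewrite nvecD !addr0.
  have E (i : 'I_m) : (if odd i then 0 else nvec (proj x (mu i)) 0 0) =
      nvec (if odd i then 0 else proj x (mu i)) 0 0 :> 'cV[R]_(m + 2).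
    by case: ifP; rewrite ?nvec0.
  under eq_bigr do rewrite E.
  rewrite big_nvec; congr nvec; apply/colP => r; rewrite summxE.
  pose i0 : 'I_m := if odd r then inord r.-1 else r.
  have r2 := ltn_ord r.
  have i0E : i0 = (if odd r then r.-1 else r) :> nat.
    by rewrite /i0; case: ifP => // oo; rewrite inordK//; lia.
  have oi0 : odd i0 = false by rewrite i0E; case: ifP; lia.
  have mi0 : mu i0 = mu r.
    rewrite /mu i0E; case: (boolP (odd r)) => oo //.
    have -> : (r.-1 < k.*2)%N = (r < k.*2)%N by lia.
    by have -> : r.-1./2 = r./2 by lia.
  rewrite (bigD1 i0)//= oi0 mxE mi0 eqxx big1 ?addr0// => i ii0.
  case: (boolP (odd i)) => oi; rewrite mxE//; case: eqP => // mm.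
  have [ik ih] := mu_inj size_a a_decr a_pos mm.
  case/eqP: ii0; apply: val_inj; rewrite /= i0E.
  have := ltn_ord i; have [ik'|ik'] := ltnP i k.*2.
    by move: (ih (etrans ik ik')); case: ifP; lia.
  by move: ik; case: ifP; lia.
apply: eq_bigr => i _; rewrite mxE /frame_vec; case: ifP => oi; first by rewrite scale0r.
case: ifP => ik.
  have ii : inord (i./2).*2 = i.
    by apply: val_inj; rewrite /= inordK; have := ltn_ord i; lia.
  have -> : mu i = - a`_(i./2) ^+ 2 by rewrite /mu ik.
  by rewrite -(eE _ (inord (i./2).*2)).
have -> : mu i = 0 by rewrite /mu ik.
by rewrite -(eE _ ord_max).
Qed.

End NullVectors.

(** * Singular values of depth one orbits *)

Section ResolventIdentity.
Context (R : realType) (k : nat).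
Notation m := (k.*2.+1).
Notation O := (@lorentz_group R m).
Notation ep := (ep R m).
Notation em := (em R m).
Variable a : seq R.
Hypothesis size_a : size a = k.+1.
Hypothesis a_decr : forall i j : nat, (i < j < k)%N -> a`_j < a`_i.
Hypothesis a_pos : forall i : nat, (i < k.+1)%N -> 0 < a`_i.
Implicit Types (x : 'cV[R]_m) (X Z g h : 'M[R]_(m + 2)) (Y : 'M[R]_m).
Implicit Types (b al : 'rV[R]_m) (t : R).
Notation T := (t' m a).
Notation ak := (a`_k).
Notation mu := (mu k a).
Notation nodes := (nodes k a).

Lemma prod_nodes s :
  \prod_(y <- nodes) (s - y) = \prod_(j < k) (s + a`_j ^+ 2) * s.
Proof.
rewrite /nodes -cats1 big_cat big_seq1 subr0 big_map /=; congr (_ * _).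
by rewrite -[X in iota 0 X]subn0 -/(index_iota 0 k) big_mkord; apply: eq_bigr => j _; rewrite opprK.
Qed.

(* For a null vector [nvec x p q] one has [4 p q = - edot x x], which turns its
   resolvent coefficient [ldot ((s - T^2)^-1 v) v] into
   [\sum_y Wv x y (1 / (s - y) - 1 / (s - ak ^+ 2))]; the factor [ak ^+ 2 - y]
   is the numerator of that difference, up to sign. *)
Definition wnodes x : seq (R * R) := [seq (y, Wv a x y * (ak ^+ 2 - y)) | y <- nodes].

Lemma wnodes1 x : [seq p.1 | p <- wnodes x] = nodes.
Proof. by rewrite -map_comp map_id. Qed.

Lemma wnodes_horner x t : t != 0 -> (nodepoly (wnodes x)).[t ^+ 2] =
  \prod_(y <- nodes) (t ^+ 2 - y) *
  \sum_(y <- nodes) Wv a x y * (ak ^+ 2 - y) / (t ^+ 2 - y).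
Proof.
move=> t0; rewrite nodepoly_horner; last first.
  move=> _ /mapP[y yn ->] /=; rewrite gt_eqF//.
  apply: le_lt_trans (nodes_le0 yn) _.
  by rewrite exprn_even_gt0//= orbC t0.
by rewrite !big_map.
Qed.

Lemma resolvent_identity g X Y b al x p q t :
  O g -> X = g *m T *m invmx g -> Y \in so_m R m -> Y *m b^T = 0 ->
  X = gmx Y 0 b al -> g *m nvec x p q = ep -> t != 0 -> t ^+ 2 != ak ^+ 2 ->
  4 * edot b^T b^T * \det (resm Y t) = t * (nodepoly (wnodes x)).[t ^+ 2].
Proof.
move=> Og XT sY Yb XZ gx t0 tak.
have gT : T \in g_alg R m := t'_g size_a.
have gX : X \in g_alg R m by rewrite XT; exact: g_conj.
have s0 : 0 < t ^+ 2 by rewrite exprn_even_gt0//= orbC t0.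
have nod y : y \in nodes -> t ^+ 2 - y != 0.
  by move=> yn; rewrite subr_eq0 gt_eqF// (le_lt_trans (nodes_le0 yn)).
have tA : t ^+ 2 - ak ^+ 2 != 0 by rewrite subr_eq0.
(* The solution of $(t^2-T^2)y_0=v$, explicit because $T^2$ is diagonal in null coordinates. *)
pose y0 := nvec (\col_i (x i 0 / (t ^+ 2 - mu i))) (p / (t ^+ 2 - ak ^+ 2))
  (q / (t ^+ 2 - ak ^+ 2)) : 'cV[R]_(m + 2).
have Ey0 : t ^+ 2 *: y0 - T *m (T *m y0) = nvec x p q.
  rewrite /y0 t'_sq// nvecZ nvecB; congr nvec.
  - by apply/colP => i; rewrite !mxE; field; apply: nod; exact: mu_nodes.
  - by field.
  - by field.
have Xg v : X *m (g *m v) = g *m (T *m v).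
  by rewrite XT !mulmxA mulmxKV ?lorentz_unit.
have Ew : t ^+ 2 *: (g *m y0) - X *m (X *m (g *m y0)) = ep.
  by rewrite !Xg scalemxAr -mulmxBr Ey0.
have [W1 W2] := g_resolvent_sq gX Ew.
rewrite XZ in W1; have := det_resolvent_ep sY Yb t0 W1.
rewrite -XZ W2 -[in ldot _ ep]gx lorentz_ldot// ldot_nvec.
have -> : \det (t%:M - X) = \det (t%:M - T).
  have -> : t%:M - X = g *m (t%:M - T) *m invmx g.
    rewrite mulmxBr mulmxBl -XT mul_mx_scalar -scalemxAl lorentz_mulV//.
    by rewrite scalemx1.
  rewrite !det_mulmx det_inv mulrAC divff ?mul1r//.
  by rewrite -unitfE -unitmxE lorentz_unit.
rewrite (det_t' size_a) wnodes_horner// prod_nodes.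
have -> : edot (\col_i (x i 0 / (t ^+ 2 - mu i))) x =
    \sum_(y <- nodes) Wv a x y / (t ^+ 2 - y).
  rewrite edotE (sum_nodes size_a a_decr a_pos); apply: eq_bigr => y _.
  rewrite /Wv mulr_suml; apply: eq_bigr => i /eqP <-.
  by rewrite mxE expr2 mulrAC.
have pq : 4 * (p * q) = - \sum_(y <- nodes) Wv a x y.
  have := lorentz_ldot (nvec x p q) (nvec x p q) Og.
  rewrite gx ldot_pp ldot_nvec (edot_Wv size_a a_decr a_pos) => E.
  by apply/eqP; rewrite -subr_eq0 opprK; apply/eqP; rewrite [RHS]E; ring.
have -> : 2 * (p / (t ^+ 2 - ak ^+ 2) * q + q / (t ^+ 2 - ak ^+ 2) * p) =
  - (\sum_(y <- nodes) Wv a x y) / (t ^+ 2 - ak ^+ 2).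
  by rewrite -pq; field.
move=> E.
have -> : 4 * edot b^T b^T * \det (resm Y t) = - (- 4 * edot b^T b^T * \det (resm Y t)).
  by ring.
rewrite -E.
have SE : (t ^+ 2 - ak ^+ 2) * (\sum_(y <- nodes) Wv a x y / (t ^+ 2 - y) +
    - (\sum_(y <- nodes) Wv a x y) / (t ^+ 2 - ak ^+ 2)) =
    - \sum_(y <- nodes) Wv a x y * (ak ^+ 2 - y) / (t ^+ 2 - y).
  rewrite mulrDr mulrCA mulfV// mulr1 mulr_sumr -sumrB -sumrN.
  by rewrite big_seq [RHS]big_seq; apply: eq_bigr => y /nod yn; field.
move: SE; set S1 := \sum_(y <- nodes) _ / _; set S2 := \sum_(y <- nodes) _ => SE.
set S3 := \sum_(y <- nodes) _ in SE *; set P := \prod_(j < k) _.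
rewrite [LHS](_ : _ = - (t * P * t ^+ 2 * ((t ^+ 2 - ak ^+ 2) *
  (S1 + - S2 / (t ^+ 2 - ak ^+ 2))))); last by ring.
by rewrite SE; ring.
Qed.

Lemma nodepoly_linear (ns : seq R) (f g : R -> R) :
  nodepoly [seq (y, f y) | y <- ns] - nodepoly [seq (y, g y) | y <- ns] =
  nodepoly [seq (y, f y - g y) | y <- ns].
Proof.
elim: ns => [|y ns IH] /=; first by rewrite subrr.
have E (h : R -> R) : \prod_(q <- [seq (z, h z) | z <- ns]) ('X - (q.1)%:P) =
  \prod_(z <- ns) ('X - z%:P) by rewrite big_map.
by rewrite !E -IH opprD addrACA -scalerBl mulrBr.
Qed.

(** The left side of [resolvent_identity] involves [Y] and [b] but not [al], so the two numerators
    coincide; distinct nodes then separate the weights, and the null condition gives the product of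
    the null coordinates. *)
Lemma Wv_inj g g' X X' Y b al al' x p q x' p' q' :
  O g -> X = g *m T *m invmx g -> O g' -> X' = g' *m T *m invmx g' ->
  Y \in so_m R m -> Y *m b^T = 0 -> X = gmx Y 0 b al -> X' = gmx Y 0 b al' ->
  g *m nvec x p q = ep -> g' *m nvec x' p' q' = ep ->
  (forall y, y \in nodes -> Wv a x y = Wv a x' y) /\ p * q = p' * q'.
Proof.
move=> Og XT Og' XT' sY Yb XZ XZ' gx gx'.
have PP : nodepoly (wnodes x) = nodepoly (wnodes x').
  (* Squares of points beyond [ak], which avoids the excluded values [t = 0] and
     [t ^+ 2 = ak ^+ 2]. *)
  apply: (@poly_eq_seq R (fun i => (i%:R + ak + 1) ^+ 2)).
    have ak0 : 0 < ak by exact: a_pos.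
    move=> i j /eqP; rewrite eqrXn2 ?addr_ge0 ?ler0n ?ltW// => /eqP /addIr /addIr /eqP.
    by rewrite eqr_nat => /eqP.
  move=> i; set t := _ + 1; have ak0 : 0 < ak by exact: a_pos.
  have t_ak : ak < t by rewrite /t; have := ler0n R i; lra.
  have t0 : t != 0 by rewrite gt_eqF// (lt_trans ak0).
  have tak : t ^+ 2 != ak ^+ 2.
    by rewrite gt_eqF// ltr_pXn2r ?nnegrE ?ltW// (lt_trans ak0).
  apply: (mulfI t0).
  rewrite -(resolvent_identity Og XT sY Yb XZ gx)//.
  by rewrite -(resolvent_identity Og' XT' sY Yb XZ' gx').
have WE : forall y, y \in nodes -> Wv a x y = Wv a x' y.
  have := subrr (nodepoly (wnodes x)); rewrite {2}PP nodepoly_linear.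
  move=> /nodepoly_eq0 H y yn.
  have /= := H _ (y, Wv a x y * (ak ^+ 2 - y) - Wv a x' y * (ak ^+ 2 - y)).
  rewrite -map_comp map_id => /(_ (nodes_uniq size_a a_decr a_pos)).
  move=> /(_ (map_f (fun y => (y, Wv a x y * (ak ^+ 2 - y) - Wv a x' y * (ak ^+ 2 - y))) yn)).
  move=> /eqP; rewrite -mulrBl mulf_eq0 => /orP[|/eqP H2].
    by rewrite subr_eq0 => /eqP.
  have : 0 < ak ^+ 2 - y.
    rewrite subr_gt0 (le_lt_trans (nodes_le0 yn))// exprn_gt0//; exact: a_pos.
  by rewrite H2 ltxx.
split=> //.
have pqE g1 x1 p1 q1 : O g1 -> g1 *m nvec x1 p1 q1 = ep ->
    4 * (p1 * q1) = - \sum_(y <- nodes) Wv a x1 y.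
  move=> O1 gx1; have := lorentz_ldot (nvec x1 p1 q1) (nvec x1 p1 q1) O1.
  rewrite gx1 ldot_pp ldot_nvec (edot_Wv size_a a_decr a_pos) => E.
  by apply/eqP; rewrite -subr_eq0 opprK; apply/eqP; rewrite [RHS]E; ring.
have : 4 * (p * q) = 4 * (p' * q').
  rewrite (pqE _ _ _ _ Og gx) (pqE _ _ _ _ Og' gx'); congr (- _).
  by rewrite big_seq [RHS]big_seq; apply: eq_bigr => y /WE.
by move=> /mulfI -> //; rewrite pnatr_eq0.
Qed.

End ResolventIdentity.

Section SingularValues.
Context (R : realType) (k : nat).
Notation m := (k.*2.+1).
Notation O := (@lorentz_group R m).
Notation ep := (ep R m).
Notation em := (em R m).
Variable a : seq R.
Implicit Types (x : 'cV[R]_m) (X Z g h : 'M[R]_(m + 2)) (Y : 'M[R]_m).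
Implicit Types (b al : 'rV[R]_m) (xs : seq R).
Notation T := (t' m a).
Notation ak := (a`_k).
Notation mu := (mu k a).
Notation nodes := (nodes k a).

(** The characteristic polynomial of a skew matrix of odd size whose singular values are
    [doubled xs]; see [singular_valuesP]. *)
Definition psi xs : {poly R} := 'X * \prod_(t <- xs) ('X^2 + (t ^+ 2)%:P).

Lemma psi_horner xs s : (psi xs).[s] = s * \prod_(t <- xs) (s ^+ 2 + t ^+ 2).
Proof.
rewrite /psi hornerM hornerX horner_prod; congr (_ * _).
by apply: eq_bigr => t _; rewrite !hornerE.
Qed.

Lemma psi_monic xs : psi xs \is monic.
Proof.
rewrite /psi monicMl ?monicX//; apply: monic_prod => t _.
rewrite monicE lead_coefDl ?lead_coefXn// size_polyXn.
exact: leq_ltn_trans (size_polyC_leq1 _) _.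
Qed.

Definition doubled xs : seq R := rcons (flatten [seq [:: t; t] | t <- xs]) 0.

Lemma doubled_horner xs s : (\prod_(t <- doubled xs) ('X - (t ^+ 2)%:P)).[s] =
  s * \prod_(t <- xs) (s - t ^+ 2) ^+ 2.
Proof.
rewrite horner_prod /doubled -cats1 big_cat big_seq1 /= expr0n subr0 hornerX mulrC.
congr (_ * _); rewrite big_flatten /= big_map; apply: eq_bigr => t _.
by rewrite !big_cons big_nil mulr1 !hornerE expr2.
Qed.

(** $Y^tY=-Y^2$, and the sign on the right is $(-1)^m$ with $m$ odd. *)
Lemma gram_horner Y t : Y \in so_m R m ->
  (char_poly (Y^T *m Y)).[- (t ^+ 2)] = - (char_poly Y).[t] ^+ 2.
Proof.
move=> sY; rewrite !char_poly_horner -det_skew_sq// so_m_tr// mulNmx opprK.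
have -> : (- (t ^+ 2))%:M + Y *m Y = -1 *: ((t ^+ 2)%:M - Y *m Y).
  by rewrite scaleN1r opprB addrC raddfN.
by rewrite detZ -signr_odd /= odd_double expr1 mulN1r.
Qed.

Lemma doubled_psi xs t :
  (\prod_(t <- doubled xs) ('X - (t ^+ 2)%:P)).[- (t ^+ 2)] = - (psi xs).[t] ^+ 2.
Proof.
rewrite doubled_horner psi_horner exprMn mulNr -prodrXl; congr (- (_ * _)).
by apply: eq_bigr => x _; rewrite -opprD sqrrN.
Qed.

Lemma singular_valuesP Y xs : Y \in so_m R m ->
  singular_values Y (doubled xs) <-> all (>= 0) xs /\ char_poly Y = psi xs.
Proof.
move=> sY; have allE : all (fun t => 0 <= t) (doubled xs) = all (>= 0) xs.
  rewrite /doubled all_rcons lexx /=; elim: xs => //= t xs ->.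
  by rewrite andbA andbb.
rewrite /singular_values allE; split=> -[xs0 H]; split=> //.
  apply: monic_sqr_inj; [exact: char_poly_monic|exact: psi_monic|].
  apply: (@poly_eq_large _ 0) => t _; apply: oppr_inj.
  by rewrite !horner_exp -gram_horner// -doubled_psi H.
apply: (@poly_eq_seq R (fun i => - (i%:R ^+ 2))).
  move=> i j /oppr_inj /eqP; rewrite eqrXn2 ?ler0n// => /eqP /eqP.
  by rewrite eqr_nat => /eqP.
by move=> i; rewrite gram_horner// H doubled_psi.
Qed.

Hypothesis size_a : size a = k.+1.
Hypothesis a_decr : forall i j : nat, (i < j < k)%N -> a`_j < a`_i.
Hypothesis a_pos : forall i : nat, (i < k.+1)%N -> 0 < a`_i.

Lemma sqrtr_sqr_id (r : R) : 0 <= r -> Num.sqrt (r ^+ 2) = r.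
Proof. by move=> r0; rewrite sqrtr_sqr ger0_norm. Qed.

Lemma char_poly_resm Y t : (char_poly Y).[t] = \det (resm Y t).
Proof. exact: char_poly_horner. Qed.

Lemma interlacing g X Y b al : O g -> X = g *m T *m invmx g ->
  Y \in so_m R m -> Y *m b^T = 0 -> b != 0 -> X = gmx Y 0 b al ->
  exists xs : k.-tuple R,
    [/\ sorted >=%R xs, interlaced k a xs & char_poly Y = psi xs].
Proof.
move=> Og XT sY Yb b0 XZ.
have ak0 : 0 < ak by exact: a_pos.
have bT0 : b^T != 0.
  by apply: contra b0 => /eqP bT; rewrite -(trmxK b) bT trmx0.
have b2 : edot b^T b^T != 0 by rewrite edot_eq0.
have [x [p [q gx']]] := nvecP (invmx g *m ep).
have gx : g *m nvec x p q = ep by rewrite -gx' mulmxA lorentz_mulV// mul1mx.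
have RI t : ak < t -> 4 * edot b^T b^T * (char_poly Y).[t] =
    t * (nodepoly (wnodes a x)).[t ^+ 2].
  move=> t_ak; rewrite char_poly_resm.
  apply: (resolvent_identity size_a a_decr a_pos Og XT sY Yb XZ gx).
    by rewrite gt_eqF// (lt_trans ak0).
  by rewrite gt_eqF// ltr_pXn2r ?nnegrE ?ltW// (lt_trans ak0).
have wpos : {in wnodes a x, forall p, 0 <= p.2}.
  move=> _ /mapP[y yn ->] /=; rewrite mulr_ge0 ?Wv_ge0// subr_ge0.
  by rewrite (le_trans (nodes_le0 yn))// sqr_ge0.
have ws : sorted <%R [seq p.1 | p <- wnodes a x].
  by rewrite wnodes1; exact: nodes_sorted.
(* If all weights vanished, the resolvent identity at [ak + 1] would make [t - Y] singular. *)
have w0 : 0 < weight (wnodes a x).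
  have w_ge0 : 0 <= weight (wnodes a x).
    by rewrite /weight big_seq sumr_ge0// => p' /wpos.
  rewrite lt0r w_ge0 andbT; apply/negP.
  rewrite /weight big_seq psumr_eq0; last exact: wpos.
  move=> /allP W0; have tk : ak < ak + 1 by rewrite ltrDl.
  have tn : ak + 1 != 0 by rewrite gt_eqF// (lt_trans ak0).
  have := RI _ tk; rewrite wnodes_horner// [X in _ * (_ * X)]big1_seq ?mulr0; last first.
    move=> y /andP[_ yn].
    have yw : (y, Wv a x y * (ak ^+ 2 - y)) \in wnodes a x.
      exact: (map_f (fun y => (y, Wv a x y * (ak ^+ 2 - y)))).
    by have := W0 _ yw; rewrite yw /= => /eqP ->; rewrite mul0r.
  move=> /eqP; rewrite !mulf_eq0 pnatr_eq0 (negbTE b2) /= char_poly_resm.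
  by apply/negP; rewrite -unitfE -unitmxE; exact: resm_unit.
have [xi I E] := nodepoly_roots ws wpos w0.
rewrite wnodes1 in I.
have sxi : size xi = k.
  by have := interl_size I; rewrite size_nodes => -[].
have xi_le0 i : (i < k)%N -> xi`_i <= 0.
  move=> ik; have := interl_nth I; rewrite sxi => /(_ _ ik) /andP[_ xin].
  by apply: le_trans xin _; apply: nodes_le0; apply: mem_nth; rewrite size_nodes.
pose xs := [seq Num.sqrt (- z) | z <- xi].
have sxs : size xs == k by rewrite size_map sxi.
have xsE i : (i < k)%N -> xs`_i = Num.sqrt (- xi`_i).
  by move=> ik; rewrite (nth_map 0) ?sxi.
have le1 i : (i < k)%N -> xs`_i <= a`_i.
  move=> ik; rewrite xsE//; have := interl_nth I; rewrite sxi => /(_ _ ik) /andP[+ _].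
  have ai : 0 <= a`_i by apply/ltW/a_pos; exact: ltnW.
  by rewrite nth_nodes// => H; rewrite -[leRHS]sqrtr_sqr_id// ler_wsqrtr// lerNl.
have le2 i : (i.+1 < k)%N -> a`_i.+1 <= xs`_i.
  move=> ik; rewrite xsE; last exact: ltnW.
  have := interl_nth I; rewrite sxi => /(_ i (ltnW ik)) /andP[_ +].
  have ai : 0 <= a`_i.+1 by apply/ltW/a_pos; exact: ltnW.
  by rewrite nth_nodes// => H; rewrite -[leLHS]sqrtr_sqr_id// ler_wsqrtr// lerNr.
exists (Tuple sxs); split.
- apply/(sortedP 0) => i; rewrite (eqP sxs) => ik.
  exact: le_trans (le1 _ ik) (le2 _ ik).
- by split=> //= i ik; rewrite xsE// sqrtr_ge0.
(* Both polynomials are monic, so comparing leading coefficients identifies the total weight with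
   $4|b|^2$. *)
- have CE : (4 * edot b^T b^T) *: char_poly Y = weight (wnodes a x) *: psi xs.
    apply: (@poly_eq_large R ak) => t t_ak.
    rewrite !hornerZ RI// E hornerZ horner_prod psi_horner mulrCA; congr (_ * (_ * _)).
    rewrite big_map big_seq [RHS]big_seq; apply: eq_bigr => z zxi.
    rewrite hornerXsubC sqr_sqrtr// oppr_ge0.
    by move: zxi => /(nthP 0)[i]; rewrite sxi => /xi_le0 zi <-.
  have c0 : 4 * edot b^T b^T != 0 by rewrite mulf_neq0.
  have := congr1 lead_coef CE; rewrite !lead_coefZ.
  rewrite (monicP (char_poly_monic _)) (monicP (psi_monic _)) !mulr1 => ce.
  by apply: (scalerI c0); rewrite CE ce.
Qed.
End SingularValues.

(** * Realization of interlaced singular values *)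

Lemma interl_of_nth (R : rcfType) (N xi : seq R) : size N = (size xi).+1 ->
  (forall i, (i < size xi)%N -> N`_i <= xi`_i <= N`_i.+1) -> interl N xi.
Proof.
elim: N xi => [|y0 N IH] [|x xi] //=; first by case: N {IH}.
case: N IH => [|y1 N] IH //= [sN] H.
have /= /andP[-> ->] := H 0%N isT.
by apply: IH => [|i ik]; [rewrite /= sN|exact: (H i.+1)].
Qed.

Lemma uniq_map_inj (S T : eqType) (f : S -> T) (s : seq S) :
  uniq [seq f x | x <- s] -> {in s &, injective f}.
Proof.
elim: s => //= z s IH /andP[zs us] x y.
rewrite !inE => /orP[/eqP->|xs] /orP[/eqP->|ys] // E.
- by case/negP: zs; rewrite E; exact: map_f.
- by case/negP: zs; rewrite -E; exact: map_f.
- exact: IH.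
Qed.

Section Realization.
Context (R : realType) (k : nat).
Notation m := (k.*2.+1).
Notation O := (@lorentz_group R m).
Implicit Types (x v : 'cV[R]_m) (Y : 'M[R]_m).
Implicit Types (b al : 'rV[R]_m) (xs : seq R).

Lemma normalize x : x != 0 ->
  edot ((Num.sqrt (edot x x))^-1 *: x) ((Num.sqrt (edot x x))^-1 *: x) = 1.
Proof.
move=> x0; rewrite edotZl edotZr mulrA -invfM -expr2 sqr_sqrtr ?edot_ge0//.
by rewrite mulVf// edot_eq0.
Qed.

Lemma char_poly_skew_sq Y xs : Y \in so_m R m -> char_poly Y = psi xs ->
  char_poly (Y *m Y) = 'X * \prod_(t <- xs) ('X + (t ^+ 2)%:P) ^+ 2.
Proof.
move=> sY cY; apply: (@poly_eq_seq R (fun i => i%:R ^+ 2)).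
  move=> i j /eqP; rewrite eqrXn2 ?ler0n// => /eqP /eqP.
  by rewrite eqr_nat => /eqP.
move=> i; rewrite char_poly_horner det_skew_sq// -char_poly_horner cY psi_horner.
rewrite exprMn hornerM hornerX horner_prod -prodrXl; congr (_ * _).
by apply: eq_bigr => t _; rewrite !hornerE.
Qed.

Lemma skew_eigenvector Y b xs t : Y \in so_m R m -> Y *m b^T = 0 -> b != 0 ->
  char_poly Y = psi xs -> t \in xs -> exists v,
  [/\ Y *m (Y *m v) = - t ^+ 2 *: v, edot v v = 1 & edot b^T v = 0].
Proof.
move=> sY Yb b0 cY txs.
have YY := char_poly_skew_sq sY cY.
have bYY v : edot b^T (Y *m v) = 0.
  by rewrite -[LHS]opprK -skew_edot// Yb edot0l oppr0.
suff [v [v0 Ev bv]] : exists v, [/\ v != 0, Y *m (Y *m v) = - t ^+ 2 *: v &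
    edot b^T v = 0].
  exists ((Num.sqrt (edot v v))^-1 *: v); split; last by rewrite edotZr bv mulr0.
    by rewrite -!scalemxAr Ev !scalerA mulrC.
  exact: normalize.
(* For nonzero [t], orthogonality to [b] follows from [Y *m b^T = 0]; for [t = 0] the vector [b]
   itself is in the kernel and has to be avoided. *)
have [t0|t0] := eqVneq t 0; last first.
  have [|v Ev v0] := (@root_char_polyP _ _ (Y *m Y) (- t ^+ 2)).1.
    apply/rootP; rewrite YY hornerM horner_prod (big_rem t)//=.
    by rewrite horner_exp hornerD hornerX hornerC addNr expr0n mul0r mulr0.
  rewrite -mulmxA in Ev; exists v; split=> //.
  have := bYY (Y *m v); rewrite Ev edotZr => /eqP.
  by rewrite mulf_eq0 oppr_eq0 sqrf_eq0 (negbTE t0) /= => /eqP.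
(* A kernel vector of [Y] orthogonal to [b]: subtracting [b^T *m b] moves the
   eigenvalue of [Y *m Y] on [b^T] from [0] to [- |b|^2], so that a zero of the
   characteristic polynomial that remains comes from another vector. *)
pose M := Y *m Y - b^T *m b.
have bb : b *m b^T = (edot b^T b^T)%:M by rewrite -edot_mx trmxK.
have cM : char_poly M = \prod_(t <- xs) ('X + (t ^+ 2)%:P) ^+ 2 *
    ('X + (edot b^T b^T)%:P).
  apply: (@poly_eq_large R 0) => s s0.
  have sn : s != 0 by rewrite gt_eqF.
  have E : s%:M - M = (s%:M - Y *m Y) *m (1%:M - (- s^-1 *: b^T) *m b).
    rewrite mulmxBr mulmx1 mulmxA; have -> : (s%:M - Y *m Y) *m (- s^-1 *: b^T) = - b^T.
      rewrite mulmxBl mul_scalar_mx scalerA mulrN mulfV// scaleN1r.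
      by rewrite -scalemxAr -mulmxA Yb mulmx0 scaler0 subr0.
    by rewrite mulNmx opprK /M opprB addrA addrAC.
  rewrite char_poly_horner E det_mulmx det_sylvester -scalemxAr bb det_mx11.
  rewrite -char_poly_horner YY !hornerM !hornerE !horner_prod.
  rewrite [_ 0 0](_ : _ = 1 + s^-1 * edot b^T b^T); last first.
    by rewrite !mxE !eqxx !mulr1n mulNr opprK.
  have -> : \prod_(t <- xs) (('X + (t ^+ 2)%:P) ^+ 2).[s] =
    \prod_(t <- xs) (s + t ^+ 2) ^+ 2 by apply: eq_bigr => r _; rewrite !hornerE.
  by field.
have [|v Ev v0] := (@root_char_polyP _ _ M 0).1.
  apply/rootP; rewrite cM hornerM horner_prod (big_rem t)//=.
  by rewrite horner_exp hornerD hornerX hornerC t0 expr0n addr0 expr0n !mul0r.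
have Ev' : Y *m (Y *m v) = edot b^T v *: b^T.
  move: Ev; rewrite scale0r /M mulmxBl -!mulmxA => /eqP; rewrite subr_eq0 => /eqP ->.
  have -> : b *m v = (edot b^T v)%:M by rewrite -edot_mx trmxK.
  by rewrite mul_mx_scalar.
have H : edot (Y *m v) (Y *m v) + edot b^T v ^+ 2 = 0.
  have := congr1 (edot v) Ev'; rewrite edotZr (edotC v b^T) -expr2 => <-.
  by rewrite skew_edot// addNr.
move: H => /eqP; rewrite paddr_eq0 ?edot_ge0 ?sqr_ge0// edot_eq0 sqrf_eq0.
move=> /andP[/eqP Yv /eqP bv]; exists v; split=> //.
by rewrite Yv mulmx0 t0 expr0n /= oppr0 scale0r.
Qed.

Variable a : seq R.
Hypothesis size_a : size a = k.+1.
Hypothesis a_decr : forall i j : nat, (i < j < k)%N -> a`_j < a`_i.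
Hypothesis a_pos : forall i : nat, (i < k.+1)%N -> 0 < a`_i.
Notation T := (t' m a).
Notation ak := (a`_k).

(* Dividing the characteristic polynomial of t' by that of [Y] leaves nonnegative
   residues, the interlacing being read with the extra node [ak ^+ 2 > 0]. *)
Lemma chi_fractions xs : size xs = k -> interlaced k a xs ->
  exists c D, [/\ uniq [seq p.1 | p <- D],
    {in D, forall p, exists2 t, t \in xs & p.1 = - t ^+ 2},
    {in D, forall p : R * R, 0 <= p.2} &
    forall t, 0 < t -> (chi k a).[t] = (psi xs).[t] *
      (t ^+ 2 - c - \sum_(p <- D) p.2 / (t ^+ 2 - p.1))].
Proof.
move=> sxs [xa ax x0].
pose N := rcons [seq - a`_j ^+ 2 | j <- iota 0 k] (ak ^+ 2).
pose xi := [seq - t ^+ 2 | t <- xs].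
have a0 i : (i < k.+1)%N -> 0 <= a`_i by move=> ik; apply/ltW/a_pos.
have sN : size N = k.+1 by rewrite size_rcons size_map size_iota.
have Nk i : (i < k)%N -> N`_i = - a`_i ^+ 2.
  by move=> ik; rewrite nth_rcons size_map size_iota ik (nth_map 0%N) ?size_iota// nth_iota.
have Nl : N`_k = ak ^+ 2 by rewrite nth_rcons size_map size_iota ltnn eqxx.
have sortN : sorted <%R N.
  apply/(sortedP 0) => i; rewrite sN ltnS => ik; rewrite Nk//.
  have [ik1|ik1] := ltnP i.+1 k.
    by rewrite Nk// ltrN2 ltr_pXn2r ?nnegrE ?a0 ?a_decr ?ltnSn//; lia.
  have -> : i.+1 = k by lia.
  rewrite Nl; apply: (@lt_trans _ _ 0); last by rewrite exprn_gt0// a_pos.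
  by rewrite oppr_lt0 exprn_gt0// a_pos// ltnW.
have I : interl N xi.
  apply: interl_of_nth; first by rewrite sN size_map sxs.
  move=> i; rewrite size_map sxs => ik.
  have ai := a0 _ (ltnW ik); have xi0 := x0 _ ik.
  rewrite (nth_map 0) ?sxs// Nk// lerN2 ler_pXn2r ?nnegrE// xa//=.
  have [ik1|ik1] := ltnP i.+1 k.
    by rewrite Nk// lerN2 ler_pXn2r ?nnegrE ?ax// a0// ltnW.
  have -> : i.+1 = k by lia.
  by rewrite Nl (@le_trans _ _ 0) ?sqr_ge0// oppr_le0 sqr_ge0.
have [c [D [uD sD wD E]]] := partial_fractions sortN I.
exists c, D; split=> //.
  by move=> p /(map_f (fun p => p.1)) /sD /mapP[t txs ->]; exists t.
move=> t t0; have tn : t ^+ 2 \notin xi.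
  apply/negP => /mapP[s _ E1]; have : 0 < t ^+ 2 by rewrite exprn_gt0.
  by rewrite E1 oppr_gt0 ltNge sqr_ge0.
have := E _ tn; rewrite chi_horner psi_horner -mulrA.
have -> : \prod_(y <- N) (t ^+ 2 - y) =
    \prod_(j < k) (t ^+ 2 + a`_j ^+ 2) * (t ^+ 2 - ak ^+ 2).
  rewrite /N -cats1 big_cat big_seq1 big_map /=; congr (_ * _).
  rewrite -[X in iota 0 X]subn0 -/(index_iota 0 k) big_mkord.
  by apply: eq_bigr => j _; rewrite opprK.
move=> ->; rewrite big_map -mulrA; congr (_ * (_ * _)).
by apply: eq_bigr => s _; rewrite opprK.
Qed.

Lemma orthonormal_sum (e : R -> 'cV[R]_m) (D : seq (R * R)) (f g : R * R -> R) :
  uniq [seq p.1 | p <- D] ->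
  {in D, forall p, edot (e p.1) (e p.1) = 1} ->
  {in D &, forall p q, p.1 != q.1 -> edot (e p.1) (e q.1) = 0} ->
  edot (\sum_(p <- D) f p *: e p.1) (\sum_(p <- D) g p *: e p.1) =
  \sum_(p <- D) f p * g p.
Proof.
move=> uD e1 e0; rewrite edot_suml big_seq [RHS]big_seq; apply: eq_bigr => p pD.
rewrite edotZl edot_sumr (bigD1_seq p)//=; last exact: map_uniq uD.
rewrite edotZr e1// mulr1 big_seq_cond big1 ?addr0// => q /andP[qD qp].
rewrite edotZr e0 ?mulr0//; apply: contra qp => /eqP pq.
by apply/eqP; apply: (uniq_map_inj uD).
Qed.

(* [al] is a combination of [b] and of eigenvectors of [Y *m Y] whose squared
   coefficients are the residues of [chi_fractions] divided by [4 |b|^2]. *)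
Lemma realization Y b xs : Y \in so_m R m -> Y *m b^T = 0 -> b != 0 ->
  char_poly Y = psi xs -> size xs = k -> interlaced k a xs ->
  exists al g, O g /\ gmx Y 0 b al = g *m T *m invmx g.
Proof.
move=> sY Yb b0 cY sxs I; have [c [D [uD sD wD E]]] := chi_fractions sxs I.
have bT0 : b^T != 0.
  by apply: contra b0 => /eqP bT; rewrite -(trmxK b) bT trmx0.
have [e He] : exists e : R -> 'cV[R]_m, {in D, forall p,
    [/\ Y *m (Y *m e p.1) = p.1 *: e p.1, edot (e p.1) (e p.1) = 1 &
        edot b^T (e p.1) = 0]}.
  have H d : exists v : 'cV[R]_m, d \in [seq p.1 | p <- D] ->
    [/\ Y *m (Y *m v) = d *: v, edot v v = 1 & edot b^T v = 0].
    have [/mapP[p /sD[t txs ->] ->]|_] := boolP (d \in [seq p.1 | p <- D]).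
      by have [v Hv] := skew_eigenvector sY Yb b0 cY txs; exists v.
    by exists 0.
  by have [e He] := choice H; exists e => p pD; apply: He; exact: map_f.
set B := b^T in Yb bT0 He; pose b2 := edot B B.
have b2p : 0 < b2 by rewrite edot_gt0.
have b2n : b2 != 0 by rewrite gt_eqF.
pose f (p : R * R) := Num.sqrt p.2 / (2 * Num.sqrt b2).
have ff p : p \in D -> f p * f p = p.2 / (4 * b2).
  move=> pD; rewrite /f mulrACA -invfM -!expr2 sqr_sqrtr ?wD// exprMn.
  by rewrite sqr_sqrtr ?(ltW b2p)//; congr (_ / (_ * _)); ring.
have ee : {in D &, forall p q, p.1 != q.1 -> edot (e p.1) (e q.1) = 0}.
  move=> p q pD qD pq; have [Ep _ _] := He _ pD; have [Eq _ _] := He _ qD.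
  have := skew_edot sY (Y *m e p.1) (e q.1).
  rewrite Ep (skew_edot sY (e p.1)) Eq opprK edotZl edotZr => /eqP.
  by rewrite -subr_eq0 -mulrBl mulf_eq0 subr_eq0 (negbTE pq) /= => /eqP.
have e1 : {in D, forall p, edot (e p.1) (e p.1) = 1} by move=> p /He[].
(* Matched with [det_resolvent_sq]: the [B] component makes the pairing of [al] and [b] equal to
   [c / 4], and its contribution to the last term cancels the square of that pairing; the other
   components yield the prescribed residues. *)
pose aT := (c / 4 / b2) *: B + \sum_(p <- D) f p *: e p.1.
have Bsum (h : R * R -> R) : edot B (\sum_(p <- D) h p *: e p.1) = 0.
  rewrite edot_sumr big_seq big1// => p /He[_ _ Bp].
  by rewrite edotZr Bp mulr0.
exists aT^T.
have [|g Og ->] := @char_poly_conj R k a size_a a_decr a_pos (gmx Y 0 b aT^T) (gmx_g _ _ _ sY);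
  last by exists g.
apply: (@poly_eq_large R 0) => t t0; rewrite char_poly_horner E//.
have tn : t != 0 by rewrite gt_eqF.
have tp p : p \in D -> t ^+ 2 - p.1 != 0.
  move=> /sD[s _ ->]; rewrite opprK gt_eqF// ltr_wpDr ?sqr_ge0//.
  by rewrite exprn_gt0.
pose y := (c / 4 / b2 / t ^+ 2) *: B + \sum_(p <- D) (f p / (t ^+ 2 - p.1)) *: e p.1.
have Ey : (t ^+ 2)%:M *m y - Y *m (Y *m y) = (aT^T)^T.
  rewrite trmxK mul_scalar_mx /y !mulmxDr -!scalemxAr Yb mulmx0 scaler0 add0r.
  rewrite scalerDr scalerA -addrA /aT; congr (_ *: _ + _); first by field; rewrite ?b2n ?tn.
  rewrite !mulmx_sumr scaler_sumr -sumrB big_seq [RHS]big_seq.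
  apply: eq_bigr => p pD; have [Ep _ _] := He _ pD.
  rewrite -!scalemxAr Ep !scalerA -scalerBl; congr (_ *: _).
  by field; exact: tp.
rewrite (det_resolvent_sq sY Yb tn Ey) trmxK -char_poly_resm cY; congr (_ * _).
have aB : edot aT B = c / 4.
  by rewrite edotC /aT edotDr edotZr Bsum addr0 -/b2; field.
have ay : edot aT y = (c / 4) ^+ 2 / b2 / t ^+ 2 +
    \sum_(p <- D) p.2 / (t ^+ 2 - p.1) / (4 * b2).
  rewrite /aT /y edotDl edotZl 2!edotDr !edotZr !Bsum.
  rewrite (edotC _ B) Bsum orthonormal_sum// -/b2 !mulr0 addr0 add0r.
  congr (_ + _); first by field; rewrite b2n tn.
  rewrite big_seq [RHS]big_seq; apply: eq_bigr => p pD.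
  by rewrite mulrA ff//; field; rewrite b2n tp.
rewrite aB ay -mulr_suml -/B -/b2; field; exact/andP.
Qed.

End Realization.

Lemma nodepoly_root (R : rcfType) (L : seq (R * R)) p :
  uniq [seq x.1 | x <- L] -> p \in L -> (nodepoly L).[p.1] = 0 -> p.2 = 0.
Proof.
elim: L => [|q L IH] //= /andP[qL uL]; rewrite inE hornerD hornerZ hornerM.
rewrite hornerXsubC horner_prod => /orP[/eqP->|pL].
  rewrite subrr mul0r addr0 => /eqP; rewrite mulf_eq0 => /orP[/eqP//|].
  rewrite prodf_seq_eq0 => /hasP[r rL /=]; rewrite hornerXsubC subr_eq0 => /eqP qr.
  by case/negP: qL; rewrite qr; exact: map_f.
rewrite (big_rem p)//= hornerXsubC subrr mul0r mulr0 add0r => /eqP.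
rewrite mulf_eq0 subr_eq0 => /orP[/eqP pq|/eqP]; last exact: IH.
by case/negP: qL; rewrite -pq; exact: map_f.
Qed.

(** * Separation of orbits *)

Section OrbitSeparation.
Context (R : realType) (k : nat).
Notation m := (k.*2.+1).
Notation O := (@lorentz_group R m).
Notation ep := (ep R m).
Notation em := (em R m).
Variable a : seq R.
Hypothesis size_a : size a = k.+1.
Hypothesis a_decr : forall i j : nat, (i < j < k)%N -> a`_j < a`_i.
Hypothesis a_pos : forall i : nat, (i < k.+1)%N -> 0 < a`_i.
Implicit Types (x : 'cV[R]_m) (X Z g h A B : 'M[R]_(m + 2)) (Y : 'M[R]_m).
Implicit Types (b al : 'rV[R]_m).
Notation T := (t' m a).
Notation Tinf := (ginf_mx R m *m t' m a *m invmx (ginf_mx R m)).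
Notation ak := (a`_k).

Lemma conjM g h X : O g -> O h ->
  g *m (h *m X *m invmx h) *m invmx g = (g *m h) *m X *m invmx (g *m h).
Proof.
move=> Og Oh; have -> : invmx (g *m h) = invmx h *m invmx g.
  apply: (can_inj (mulKmx (lorentz_unit (lorentzM Og Oh)))).
  rewrite lorentz_mulV; last exact: lorentzM.
  by rewrite -mulmxA (mulmxA h) lorentz_mulV// mul1mx lorentz_mulV.
by rewrite !mulmxA.
Qed.

Lemma conj_vec g X (v : 'cV[R]_(m + 2)) : O g -> (g *m X *m invmx g) *m (g *m v) = g *m (X *m v).
Proof. by move=> Og; rewrite -!mulmxA (mulmxA (invmx g)) lorentz_Vmul// mul1mx. Qed.

Lemma Tinf_ep : Tinf *m ep = - ak *: ep.
Proof.
have Og := ginf_lorentz R k.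
have E : ep = ginf_mx R m *m (- em) by rewrite mulmxN ginf_em opprK.
rewrite {1}E conj_vec// mulmxN t'_em// -scaleNr opprK -scalemxAr ginf_em.
by rewrite scalerN scaleNr.
Qed.

(* [ep] pulls back to a null eigenvector of [T], hence to a multiple of [ep] or
   [em]; these are exchanged, up to sign, by the matrix of g'_infinity. *)
Lemma depth_zero_class g X c : O g -> X = g *m T *m invmx g ->
  X *m ep = c *: ep ->
  exists2 A, Pmx A & (X = A *m T *m invmx A /\ c = ak) \/
                     (X = A *m Tinf *m invmx A /\ c = - ak).
Proof.
move=> Og XT Xep; have akn : ak != 0 by rewrite gt_eqF// a_pos.
have [x [p [q gx']]] := nvecP (invmx g *m ep).
have gx : g *m nvec x p q = ep by rewrite -gx' mulmxA lorentz_mulV// mul1mx.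
have Ev : T *m nvec x p q = c *: nvec x p q.
  have := Xep; rewrite -gx XT conj_vec// scalemxAr.
  by move=> /(can_inj (mulKmx (lorentz_unit Og))).
have null : edot x x + 4 * (p * q) = 0.
  have := lorentz_ldot (nvec x p q) (nvec x p q) Og.
  by rewrite gx ldot_pp ldot_nvec => E; rewrite [RHS]E; ring.
have := Ev; rewrite t'_nvec// nvecZ => /nvec_inj[_ Ep Eq].
(* The null coordinates are scaled by [ak] and [- ak], so at most one survives in an eigenvector;
   being null, the vector then has [x = 0]. *)
have pq : p * q = 0.
  have [->|p0] := eqVneq p 0; first by rewrite mul0r.
  have [->|q0] := eqVneq q 0; first by rewrite mulr0.
  have ca : ak = c by exact: (mulIf p0).
  have cb : - ak = c by apply: (mulIf q0); rewrite mulNr.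
  have : ak *+ 2 == 0 by rewrite mulr2n addr_eq0 cb ca.
  by rewrite mulrn_eq0 /= (negbTE akn).
have x0 : x = 0 by apply/eqP; rewrite -edot_eq0 -null pq mulr0 addr0.
have [p0|p0] := eqVneq p 0.
  have q0 : q != 0.
    apply/eqP => q0; have := ep_neq0 R m.
    by rewrite -gx x0 p0 q0 nvec0 mulmx0 eqxx.
  have cE : c = - ak by apply: (mulIf q0); rewrite mulNr Eq.
  have gem : g *m em = q^-1 *: ep.
    by rewrite -gx x0 p0 scalemxAr nvecZ emE !mulr0 scaler0 mulVf.
  have Og' := lorentzM Og (lorentzV (ginf_lorentz R k)).
  have gi : invmx (ginf_mx R m) *m ep = - em.
    rewrite -[ep]opprK -ginf_em mulmxN mulmxA lorentz_Vmul ?mul1mx//.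
    exact: ginf_lorentz.
  have g'ep : g *m invmx (ginf_mx R m) *m ep = - q^-1 *: ep.
    by rewrite -mulmxA gi mulmxN gem scaleNr.
  have qn : - q^-1 != 0 by rewrite oppr_eq0 invr_eq0.
  have [h [Oh hT hg PA]] := Pmx_adjust size_a Og' qn g'ep.
  exists (g *m invmx (ginf_mx R m) *m h) => //; right; split=> //.
  have Oi := ginf_lorentz R k.
  have AE : g *m invmx (ginf_mx R m) *m h *m ginf_mx R m = g *m h.
    by rewrite -mulmxA hg mulmxA mulmxKV// lorentz_unit.
  by rewrite conjM ?AE ?t'_conjM//; exact: lorentzM.
have cE : c = ak by apply: (mulIf p0).
have gep : g *m ep = p^-1 *: ep.
  have pq0 : q = 0 by move/eqP: pq; rewrite mulf_eq0 (negbTE p0) /= => /eqP.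
  by rewrite -{2}gx x0 pq0 scalemxAr nvecZ epE !mulr0 scaler0 mulVf.
have pn : p^-1 != 0 by rewrite invr_eq0.
have [h [Oh hT hg PA]] := Pmx_adjust size_a Og pn gep.
by exists (g *m h) => //; left; split=> //; rewrite t'_conjM.
Qed.

(** Intertwining the two normal forms, [B] fixes the image $2b$ of [ep]. The next image lies in the
    plane of [ep] and [em], so [em] goes to [em + r *: ep], and nullity gives [r = 0]: [B] is a
    block of size [m]. *)
Lemma fix_ep_structure B Y b al al' : O B -> B *m ep = ep -> Y *m b^T = 0 ->
  b != 0 -> B *m gmx Y 0 b al = gmx Y 0 b al' *m B ->
  exists kp : 'M[R]_m, [/\ kp *m kp^T = 1%:M, kp *m Y = Y *m kp,
    kp *m b^T = b^T & \det B = \det kp].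
Proof.
move=> OB Be Yb b0 BZ; have b2 : edot b^T b^T != 0.
  by rewrite edot_eq0; apply: contra b0 => /eqP bT; rewrite -(trmxK b) bT trmx0.
have Ze al1 : gmx Y 0 b al1 *m ep = nvec (2 *: b^T) 0 0 by exact: gmx_ep.
have Zx al1 x : gmx Y 0 b al1 *m nvec x 0 0 =
    nvec (Y *m x) (edot al1^T x) (- edot b^T x).
  by rewrite gmx_nvec !mulr0 !scale0r addr0 !subr0 addr0.
have BZv (v : 'cV[R]_(m + 2)) : B *m (gmx Y 0 b al *m v) = gmx Y 0 b al' *m (B *m v).
  by rewrite !mulmxA BZ.
have Bb : B *m nvec (2 *: b^T) 0 0 = nvec (2 *: b^T) 0 0.
  by rewrite -(Ze al) BZv Be Ze.
have Bm0 : B *m nvec 0 (edot al^T (2 *: b^T)) (- edot b^T (2 *: b^T)) =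
    nvec 0 (edot al'^T (2 *: b^T)) (- edot b^T (2 *: b^T)).
  have := BZv (nvec (2 *: b^T) 0 0).
  by rewrite Bb !Zx -!scalemxAr Yb !scaler0.
pose r := (edot al^T (2 *: b^T) - edot al'^T (2 *: b^T)) / (2 * edot b^T b^T).
have Bm1 : B *m em = em + r *: ep.
  have := Bm0; rewrite (nvec_sum 0) (nvec_sum 0 (edot al'^T _)) nvec0 !add0r.
  rewrite mulmxDr -!scalemxAr Be => E.
  have bn : - edot b^T (2 *: b^T) != 0 by rewrite oppr_eq0 edotZr mulf_neq0.
  apply: (scalerI bn).
  transitivity (edot al'^T (2 *: b^T) *: ep + - edot b^T (2 *: b^T) *: em -
    edot al^T (2 *: b^T) *: ep); first by rewrite -E addrAC subrr add0r.
  rewrite scalerDr scalerA addrAC addrC -scalerBl; congr (_ + _ *: _).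
  by rewrite /r !edotZr; field.
have r0 : r = 0.
  have := lorentz_ldot em em OB; rewrite Bm1 !ldotE ldot_mm ldot_pp ldot_pm.
  by rewrite (ldotC em ep) ldot_pm => H; lra.
have Bm : B *m em = 1^-1 *: em by rewrite Bm1 r0 scale0r addr0 invr1 scale1r.
have Bp : B *m ep = 1 *: ep by rewrite scale1r.
have [kp kk BE] := kblock_split OB ltr01 Bp Bm.
have Bx x p q : B *m nvec x p q = nvec (kp *m x) p q.
  by rewrite BE -mulmxA expmx_H0_nvec kblock_nvec ln1 oppr0 expR0 !mul1r.
exists kp; split=> //.
- apply: mulmx_vec_inj => x.
  have := BZv (nvec x 0 0); rewrite Zx !Bx Zx => /nvec_inj[+ _ _].
  by rewrite !mulmxA.
- have /nvec_inj[+ _ _] : nvec (kp *m (2 *: b^T)) 0 0 = nvec (2 *: b^T) 0 0 :> 'cV[R]_(m + 2).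
    by rewrite -Bx Bb.
  by rewrite -scalemxAr => /scalerI -> //; rewrite pnatr_eq0.
- have -> : B = kblock kp by apply: mulmx_nvec_inj => x p q; rewrite Bx kblock_nvec.
  exact: det_kblock.
Qed.

(** A nonzero weight at the node 0 makes 0 a simple root of the characteristic polynomial of [Y],
    the root belonging to [b]. *)
Lemma kernel_trivial g X Y b al x p q : O g -> X = g *m T *m invmx g ->
  Y \in so_m R m -> Y *m b^T = 0 -> b != 0 -> X = gmx Y 0 b al ->
  g *m nvec x p q = ep -> Wv a x 0 != 0 ->
  forall z, Y *m z = 0 -> edot b^T z = 0 -> z = 0.
Proof.
move=> Og XT sY Yb b0 XZ gx W0 z Yz bz; apply/eqP/negPn/negP => z0.
have ak0 : 0 < ak by exact: a_pos.
have b2 : edot b^T b^T != 0.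
  by rewrite edot_eq0; apply: contra b0 => /eqP bT; rewrite -(trmxK b) bT trmx0.
(* Moves the eigenvalue of [b] from 0 to $-|b|^2$. A second kernel vector would make [M] singular,
   whereas the value of its characteristic polynomial at 0 is a quarter of the numerator at the node
   0. *)
pose M := Y - b^T *m b.
have bb : b *m b^T = (edot b^T b^T)%:M by rewrite -edot_mx trmxK.
have CE : (4 * edot b^T b^T) *: char_poly M =
    ('X + (edot b^T b^T)%:P) * (nodepoly (wnodes a x) \Po 'X^2).
  apply: (@poly_eq_large R ak) => t t_ak.
  have t0 : t != 0 by rewrite gt_eqF// (lt_trans ak0).
  have tak : t ^+ 2 != ak ^+ 2.
    by rewrite gt_eqF// ltr_pXn2r ?nnegrE ?ltW// (lt_trans ak0).
  have E : t%:M - M = resm Y t *m (1%:M - (- t^-1 *: b^T) *m b).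
    rewrite mulmxBr mulmx1 mulmxA; have -> : resm Y t *m (- t^-1 *: b^T) = - b^T.
      by rewrite resmE -scalemxAr Yb scaler0 subr0 scalerA mulrN mulfV// scaleN1r.
    by rewrite mulNmx opprK /M /resm opprB addrA addrAC.
  rewrite hornerZ char_poly_horner E det_mulmx det_sylvester -scalemxAr bb det_mx11.
  rewrite [_ 0 0](_ : _ = 1 + t^-1 * edot b^T b^T); last first.
    by rewrite !mxE !eqxx !mulr1n mulNr opprK.
  rewrite mulrA (resolvent_identity size_a a_decr a_pos Og XT sY Yb XZ gx)//.
  rewrite hornerM horner_comp hornerD hornerX hornerC hornerXn; by field.
have M0 : (char_poly M).[0] = 0.
  rewrite char_poly_horner; apply/eqP; rewrite -[_ == 0]negbK -unitfE -unitmxE.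
  apply/negP => uM; case/eqP: z0.
  rewrite -[z](mulKmx uM) mulmxBl mul_scalar_mx scale0r sub0r /M mulmxBl Yz.
  rewrite -mulmxA; have -> : b *m z = 0.
    by rewrite -[b]trmxK edot_mx bz raddf0.
  by rewrite mulmx0 subr0 oppr0 mulmx0.
have := congr1 (horner^~ 0) CE; rewrite hornerZ M0 mulr0 hornerM hornerD hornerX.
rewrite hornerC add0r horner_comp hornerXn expr0n /= => /esym /eqP.
rewrite mulf_eq0 (negbTE b2) /= => /eqP n0.
have w0 : (0, Wv a x 0 * (ak ^+ 2 - 0)) \in wnodes a x.
  by apply: (map_f (fun y => (y, Wv a x y * (ak ^+ 2 - y)))); rewrite mem_rcons mem_head.
have := @nodepoly_root R (wnodes a x) _ _ w0 n0.
rewrite wnodes1 /= => /(_ (nodes_uniq size_a a_decr a_pos)) /eqP.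
by rewrite mulf_eq0 (negbTE W0) /= subr0 sqrf_eq0 gt_eqF.
Qed.

(** By [Wv_inj] the two pullbacks of [ep] have the same canonical form under the centralizer of t',
    hence a Lorentz matrix fixing [ep] conjugates one normal form into the other. What remains is
    its determinant. *)
Lemma normal_form_conj g g' Y b al al' : O g -> O g' ->
  gmx Y 0 b al = g *m T *m invmx g -> gmx Y 0 b al' = g' *m T *m invmx g' ->
  Y \in so_m R m -> Y *m b^T = 0 -> b != 0 ->
  exists2 B, Pmx B & gmx Y 0 b al' = B *m gmx Y 0 b al *m invmx B.
Proof.
move=> Og Og' ZT ZT' sY Yb b0.
have bT0 : b^T != 0.
  by apply: contra b0 => /eqP bT; rewrite -(trmxK b) bT trmx0.
have normalized g1 al1 : O g1 -> gmx Y 0 b al1 = g1 *m T *m invmx g1 ->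
    exists h x p q, [/\ O h, T *m h = h *m T, g1 *m nvec x p q = ep &
      (g1 *m h) *m nvec (canon_coord a x) 1 (p * q) = ep].
  move=> O1 Z1; have [x [p [q gx']]] := nvecP (invmx g1 *m ep).
  have gx : g1 *m nvec x p q = ep by rewrite -gx' mulmxA lorentz_mulV// mul1mx.
  (* Otherwise the pullback is a multiple of [em], and [ep] is an eigenvector, against [b != 0]. *)
  have p0 : p != 0.
    apply/eqP => p0; have := lorentz_ldot (nvec x p q) (nvec x p q) O1.
    rewrite gx ldot_pp ldot_nvec p0 mul0r mulr0 addr0 mulr0 addr0 => /esym /eqP.
    rewrite edot_eq0 => /eqP x0.
    have Te : T *m nvec x p q = - ak *: nvec x p q.
      by rewrite t'_nvec// x0 p0 mulmx0 nvecZ scaler0 !mulr0 mulNr.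
    have := gmx_ep Y 0 b al1; rewrite Z1 -gx conj_vec// Te -scalemxAr gx epE nvecZ.
    move=> /nvec_inj[/esym /eqP + _ _]; rewrite scaler0 scaler_eq0 pnatr_eq0 /=.
    by rewrite (negbTE bT0).
  have [h [Oh Th vE]] := t'_canonical size_a a_decr a_pos x q p0.
  by exists h, x, p, q; rewrite -mulmxA -vE.
have [h [x [p [q [Oh Th gx hx]]]]] := normalized _ _ Og ZT.
have [h' [x' [p' [q' [Oh' Th' gx' hx']]]]] := normalized _ _ Og' ZT'.
have [WE pqE] := Wv_inj size_a a_decr a_pos Og ZT Og' ZT' sY Yb erefl erefl gx gx'.
have cE : canon_coord a x = canon_coord a x'.
  apply/colP => i; rewrite !mxE; case: ifP => // _.
  by rewrite WE// mu_nodes.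
have Ogh := lorentzM Og Oh; have Ogh' := lorentzM Og' Oh'.
(* [N] is the remaining freedom: an element of the centralizer that fixes the canonical vector. It
   is [1%:M] at first and [det_flip] for the correction. *)
have step N : O N -> T *m N = N *m T ->
    N *m nvec (canon_coord a x') 1 (p' * q') = nvec (canon_coord a x') 1 (p' * q') ->
    let B := g' *m h' *m N *m invmx (g *m h) in
    [/\ O B, B *m ep = ep & gmx Y 0 b al' = B *m gmx Y 0 b al *m invmx B].
  move=> ON TN Nv; set G := g' *m h' *m N; set H := g *m h => B.
  have OG : O G by exact: lorentzM.
  have OH : O H by [].
  have OB : O B by apply: lorentzM => //; exact: lorentzV.
  have BH : B *m H = G by rewrite mulmxKV// lorentz_unit.
  have ZH : gmx Y 0 b al = H *m T *m invmx H by rewrite t'_conjM.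
  have ZG : gmx Y 0 b al' = G *m T *m invmx G.
    have -> : G = g' *m (h' *m N) by rewrite mulmxA.
    rewrite t'_conjM//; first exact: lorentzM.
    by rewrite -mulmxA -TN mulmxA -Th' mulmxA.
  split=> //; last by rewrite ZG ZH conjM// BH.
  rewrite -[in LHS]hx -/H mulmxA BH cE pqE /G -mulmxA Nv.
  exact: hx'.
have [OB1 Be1 Z1] := step 1%:M (lorentz1 R m) (etrans (mulmx1 _) (esym (mul1mx _))) (mul1mx _).
set B1 := g' *m h' *m _ *m _ in OB1 Be1 Z1.
have Pdet B : O B -> B *m ep = ep -> \det B = 1 -> Pmx B.
  by move=> OB Be dB; split=> //; exists 1 => //; rewrite scale1r.
case: (det_lorentz OB1) => dB; first by exists B1 => //; exact: Pdet.
(* The last coordinate of the canonical vector is the square root of this weight, so when it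
   vanishes [det_flip] fixes that vector. Otherwise the determinant is 1 by [kernel_trivial] and
   [det_orth_commute], whatever the choices. *)
have [W0|W0] := eqVneq (Wv a x 0) 0.
  have [|OB2 Be2 Z2] := step (det_flip R k) (det_flip_lorentz R k) (esym (det_flip_t' size_a)).
    rewrite det_flip_nvec; congr nvec; apply/colP => i; rewrite flip_lastE.
    case: eqP => ik; last by rewrite mul1r.
    rewrite mxE ik odd_double mu_last.
    rewrite -WE; last by rewrite mem_rcons mem_head.
    by rewrite W0 sqrtr0 mulr0.
  exists (g' *m h' *m det_flip R k *m invmx (g *m h)) => //.
  apply: Pdet => //; move: dB; rewrite /B1 mulmx1 det_mulmx => dB.
  by rewrite det_mulmx (det_mulmx _ (det_flip R k)) det_det_flip mulrAC dB mulrNN mulr1.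
have BZ : B1 *m gmx Y 0 b al = gmx Y 0 b al' *m B1.
  by rewrite Z1 mulmxKV// lorentz_unit.
have [kp [kk kY kb dE]] := fix_ep_structure OB1 Be1 Yb b0 BZ.
exists B1 => //; apply: Pdet => //; rewrite dE.
apply: (det_orth_commute (so_m_tr sY) kk kY kb).
exact: (kernel_trivial Og ZT sY Yb b0 erefl gx W0).
Qed.

End OrbitSeparation.

(** * The image and the fibres of the moment map *)

Section MomentImage.
Context (R : realType) (k : nat).
Notation m := (k.*2.+1).
Context (G : topologicalGroupType) (cov : G -> 'M[R]_(m + 2)).
Hypothesis G_Spin : is_Spin cov.
Variables (ginf : G) (a : seq R).
Hypothesis cov_ginf : cov ginf = ginf_mx R m.
Hypothesis size_a : size a = k.+1.
Hypothesis a_decr : forall i j : nat, (i < j < k)%N -> a`_j < a`_i.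
Hypothesis a_pos : forall i : nat, (i < k.+1)%N -> 0 < a`_i.
Notation O := (@lorentz_group R m).
Notation ep := (ep R m).
Notation T := (t' m a).
Notation Tinf := (ginf_mx R m *m t' m a *m invmx (ginf_mx R m)).
Notation ak := (a`_k).
Notation Of := (G_orbit cov (iotag T)).
Notation q := (@moment R m).
Implicit Types (g X A B : 'M[R]_(m + 2)).

(** [G] acts through SO_e only, but by [SOe_adjust] the centralizer of t' compensates for the
    component, so arbitrary Lorentz conjugates are allowed. *)
Lemma G_orbitP h : Of h <-> exists2 g, O g & h = iotag (g *m T *m invmx g).
Proof.
split=> [[g _ <-]|[g Og ->]].
  exists (cov g); first exact: cov_lorentz.
  by rewrite coad_iotag// AdE.
have [h' [Oh hT Sgh]] := SOe_adjust size_a Og.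
have [g' g'E] := cov_surj G_Spin Sgh; exists g' => //.
by rewrite coad_iotag// AdE// g'E t'_conjM.
Qed.

Lemma conj_g g : O g -> g *m T *m invmx g \in g_alg R m.
Proof. by move=> Og; apply: g_conj => //; exact: t'_g. Qed.

Lemma conj_Pmx A g : O g -> Pmx A ->
  A *m (g *m T *m invmx g) *m invmx A = (A *m g) *m T *m invmx (A *m g).
Proof. by move=> Og PA; rewrite conjM//; exact: Pmx_lorentz. Qed.

Lemma TinfE : moment (coad cov ginf (iotag T)) = pr Tinf.
Proof. by rewrite coad_iotag// AdE// cov_ginf. Qed.

Lemma pr_Pmx A X X' : Pmx A -> pr X = pr X' ->
  pr (A *m X *m invmx A) = pr (A *m X' *m invmx A).
Proof.
move=> PA XX; have [g Pg gA] := Pmx_lift G_Spin PA.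
have := congr1 (coad cov g) XX; rewrite !coad_pr//.
by rewrite !AdE// gA.
Qed.

Lemma depth_zero_orbits :
  [/\ depth_zero cov (P_orbit cov (pr T)), depth_zero cov (P_orbit cov (pr Tinf)) &
      P_orbit cov (pr T) <> P_orbit cov (pr Tinf)].
Proof.
have gT := t'_g size_a; have Oi := ginf_lorentz R k.
have gTi := conj_g Oi; split.
- by apply/depth_zero_pr => //; exists ak; exact: t'_ep.
- by apply/depth_zero_pr => //; exists (- ak); exact: Tinf_ep.
move=> E; have : P_orbit cov (pr Tinf) (pr T) by rewrite -E; exact: P_orbit_refl.
(* The eigenvalue on [ep] separates the two orbits: conjugation by P preserves it, [X_ al] kills
   [ep], and it is [ak] on one side and [- ak] on the other. *)
move=> /(P_orbit_pr G_Spin)[A PA]; have OA := Pmx_lorentz PA.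
move=> /(pr_eqP gT (g_conj OA gTi))[al TE].
have [_ _ [c c0 cA]] := PA; have cn : c != 0 by rewrite gt_eqF.
have TA : (A *m Tinf *m invmx A) *m ep = - ak *: ep.
  have {1}-> : ep = A *m (c^-1 *: ep).
    by rewrite -scalemxAr cA scalerA mulVf ?scale1r.
  rewrite conj_vec// -scalemxAr Tinf_ep// -!scalemxAr cA !scalerA.
  by congr (_ *: _); field.
have : T *m ep = - ak *: ep.
  rewrite TE mulmxDl TA epE X_nvec edot0r.
  by rewrite !mulr0 oppr0 scale0r nvec0 addr0.
rewrite t'_ep// => /eqP; rewrite -subr_eq0 -scalerBl scaler_eq0 (negbTE (ep_neq0 R m)).
by rewrite orbF opprK -mulr2n mulrn_eq0 /= gt_eqF// a_pos.
Qed.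

Lemma image_sub X g : O g -> X = g *m T *m invmx g ->
  (exists c, X *m ep = c *: ep) ->
  P_orbit cov (pr T) (pr X) \/ P_orbit cov (pr Tinf) (pr X).
Proof.
move=> Og XT [c Xc]; have [A PA [[-> _]|[-> _]]] := depth_zero_class size_a a_pos Og XT Xc.
  by left; apply/P_orbit_pr => //; exists A.
by right; apply/P_orbit_pr => //; exists A.
Qed.

Definition interlaced_orbits : set (set (lin_dual (p_alg R m))) :=
  [set O1 | depth_one cov O1 /\ exists x : k.-tuple R,
     orbit_singular_values O1 x /\ interlaced k a x].

Lemma image_depth_one X g : O g -> X = g *m T *m invmx g ->
  ~ (exists c, X *m ep = c *: ep) -> interlaced_orbits (P_orbit cov (pr X)).
Proof.
move=> Og XT NX; have gX : X \in g_alg R m by rewrite XT; exact: conj_g.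
have [A [Y [b [al [PA sY b0 Yb ZE]]]]] := normal_form gX NX.
have OAg := lorentzM (Pmx_lorentz PA) Og.
have ZT : A *m X *m invmx A = (A *m g) *m T *m invmx (A *m g).
  by rewrite XT conj_Pmx.
have [xs [sxs I cY]] := interlacing size_a a_decr a_pos OAg ZT sY Yb b0 ZE.
split; first exact/depth_one_pr.
exists xs; split=> //; split=> //; exists Y, b; split=> //.
  have -> : pr (X_Ybeta0 Y b) = pr (A *m X *m invmx A).
    rewrite ZE; apply/esym/pr_eqP; first exact: gmx_g.
      have -> : X_Ybeta0 Y b = gmx Y 0 b 0.
        by rewrite -Xb_gmx linear0 addr0.
      exact: gmx_g.
    by exists al; rewrite Xb_gmx.
  by apply/P_orbit_pr => //; exists A.
apply/singular_valuesP => //; split=> //.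
apply/(all_nthP 0) => i; rewrite size_tuple => ik.
by have [_ _ x0] := I; exact: x0.
Qed.

Lemma image_sup O1 h : interlaced_orbits O1 -> O1 h -> (q @` Of) h.
Proof.
move=> [[oO1 _] [xs [[_ [Y [b [sY b0 Yb O1Y sv]]]] I]]] O1h.
have [xs0 cY] := (singular_valuesP xs sY).1 sv.
have [al [g [Og ZE]]] := realization size_a a_decr a_pos sY Yb b0 cY (size_tuple xs) I.
have O1E := is_P_orbitE G_Spin (@P_stable_p R m G cov G_Spin) oO1 O1Y.
have prE : pr (X_Ybeta0 Y b) = pr (gmx Y 0 b al).
  apply/esym/pr_eqP; first exact: gmx_g.
    have -> : X_Ybeta0 Y b = gmx Y 0 b 0 by rewrite -Xb_gmx linear0 addr0.
    exact: gmx_g.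
  by exists al; rewrite Xb_gmx.
move: O1h; rewrite O1E prE ZE => /(P_orbit_pr G_Spin)[A PA ->].
rewrite conj_Pmx//; exists (iotag ((A *m g) *m T *m invmx (A *m g))) => //.
by apply/G_orbitP; exists (A *m g) => //; apply: lorentzM => //; exact: Pmx_lorentz.
Qed.

Lemma P_orbit_image X h g : O g -> X = g *m T *m invmx g ->
  P_orbit cov (pr X) h -> (q @` Of) h.
Proof.
move=> Og -> /(P_orbit_pr G_Spin)[A PA ->]; rewrite conj_Pmx//.
exists (iotag ((A *m g) *m T *m invmx (A *m g))) => //.
by apply/G_orbitP; exists (A *m g) => //; apply: lorentzM => //; exact: Pmx_lorentz.
Qed.

Lemma moment_image : q @` Of = P_orbit cov (pr T) `|` P_orbit cov (pr Tinf) `|`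
  \bigcup_(O1 in interlaced_orbits) O1.
Proof.
apply/seteqP; split=> h.
  move=> [_ /G_orbitP[g Og ->] <-]; set X := g *m T *m invmx g.
  have [Xc|NX] := pselect (exists c, X *m ep = c *: ep).
    by left; have [H|H] := image_sub Og erefl Xc; [left|right].
  right; exists (P_orbit cov (pr X)); first exact: (image_depth_one Og erefl NX).
  exact: P_orbit_refl.
move=> [[H|H]|[Q QI Qh]]; last exact: image_sup QI Qh.
- apply: (P_orbit_image (lorentz1 R m)) H.
  by rewrite mul1mx invmx1 mulmx1.
- exact: (P_orbit_image (ginf_lorentz R k) erefl) H.
Qed.

(** When [ep] is an eigenvector, its eigenvalue is common to [X] and [X'] and selects the same
    conjugate of t' for both. Otherwise the [A] that normalizes [X] also normalizes [X']: the
    difference stays in n and affects only [al]. *)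
Lemma conj_of_pr_eq X X' g g' : O g -> O g' -> X = g *m T *m invmx g ->
  X' = g' *m T *m invmx g' -> pr X = pr X' ->
  exists2 B, Pmx B & X' = B *m X *m invmx B.
Proof.
move=> Og Og' XT XT' XX.
have gX : X \in g_alg R m by rewrite XT; exact: conj_g.
have gX' : X' \in g_alg R m by rewrite XT'; exact: conj_g.
have akn : ak != 0 by rewrite gt_eqF// a_pos.
have inv A Z : O A -> invmx A *m (A *m Z *m invmx A) *m A = Z.
  by move=> OA; rewrite -!mulmxA !(mulmxA (invmx A) A) lorentz_Vmul// !mul1mx mulmx1.
have comp A A' Z : Pmx A -> Pmx A' -> exists2 B, Pmx B &
    A' *m Z *m invmx A' = B *m (A *m Z *m invmx A) *m invmx B.
  move=> PA PA'; exists (A' *m invmx A); first exact: PmxM PA' (PmxV PA).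
  have OA := Pmx_lorentz PA; have OA' := Pmx_lorentz PA'.
  rewrite conjM//; last by apply: lorentzM => //; exact: lorentzV.
  by rewrite mulmxKV// lorentz_unit.
have [Xc|NX] := pselect (exists c, X *m ep = c *: ep).
  have [c cX] := Xc; have [al XE] := (pr_eqP gX gX').1 XX.
  have cX' : X' *m ep = c *: ep.
    rewrite -cX XE mulmxDl {3}epE X_nvec edot0r.
    by rewrite mulr0 oppr0 scale0r nvec0 addr0.
  have two : - ak <> ak.
    move=> H; have : ak *+ 2 == 0 by rewrite mulr2n addr_eq0 H.
    by rewrite mulrn_eq0 /= (negbTE akn).
  have [A PA H] := depth_zero_class size_a a_pos Og XT cX.
  have [A' PA' H'] := depth_zero_class size_a a_pos Og' XT' cX'.
  case: H => [[-> ca]|[-> ca]]; case: H' => [[-> ca']|[-> ca']].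
  - exact: comp.
  - by case: two; exact: etrans (esym ca') ca.
  - by case: two; exact: etrans (esym ca) ca'.
  - exact: comp.
have [A [Y [b [al [PA sY b0 Yb ZE]]]]] := normal_form gX NX.
have OA := Pmx_lorentz PA.
have gZ' : A *m X' *m invmx A \in g_alg R m by exact: g_conj.
have gZ : gmx Y 0 b al \in g_alg R m by exact: gmx_g.
have := pr_Pmx PA XX; rewrite ZE => /esym/(pr_eqP gZ' gZ)[al1 ZE'].
have {}ZE' : A *m X' *m invmx A = gmx Y 0 b (al + al1).
  by rewrite ZE' -!Xb_gmx -addrA linearD.
have ZT : gmx Y 0 b al = (A *m g) *m T *m invmx (A *m g).
  by rewrite -ZE XT conj_Pmx.
have ZT' : gmx Y 0 b (al + al1) = (A *m g') *m T *m invmx (A *m g').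
  by rewrite -ZE' XT' conj_Pmx.
have [B PB BE] := normal_form_conj size_a a_decr a_pos (lorentzM OA Og)
  (lorentzM OA Og') ZT ZT' sY Yb b0.
have PV := PmxV PA; have OV := Pmx_lorentz PV; have OB := Pmx_lorentz PB.
exists (invmx A *m B *m A); first exact: PmxM (PmxM PV PB) PA.
have E : X' = invmx A *m gmx Y 0 b (al + al1) *m A by rewrite -ZE' inv.
have VB : O (invmx A *m B) by exact: lorentzM.
rewrite E BE -ZE -[A in X in _ *m X = _]invmxK.
by rewrite [LHS]conjM// [LHS]conjM.
Qed.

Lemma moment_orbit_inj (O1 O2 : set (lin_dual (g_alg R m))) :
  is_P_orbit cov O1 -> O1 `<=` Of -> is_P_orbit cov O2 -> O2 `<=` Of ->
  q @` O1 = q @` O2 -> O1 = O2.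
Proof.
move=> [h1 ->] s1 [h2 ->] s2.
have [g1 Og1 E1] := (G_orbitP h1).1 (s1 _ (P_orbit_refl G_Spin h1)).
have [g2 Og2 E2] := (G_orbitP h2).1 (s2 _ (P_orbit_refl G_Spin h2)).
rewrite E1 E2 !moment_P_orbit// => E.
have : P_orbit cov (pr (g1 *m T *m invmx g1)) (pr (g2 *m T *m invmx g2)).
  by rewrite E; exact: P_orbit_refl.
move=> /(P_orbit_pr G_Spin)[A PA]; rewrite conj_Pmx// => /esym prE.
have OAg : O (A *m g1) by apply: lorentzM => //; exact: Pmx_lorentz.
have [B PB BE] := conj_of_pr_eq OAg Og2 erefl erefl prE.
apply/esym/(P_orbit_eq G_Spin (@P_stable_g R m G cov G_Spin)).
apply/P_orbit_iotag => //; exists (B *m A); first exact: PmxM.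
rewrite BE -conj_Pmx// conjM//; exact: Pmx_lorentz.
Qed.

Lemma moment_of_orbit (O1 : set (lin_dual (g_alg R m))) :
  is_P_orbit cov O1 -> O1 `<=` Of -> is_P_orbit cov (q @` O1).
Proof.
move=> [h ->] s; have [g Og ->] := (G_orbitP h).1 (s _ (P_orbit_refl G_Spin h)).
by rewrite moment_P_orbit//; exists (pr (g *m T *m invmx g)).
Qed.

End MomentImage.

(** The type of [cov] depends on [m]; the equation [hm] as a hypothesis allows substitution,
    [(2 * n).-1] and [n.-1.*2.+1] not being the same expression. *)
Lemma moment_map_theorem (R : realType) (k m : nat) (hm : m = k.*2.+1)
  (G : topologicalGroupType) (cov : G -> 'M[R]_(m + 2))
  (G_Spin : is_Spin cov)
  (ginf : G) (cov_ginf : cov ginf = ginf_mx R m)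
  (a : seq R) (size_a : size a = k.+1)
  (a_decr : forall i j : nat, (i < j < k)%N -> a`_j < a`_i)
  (a_pos : forall i : nat, (i < k.+1)%N -> 0 < a`_i) :
  let f : lin_dual (g_alg R m) := iotag (t' m a) in
  let Of := G_orbit cov f in
  let q := @moment R m in
  let O0 := P_orbit cov (q f) in
  let Oinf := P_orbit cov (q (coad cov ginf f)) in
  [/\ [/\ depth_zero cov O0, depth_zero cov Oinf & O0 <> Oinf],
      q @` Of = O0 `|` Oinf `|`
        \bigcup_(O in [set O | depth_one cov O /\
            exists x : k.-tuple R,
              orbit_singular_values O x /\ interlaced k a x]) O,
      (forall O, is_P_orbit cov O -> O `<=` Of -> is_P_orbit cov (q @` O)) &
      (forall O1 O2, is_P_orbit cov O1 -> O1 `<=` Of ->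
         is_P_orbit cov O2 -> O2 `<=` Of -> O1 <> O2 -> q @` O1 <> q @` O2)].
Proof.
subst m => f Of q O0 Oinf.
have OiE : Oinf = P_orbit cov (pr (ginf_mx R _ *m t' _ a *m invmx (ginf_mx R _))).
  by rewrite /Oinf /q /f (TinfE G_Spin _ cov_ginf).
split.
- by rewrite OiE; exact: depth_zero_orbits.
- by rewrite OiE; exact: moment_image.
- by move=> O1; exact: moment_of_orbit.
- move=> O1 O2 h1 s1 h2 s2 n12 E; apply: n12.
  exact: (moment_orbit_inj G_Spin size_a a_decr a_pos h1 s1 h2 s2 E).
Qed.

Unset Implicit Arguments.
Theorem proposition5p8 (R : realType) (n : nat) (n_ge2 : (2 <= n)%N)
  (G : topologicalGroupType) (cov : G -> 'M[R]_((2 * n).-1 + 2))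
  (G_Spin : is_Spin cov)
  (ginf : G) (cov_ginf : cov ginf = ginf_mx R (2 * n).-1)
  (a : n.-tuple R)
  (a_decr : forall i j : nat, (i < j < n.-1)%N -> a`_j < a`_i)
  (a_pos : forall i : nat, (i < n)%N -> 0 < a`_i) :
  let f : lin_dual (g_alg R (2 * n).-1) := iotag (t' (2 * n).-1 a) in
  let Of := G_orbit cov f in
  let q := @moment R (2 * n).-1 in
  let O0 := P_orbit cov (q f) in
  let Oinf := P_orbit cov (q (coad cov ginf f)) in
  [/\ [/\ depth_zero cov O0, depth_zero cov Oinf & O0 <> Oinf],
      q @` Of = O0 `|` Oinf `|`
        \bigcup_(O in [set O | depth_one cov O /\
            exists x : (n.-1).-tuple R,
              orbit_singular_values O x /\ interlaced n.-1 a x]) O,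
      (forall O, is_P_orbit cov O -> O `<=` Of -> is_P_orbit cov (q @` O)) &
      (forall O1 O2, is_P_orbit cov O1 -> O1 `<=` Of ->
         is_P_orbit cov O2 -> O2 `<=` Of -> O1 <> O2 -> q @` O1 <> q @` O2)].
Proof.
have n0 : (0 < n)%N by exact: ltnW.
apply: (@moment_map_theorem R n.-1) => //.
- by lia.
- by rewrite size_tuple prednK.
- by move=> i; rewrite prednK//; exact: a_pos.
Qed.
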